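(* Let $\phi$ be a quantum channel on $\mathcal M(d;\mathbb C)$. The following are equivalent: (1) $\phi$ is asymptotically entanglement-saving; (2) in the structure decomposition of the phase subspace $\chi_\phi=\big(\bigoplus_i\mathcal M_{d_i^{(1)}}\otimes\rho_{i,2}\big)\oplus 0$ (see context), at least one $d_i^{(1)}$ is strictly greater than $1$; (3) $\phi$ admits two phase points $Z_1,Z_2$ that do not commute, $[Z_1,Z_2]\neq0$.
   Context: A quantum channel is a completely positive, trace-preserving linear map on $\mathcal M(d;\mathbb C)$; spectral notions refer to it as a linear operator on $\mathcal M(d;\mathbb C)$. A phase point of $\phi$ is a nonzero matrix $Z$ with $\phi(Z)=e^{i\theta}Z$ for some $\theta\in\mathbb R$; the phase subspace $\chi_\phi$ is the linear span of all phase points. It is known (structure theorem for the phase subspace) that there is a subspace $\mathcal K\subseteq\mathbb C^d$ and an orthogonal decomposition $\mathcal K=\bigoplus_i\mathbb C^{d_i^{(1)}}\otimes\mathbb C^{d_i^{(2)}}$ together with density matrices $\rho_{i,2}$ on $\mathbb C^{d_i^{(2)}}$ such that, with respect to $\mathbb C^d=\mathcal K\oplus\mathcal K^\perp$, $\chi_\phi=\big(\bigoplus_i\mathcal M_{d_i^{(1)}}\otimes\rho_{i,2}\big)\oplus 0$, where $\mathcal M_n$ denotes all $n\times n$ complex matrices. A channel is entanglement-breaking if $(\psi\otimes I)(\rho)$ is separable for every bipartite state $\rho$. $\phi$ is asymptotically entanglement-saving (AES) if no limit point of the sequence $(\phi^n)_{n\in\mathbb N}$ of its powers is entanglement-breaking.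 *)

(* Defs.v *)
(* complex numbers built on Stdlib reals, matrices as
   index functions (only entries with indices < dimension are meaningful). *)
From Stdlib Require Import Reals List Arith.
Open Scope R_scope.

Record C := mkC { Re : R; Im : R }.
Definition C0 : C := mkC 0 0.
Definition C1 : C := mkC 1 0.
Definition Cadd (a b : C) : C := mkC (Re a + Re b) (Im a + Im b).
Definition Copp (a : C) : C := mkC (- Re a) (- Im a).
Definition Csub (a b : C) : C := Cadd a (Copp b).
Definition Cmul (a b : C) : C :=
  mkC (Re a * Re b - Im a * Im b) (Re a * Im b + Im a * Re b).
Definition Cconj (a : C) : C := mkC (Re a) (- Im a).
Definition Cabs (a : C) : R := sqrt (Re a * Re a + Im a * Im a).
Definition Cexpi (t : R) : C := mkC (cos t) (sin t).

Fixpoint Csum (n : nat) (f : nat -> C) : C :=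
  match n with O => C0 | S m => Cadd (Csum m f) (f m) end.

(* complex matrices; an n x n matrix is a Mat read on indices < n *)
Definition Mat := nat -> nat -> C.

Definition meq (n : nat) (A B : Mat) : Prop :=
  forall i j, (i < n)%nat -> (j < n)%nat -> A i j = B i j.
Definition mnonzero (n : nat) (A : Mat) : Prop :=
  exists i j, (i < n)%nat /\ (j < n)%nat /\ A i j <> C0.
Definition mmul (n : nat) (A B : Mat) : Mat :=
  fun i j => Csum n (fun k => Cmul (A i k) (B k j)).
Definition adj (A : Mat) : Mat := fun i j => Cconj (A j i).
Definition idm : Mat := fun i j => if Nat.eqb i j then C1 else C0.
Definition mtrace (n : nat) (A : Mat) : C := Csum n (fun i => A i i).

Definition PSD (n : nat) (A : Mat) : Prop :=
  forall x : nat -> C,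
    let q := Csum n (fun i => Csum n (fun j =>
               Cmul (Cconj (x i)) (Cmul (A i j) (x j)))) in
    0 <= Re q /\ Im q = 0.
Definition is_state (n : nat) (A : Mat) : Prop := PSD n A /\ mtrace n A = C1.
Definition unitary (n : nat) (U : Mat) : Prop := meq n (mmul n (adj U) U) idm.

(* Linear maps on M(d;C), given by coefficients:
   (T X)_{ij} = sum_{k,l<d} T i j k l * X_{kl}, i.e. T i j k l = (T(E_kl))_{ij}. *)
Definition Superop := nat -> nat -> nat -> nat -> C.
Definition sapply (d : nat) (T : Superop) (X : Mat) : Mat :=
  fun i j => Csum d (fun k => Csum d (fun l => Cmul (T i j k l) (X k l))).
Definition sid : Superop :=
  fun i j k l => if andb (Nat.eqb i k) (Nat.eqb j l) then C1 else C0.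
Definition scomp (d : nat) (S T : Superop) : Superop :=
  fun i j k l => Csum d (fun a => Csum d (fun b => Cmul (S i j a b) (T a b k l))).
Fixpoint spow (d : nat) (T : Superop) (n : nat) : Superop :=
  match n with O => sid | S m => scomp d T (spow d T m) end.

(* C^d (x) C^k with basis index (a,b) |-> a*k + b *)
Definition ampl (d k : nat) (T : Superop) (X : Mat) : Mat :=
  fun r s => Csum d (fun c => Csum d (fun c' =>
     Cmul (T (r / k) (s / k) c c') (X (c * k + r mod k) (c' * k + s mod k))))%nat.
Definition kron (k : nat) (A B : Mat) : Mat :=
  fun r s => Cmul (A (r / k) (s / k))%nat (B (r mod k) (s mod k))%nat.

Definition completely_positive (d : nat) (T : Superop) : Prop :=
  forall (k : nat) (X : Mat), PSD (d * k) X -> PSD (d * k) (ampl d k T X).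
Definition trace_preserving (d : nat) (T : Superop) : Prop :=
  forall X : Mat, mtrace d (sapply d T X) = mtrace d X.
Definition quantum_channel (d : nat) (T : Superop) : Prop :=
  completely_positive d T /\ trace_preserving d T.

Definition separable (d k : nat) (rho : Mat) : Prop :=
  exists (m : nat) (p : nat -> R) (sig tau : nat -> Mat),
    (forall t, (t < m)%nat -> 0 <= p t /\ is_state d (sig t) /\ is_state k (tau t)) /\
    Csum m (fun t => mkC (p t) 0) = C1 /\
    meq (d * k) rho
      (fun r s => Csum m (fun t => Cmul (mkC (p t) 0) (kron k (sig t) (tau t) r s))).

Definition entanglement_breaking (d : nat) (T : Superop) : Prop :=
  forall (k : nat) (rho : Mat), is_state (d * k) rho -> separable d k (ampl d k T rho).

Definition limit_point (d : nat) (f : nat -> Superop) (L : Superop) : Prop :=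
  forall eps : R, eps > 0 -> forall N : nat, exists n : nat, (N <= n)%nat /\
    forall i j k l, (i < d)%nat -> (j < d)%nat -> (k < d)%nat -> (l < d)%nat ->
      Cabs (Csub (f n i j k l) (L i j k l)) < eps.

Definition asymptotically_entanglement_saving (d : nat) (T : Superop) : Prop :=
  forall L : Superop, limit_point d (spow d T) L -> ~ entanglement_breaking d L.

Definition phase_point (d : nat) (T : Superop) (Z : Mat) : Prop :=
  mnonzero d Z /\
  exists theta : R, meq d (sapply d T Z) (fun i j => Cmul (Cexpi theta) (Z i j)).

Definition in_phase_subspace (d : nat) (T : Superop) (X : Mat) : Prop :=
  exists (m : nat) (c : nat -> C) (Z : nat -> Mat),
    (forall t, (t < m)%nat -> phase_point d T (Z t)) /\
    meq d X (fun i j => Csum m (fun t => Cmul (c t) (Z t i j))).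

(* Block-diagonal matrix (bigoplus_i X_i (x) rho_i) (+) 0, with blocks
   given by a list of (d1_i, d2_i, rho_i); Xs i is the d1_i x d1_i matrix. *)
Fixpoint blockdiag (bs : list (nat * nat * Mat)) (Xs : nat -> Mat) (r c : nat) : C :=
  match bs with
  | nil => C0
  | (d1, d2, rho) :: bs' =>
      let s := (d1 * d2)%nat in
      if Nat.ltb r s then
        (if Nat.ltb c s then Cmul (Xs O (r / d2) (c / d2))%nat (rho (r mod d2) (c mod d2))%nat
         else C0)
      else if Nat.ltb c s then C0
      else blockdiag bs' (fun i => Xs (S i)) (r - s)%nat (c - s)%nat
  end.

Definition block_total (bs : list (nat * nat * Mat)) : nat :=
  fold_right (fun b acc => (fst (fst b) * snd (fst b) + acc)%nat) O bs.

Definition phase_structure (d : nat) (T : Superop) (U : Mat) (bs : list (nat * nat * Mat)) : Prop :=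
  unitary d U /\ (block_total bs <= d)%nat /\
  (forall d1 d2 rho, In (d1, d2, rho) bs -> is_state d2 rho) /\
  (forall X : Mat, in_phase_subspace d T X <->
     exists Xs : nat -> Mat, meq d X (mmul d (mmul d U (blockdiag bs Xs)) (adj U))).

(* Main.v *)
(* By compactness some subsequence of the powers of a channel converges to an idempotent channel P
   that fixes every phase point and whose range is the phase subspace: on the range of a limit
   point, power-boundedness excludes eigenvalues off the unit circle and nontrivial Jordan blocks.

   If P has Kraus operators K_i, let Q be the support of P(1), L_i = K_i Q and rho = P(Q).
   Lindblad's argument shows that the fixed points of B |-> sum_i L_i^* B L_i form the *-algebra
   A of all a in Q M Q commuting with the L_i and L_i^*; it commutes with rho, and the range of P
   is A rho.  A minimal projection e of A and an orthonormal basis of the left ideal A e split off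
   one block M_n (x) rho_2 of A rho, and induction on the rank of the support yields the
   structure decomposition.

   If some block has n > 1 and a limit point L of the powers were entanglement-breaking, then so
   would be P = S L for another limit point S; but P fixes an entangled state, as its partial
   transpose shows.  If all n <= 1, the phase subspace is spanned by mutually orthogonal states,
   hence commutative, and P is of measure-and-prepare form, hence entanglement-breaking. *)
Require Import Defs.
From Stdlib Require Import Reals List Arith.
From HB Require Import structures.
From mathcomp Require Import all_boot all_order all_algebra.
From mathcomp Require Import boolp Rstruct complex ring lra.

Set Implicit Arguments.
Unset Strict Implicit.
Unset Printing Implicit Defensive.
Import Order.TTheory GRing.Theory Num.Theory.
Import ComplexField.Normc.
Local Open Scope ring_scope.
Local Open Scope sesquilinear_scope.

(** * Conjugate transposes and positive semidefinite matrices *)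

(** The negation of (2) says nothing unless some structure decomposition exists, so the structure
    theorem is proved here instead of being taken from the context; one decomposition with all
    [n <= 1] then refutes both (1) and (3). A limit of powers replaces spectral theory: P moves all
    unimodular eigenvalues to 1, so that the phase subspace becomes the range of a single channel.
    That range is in general no algebra. The algebra appears in the Heisenberg picture, and there
    Lindblad's argument needs a faithful invariant state, which is why the Kraus operators are cut
    to the support of P(1). Minimality of projections is measured by rank, and orthonormal families
    are obtained as those of maximal length, so no general theory of star algebras enters.
    Entanglement is tested on one qubit only: two levels of a block with n > 1 yield both the
    failure of commutation and the negative partial transpose. *)

Section ConjugateTranspose.
Variable F : numClosedFieldType.

Lemma trmxC_mul m n p (A : 'M[F]_(m, n)) (B : 'M_(n, p)) :
  (A *m B)^t* = B^t* *m A^t*.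
Proof. by rewrite trmx_mul map_mxM. Qed.

Lemma trmxCD m n (A B : 'M[F]_(m, n)) : (A + B)^t* = A^t* + B^t*.
Proof. by rewrite linearD /= map_mxD. Qed.

Lemma trmxCB m n (A B : 'M[F]_(m, n)) : (A - B)^t* = A^t* - B^t*.
Proof. by rewrite linearB /= map_mxB. Qed.

Lemma trmxCZ m n c (A : 'M[F]_(m, n)) : (c *: A)^t* = c^* *: A^t*.
Proof. by rewrite linearZ /= map_mxZ. Qed.

Lemma trmxC0 m n : (0 : 'M[F]_(m, n))^t* = 0.
Proof. by rewrite trmx0 map_mx0. Qed.

Lemma trmxC1 n : (1%:M : 'M[F]_n)^t* = 1%:M.
Proof. by rewrite trmx1 map_mx1. Qed.

Lemma trmxC_sum m n (I : finType) (A : I -> 'M[F]_(m, n)) :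
  (\sum_i A i)^t* = \sum_i (A i)^t*.
Proof. by rewrite raddf_sum raddf_sum. Qed.

Lemma trmxC_inj m n (A B : 'M[F]_(m, n)) : A^t* = B^t* -> A = B.
Proof. by move=> /(congr1 (fun X => X^t*)); rewrite !trmxCK. Qed.

Lemma gram_ge0 m n (A : 'M[F]_(m, n)) : 0 <= \tr (A^t* *m A).
Proof.
apply: sumr_ge0 => i _; rewrite mxE; apply: sumr_ge0 => j _.
by rewrite !mxE mulrC mul_conjC_ge0.
Qed.

(** The trace is the squared Frobenius norm of [A]; arguments below that show an operator to have
    norm zero end here. *)
Lemma gram_eq0 m n (A : 'M[F]_(m, n)) : \tr (A^t* *m A) = 0 -> A = 0.
Proof.
move=> h; apply/matrixP => i j; rewrite [RHS]mxE.
have pos k : 0 <= (A^t* *m A) k k.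
  by rewrite mxE; apply: sumr_ge0 => l _; rewrite !mxE mulrC mul_conjC_ge0.
have /eqP := psumr_eq0P (fun k _ => pos k) h (i:=j) isT.
rewrite mxE psumr_eq0 => [/allP /(_ i)|k _]; last first.
  by rewrite !mxE mulrC mul_conjC_ge0.
by rewrite mem_index_enum => /(_ isT); rewrite !mxE mulrC mul_conjC_eq0 => /eqP.
Qed.

Lemma gram_mx0 m n (A : 'M[F]_(m, n)) : A^t* *m A = 0 -> A = 0.
Proof. by move=> h; apply: gram_eq0; rewrite h mxtrace0. Qed.

Lemma sum_gram_eq0 m n (I : finType) (A : I -> 'M[F]_(m, n)) :
  \sum_i \tr ((A i)^t* *m A i) = 0 -> forall i, A i = 0.
Proof.
move=> h i; apply: gram_eq0.
by apply: (psumr_eq0P _ h) => // k _; exact: gram_ge0.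
Qed.

Lemma gram00_ge0 n (x : 'cV[F]_n) : 0 <= (x^t* *m x) 0 0.
Proof. by rewrite -trace_mx11; exact: gram_ge0. Qed.

Lemma gram00_eq0 n (x : 'cV[F]_n) : (x^t* *m x) 0 0 = 0 -> x = 0.
Proof. by rewrite -trace_mx11; exact: gram_eq0. Qed.

(** In a [numClosedFieldType], [0 <= z] entails that [z] is real, so this captures both conjuncts of
    [PSD]. *)
Definition psd n (A : 'M[F]_n) := forall x : 'cV_n, 0 <= (x^t* *m A *m x) 0 0.

Lemma psd_gram m n (A : 'M[F]_(m, n)) : psd (A *m A^t*).
Proof.
move=> x; have := gram00_ge0 (A^t* *m x).
by rewrite trmxC_mul trmxCK !mulmxA.
Qed.

Lemma psd_conj m n (B : 'M[F]_(m, n)) (A : 'M[F]_n) : psd A -> psd (B *m A *m B^t*).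
Proof. by move=> h x; have := h (B^t* *m x); rewrite trmxC_mul trmxCK !mulmxA. Qed.

Lemma psdD n (A B : 'M[F]_n) : psd A -> psd B -> psd (A + B).
Proof. by move=> hA hB x; rewrite mulmxDr mulmxDl mxE addr_ge0. Qed.

Lemma psd0 n : psd (0 : 'M[F]_n).
Proof. by move=> x; rewrite mulmx0 mul0mx mxE. Qed.

Lemma psd_sum n (I : finType) (A : I -> 'M[F]_n) :
  (forall i, psd (A i)) -> psd (\sum_i A i).
Proof. by move=> h; elim/big_rec: _ => [|i x _ hx]; [exact: psd0|exact: psdD]. Qed.

Lemma psdZ n c (A : 'M[F]_n) : 0 <= c -> psd A -> psd (c *: A).
Proof. by move=> hc h x; rewrite -scalemxAr -scalemxAl mxE mulr_ge0. Qed.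

Lemma addmxE m n (A B : 'M[F]_(m, n)) i j : (A + B) i j = A i j + B i j.
Proof. by rewrite mxE. Qed.

Lemma scalemxE m n c (A : 'M[F]_(m, n)) i j : (c *: A) i j = c * A i j.
Proof. by rewrite mxE. Qed.

Lemma delta_form m n (A : 'M[F]_(m, n)) i j (k : 'I_1):
  ((delta_mx i k : 'M_(m, 1))^t* *m A *m delta_mx j k) k k = A i j.
Proof.
by rewrite (ord1 k) trmx_delta map_delta_mx -rowE -colE !mxE.
Qed.

Lemma psd_diag n (A : 'M[F]_n) i : psd A -> 0 <= A i i.
Proof. by move=> h; have := h (delta_mx i 0); rewrite delta_form. Qed.

(* Polarization along [e_i + e_j] and [e_i + 'i e_j]. *)
Lemma psd_herm n (A : 'M[F]_n) : psd A -> A^t* = A.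
Proof.
move=> h; apply/matrixP => i j; rewrite !mxE.
have key c : c * A i j + c^* * A j i \is Num.real.
  have := h (delta_mx i 0 + c *: delta_mx j 0).
  rewrite trmxCD trmxCZ !mulmxDl !mulmxDr -!(scalemxAl, scalemxAr).
  rewrite !addmxE !scalemxE !delta_form => /ger0_real hr.
  have hi := ger0_real (psd_diag i h); have hj := ger0_real (psd_diag j h).
  have hc : c^* * (c * A j j) \is Num.real.
    by rewrite mulrA [c^* * c]mulrC rpredM // ger0_real // mul_conjC_ge0.
  suff -> : c * A i j + c^* * A j i =
     A i i + (c * A i j + (c^* * A j i + c^* * (c * A j j)))
      - A i i - c^* * (c * A j j).
    rewrite rpredB // rpredB //; move: hr; congr (_ \is Num.real).
    ring.
  ring.
have /CrealP := key 1; have /CrealP := key 'i.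
rewrite !rmorphD !rmorphM /= !conjCK !conjCi rmorph1 !mul1r => h1 h2.
have i0 : 'i != 0 :> F by exact: neq0Ci.
have h3 : (A j i)^* - (A i j)^* = A i j - A j i.
  apply: (mulfI i0); rewrite !mulrBr.
  by move: h1; rewrite !mulNr addrC => ->.
have : (A j i)^* + (A j i)^* = A i j + A i j.
  have := congr2 +%R h2 h3; set a := (A i j)^*; set b := (A j i)^*.
  move=> h4; transitivity (a + b + (b - a)); first by ring.
  by rewrite h4; ring.
by rewrite -!mulr2n => /eqP; rewrite eqrMn2r //= => /eqP.
Qed.

Lemma herm_spectral n (A : 'M[F]_n) : A^t* = A ->
  exists (P : 'M[F]_n) (D : 'rV[F]_n),
    [/\ P *m P^t* = 1%:M, P^t* *m P = 1%:M & A = P^t* *m diag_mx D *m P].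
Proof.
move=> h; have /hermitian_normalmx /orthomx_spectralP : A \is hermsymmx.
  by apply/is_hermitianmxP; rewrite expr0 scale1r.
have U := spectral_unitarymx A.
rewrite invmx_unitary // => e; exists (spectralmx A), (spectral_diag A).
by split=> //; [exact/unitarymxP | apply/eqP; rewrite mulmx1C //; exact/unitarymxP].
Qed.

(** Square roots of the eigenvalues in a spectral decomposition. The factor supplies Kraus operators
    from a Choi matrix and reduces positivity of products to Gram matrices. *)
Lemma psd_factor n (A : 'M[F]_n) : psd A -> exists B : 'M[F]_n, A = B *m B^t*.
Proof.
move=> h; have [P [D [P1 P2 e]]] := herm_spectral (psd_herm h).
have Dge i : 0 <= D 0 i.
  have := psd_diag i (psd_conj P h); rewrite e !mulmxA P1 mul1mx.
  by rewrite -mulmxA P1 mulmx1 mxE eqxx.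
exists (P^t* *m diag_mx (\row_i sqrtC (D 0 i))).
rewrite trmxC_mul trmxCK tr_diag_mx map_diag_mx !mulmxA {1}e.
congr (_ *m _); rewrite -!mulmxA mulmx_diag; congr (_ *m diag_mx _).
apply/rowP => i; rewrite !mxE.
rewrite /= conj_Creal; last by rewrite ger0_real ?sqrtC_ge0.
by rewrite -expr2 sqrtCK.
Qed.

Lemma psd_ker n (A : 'M[F]_n) (x : 'cV_n) : psd A ->
  (x^t* *m A *m x) 0 0 = 0 -> A *m x = 0.
Proof.
move=> /psd_factor [B ->] h; rewrite -mulmxA.
suff -> : B^t* *m x = 0 by rewrite mulmx0.
by apply: gram00_eq0; rewrite trmxC_mul trmxCK -h !mulmxA.
Qed.

Lemma psd_tr_ge0 n (A : 'M[F]_n) : psd A -> 0 <= \tr A.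
Proof. by move=> h; apply: sumr_ge0 => i _; exact: psd_diag. Qed.

Lemma psd_tr0 n (A : 'M[F]_n) : psd A -> \tr A = 0 -> A = 0.
Proof.
move=> /psd_factor [B ->]; rewrite mxtrace_mulC => /gram_eq0 ->.
by rewrite mul0mx.
Qed.

End ConjugateTranspose.

(** * Matrices over the concrete complex numbers *)

Notation K := (complex Rdefinitions.R).

Definition toc (z : Defs.C) : K := Complex (Defs.Re z) (Defs.Im z).
Definition ofc (z : K) : Defs.C := mkC (complex.Re z) (complex.Im z).

Lemma tocK : cancel toc ofc. Proof. by case. Qed.
Lemma ofcK : cancel ofc toc. Proof. by case. Qed.

Lemma toc0 : toc Defs.C0 = 0. Proof. by []. Qed.
Lemma toc1 : toc Defs.C1 = 1. Proof. by []. Qed.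
Lemma tocD a b : toc (Cadd a b) = toc a + toc b. Proof. by []. Qed.
Lemma tocM a b : toc (Cmul a b) = toc a * toc b. Proof. by []. Qed.
Lemma toc_conj a : toc (Cconj a) = (toc a)^*. Proof. by []. Qed.

Lemma toc_sum n f : toc (Csum n f) = \sum_(i < n) toc (f i).
Proof.
by elim: n => [|n IHn]; rewrite ?big_ord0 // big_ord_recr /= tocD IHn.
Qed.

Lemma toc_ge0 z : 0 <= toc z <-> Rle (IZR 0) (Defs.Re z) /\ Defs.Im z = IZR 0.
Proof.
rewrite lecE /=; split => [/andP [/eqP -> /RleP]|[/RleP h ->]] //.
by rewrite eqxx.
Qed.

Lemma toc_abs z : `|toc z| = Complex (Cabs z) 0.
Proof. by rewrite normc_def /Cabs RsqrtE !expr2. Qed.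

Definition mx n (A : Mat) : 'M[K]_n := \matrix_(i, j) toc (A i j).

(** Entries outside the range default to zero; [meq] does not see them. *)
Definition mat n (A : 'M[K]_n) : Mat := fun i j =>
  if insub i is Some i' then if insub j is Some j' then ofc (A i' j') else Defs.C0
  else Defs.C0.

Lemma matE n (A : 'M[K]_n) (i j : 'I_n) : mat A i j = ofc (A i j).
Proof. by rewrite /mat !valK. Qed.

Lemma matK n : cancel (@mat n) (@mx n).
Proof. by move=> A; apply/matrixP => i j; rewrite mxE matE ofcK. Qed.

Lemma meq_mx n (A B : Mat) : meq n A B <-> mx n A = mx n B.
Proof.
split=> [h|/matrixP h i j /ssrnat.ltP hi /ssrnat.ltP hj].
  by apply/matrixP => i j; rewrite !mxE h //; apply/ssrnat.ltP.
by have := h (Ordinal hi) (Ordinal hj); rewrite !mxE => /(can_inj tocK).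
Qed.

Lemma mx_mul n A B : mx n (mmul n A B) = mx n A *m mx n B.
Proof.
apply/matrixP => i j; rewrite !mxE toc_sum.
by apply: eq_bigr => k _; rewrite !mxE tocM.
Qed.

Lemma mx_adj n A : mx n (adj A) = (mx n A)^t*.
Proof. by apply/matrixP => i j; rewrite !mxE toc_conj. Qed.

Lemma mx_id n : mx n idm = 1%:M.
Proof.
apply/matrixP => i j; rewrite !mxE /idm.
by case: Nat.eqb_spec => [/val_inj ->|h]; rewrite ?eqxx //; case: eqP => // e; case: h; rewrite e.
Qed.

Lemma mx_trace n A : toc (mtrace n A) = \tr (mx n A).
Proof. by rewrite toc_sum; apply: eq_bigr => i _; rewrite mxE. Qed.

Lemma mx_zero n (A : Mat) : mnonzero n A <-> mx n A != 0.
Proof.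
split=> [[i [j [/ssrnat.ltP hi [/ssrnat.ltP hj h]]]]|h].
  apply/eqP => /matrixP /(_ (Ordinal hi) (Ordinal hj)).
  by rewrite !mxE -toc0 => /(can_inj tocK).
apply: contrapT => hn; move/eqP: h; apply; apply/matrixP => i j; rewrite !mxE.
apply: contrapT => hz; apply: hn; exists i, j.
by split; [exact/ssrnat.ltP|split; [exact/ssrnat.ltP|move=> e; apply: hz; rewrite e]].
Qed.

Lemma PSD_mx n A : PSD n A <-> psd (mx n A).
Proof.
have key (x : 'cV[K]_n) (y : nat -> Defs.C) : (forall i : 'I_n, toc (y i) = x i 0) ->
    toc (Csum n (fun i => Csum n (fun j =>
      Cmul (Cconj (y i)) (Cmul (A i j) (y j))))) = (x^t* *m mx n A *m x) 0 0.
  move=> h; rewrite -mulmxA mxE toc_sum; apply: eq_bigr => i _.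
  rewrite toc_sum !mxE mulr_sumr; apply: eq_bigr => j _.
  by rewrite !tocM toc_conj !mxE !h.
split=> h x.
  have [] := h (fun i => ofc (if insub i is Some j then x j 0 else 0)).
  move=> h1 h2; rewrite -(key x (fun i => ofc (if insub i is Some j then x j 0 else 0))).
    by apply/toc_ge0.
  by move=> i; rewrite valK ofcK.
move=> q; apply/toc_ge0; rewrite (key (\col_i toc (x i))); first exact: h.
by move=> i; rewrite mxE.
Qed.

Lemma is_state_mx n A : is_state n A <-> psd (mx n A) /\ \tr (mx n A) = 1.
Proof.
rewrite /is_state PSD_mx -mx_trace -toc1.
by split=> -[h1 h2]; split=> //; [rewrite h2|exact: (can_inj tocK)].
Qed.

(** * Star algebras of matrices *)

Section Orthonormal.
Variable F : numClosedFieldType.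

(** Subspaces are predicates because those met below are given by equations or as ranges, with no
    basis at hand. *)
Record subspace d m (S : 'M[F]_(d, m) -> Prop) : Prop := Subspace {
  sub0 : S 0;
  subD : forall x y, S x -> S y -> S (x + y);
  subZ : forall c x, S x -> S (c *: x) }.

Lemma subN d m (S : 'M[F]_(d, m) -> Prop) x : subspace S -> S x -> S (- x).
Proof. by move=> hS h; rewrite -scaleN1r; exact: subZ. Qed.

Lemma subB d m (S : 'M[F]_(d, m) -> Prop) x y :
  subspace S -> S x -> S y -> S (x - y).
Proof. by move=> hS h1 h2; apply: subD => //; exact: subN. Qed.

Lemma sub_sum d m (S : 'M[F]_(d, m) -> Prop) (I : finType) (f : I -> 'M_(d, m)) :
  subspace S -> (forall i, S (f i)) -> S (\sum_i f i).
Proof. by move=> hS h; elim/big_rec: _ => [|i x _]; [exact: sub0|exact: subD]. Qed.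

(* The scalar [c] in [b^* b = c e] is a nonnegative real, so that [b] can be normalized. *)
Lemma normalize_frame d m (e : 'M[F]_m) (b : 'M_(d, m)) c :
  e != 0 -> e^t* = e -> e *m e = e -> b != 0 -> b^t* *m b = c *: e ->
  exists k, (k *: b)^t* *m (k *: b) = e.
Proof.
move=> e0 eH ee b0 hb.
have te : 0 < \tr e.
  rewrite lt0r -{2}ee -{2}eH gram_ge0 andbT; apply/eqP => h.
  by move/eqP: e0; apply; apply: gram_eq0; rewrite eH ee.
have tb : 0 < \tr (b^t* *m b).
  rewrite lt0r gram_ge0 andbT; apply/eqP => /gram_eq0 h.
  by rewrite h eqxx in b0.
have c0 : 0 < c by move: tb; rewrite hb mxtraceZ pmulr_lgt0.
exists (sqrtC c)^-1.
rewrite trmxCZ -scalemxAl -scalemxAr hb !scalerA.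
have r : (sqrtC c)^-1 \is Num.real by rewrite ger0_real // invr_ge0 sqrtC_ge0 ltW.
by rewrite /= conj_Creal // -invfM -expr2 sqrtCK mulVf ?scale1r ?gt_eqF.
Qed.

(** Orthonormality for an inner product with values in the multiples of a projection [e]. With
    [m = 1] and [e = 1] it is the usual notion for vectors; with [e] a minimal projection of an
    algebra it is orthonormality in the left ideal generated by [e]. *)
Definition frame d m (e : 'M[F]_m) n (w : nat -> 'M_(d, m)) :=
  forall i j, (i < n)%N -> (j < n)%N -> (w i)^t* *m w j = (i == j)%:R *: e.

(** At a nonzero diagonal entry [e j j], the [j]-th columns of the [w i] are [n] nonzero orthogonal
    vectors of a [d]-dimensional space. *)
Lemma frame_bound d m (e : 'M[F]_m) n (w : nat -> 'M_(d, m)) :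
  e != 0 -> e^t* = e -> e *m e = e -> frame e n w -> (n <= d)%N.
Proof.
move=> e0 eH ee hw.
have [j hj] : exists j, e j j != 0.
  apply/existsP; apply: contraNT e0 => /existsPn h; apply/eqP.
  apply: gram_eq0; rewrite eH ee; apply: big1 => i _.
  by have := h i; rewrite negbK => /eqP.
pose W := \matrix_(k < d, i < n) w i k j.
have WW : W^t* *m W = (e j j)%:M.
  apply/matrixP => i i'.
  have := hw i i' (ltn_ord i) (ltn_ord i') => /matrixP /(_ j j).
  rewrite !mxE => h; transitivity ((i == i')%:R * e j j); last first.
    by rewrite mulr_natl.
  by rewrite -h; apply: eq_bigr => k _; rewrite !mxE.
have : \rank (W^t* *m W) = n.
  by rewrite WW mxrank_unit // unitmxE det_scalar unitfE expf_neq0.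
by move=> <-; apply: leq_trans (mxrankM_maxr _ _) (rank_leq_row _).
Qed.

(** A frame of maximal length exists by [frame_bound]. If some [x] differed from its expansion, the
    normalized difference could be appended; normalization works because inner products are scalar
    multiples of [e]. *)
Lemma maximal_frame d m (S : 'M[F]_(d, m) -> Prop) (e : 'M[F]_m) :
  subspace S -> e != 0 -> e^t* = e -> e *m e = e ->
  (forall x y, S x -> S y -> exists c, x^t* *m y = c *: e) ->
  (forall x, S x -> x *m e = x) ->
  exists n (w : nat -> 'M_(d, m)),
    [/\ forall i, (i < n)%N -> S (w i), frame e n w
      & forall x, S x -> x = \sum_(i < n) w i *m ((w i)^t* *m x)].
Proof.
move=> hS e0 eH ee hc he.
pose P n := exists w : nat -> 'M_(d, m),
  (forall i, (i < n)%N -> S (w i)) /\ frame e n w.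
have P0 : exists n, `[< P n >] by exists 0%N; apply/asboolP; exists (fun=> 0).
have Pb n : `[< P n >] -> (n <= d)%N.
  by move=> /asboolP [w [_ hw]]; exact: frame_bound hw.
case: (ex_maxnP P0 Pb) => n /asboolP [w [wS hw]] nmax.
exists n, w; split=> // x Sx.
set y := \sum_(i < n) _.
have Sy : S y.
  apply: sub_sum => // i; have [c ->] := hc _ _ (wS i (ltn_ord i)) Sx.
  by rewrite -scalemxAr he; [apply: subZ => //|]; exact: wS.
have Sxy := subB hS Sx Sy.
have orth i : (i < n)%N -> (w i)^t* *m (x - y) = 0.
  move=> ltin; have [c hx] := hc _ _ (wS i ltin) Sx.
  rewrite mulmxBr mulmx_sumr (bigD1 (Ordinal ltin)) //= big1 => [|k ki].
    by rewrite addr0 hx mulmxA hw // eqxx scale1r -scalemxAr ee subrr.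
  rewrite (mulmxA ((w i)^t*)) hw // (_ : (i == k) = false) ?scale0r ?mul0mx //.
  by apply/negbTE; rewrite eq_sym; apply: contra ki => /eqP h; apply/eqP/val_inj.
apply/eqP; rewrite -subr_eq0; apply/negPn/negP => nz.
have [c hb] := hc _ _ Sxy Sxy.
have [k hk] := normalize_frame e0 eH ee nz hb.
suff : (n.+1 <= n)%N by rewrite ltnn.
apply: nmax; apply/asboolP.
exists (fun i => if i == n then k *: (x - y) else w i); split=> [i|i j].
  rewrite ltnS leq_eqVlt; case: eqP => [_ _|_ /=]; last exact: wS.
  by apply: subZ.
rewrite !ltnS (leq_eqVlt i n) (leq_eqVlt j n).
case: (i =P n) => [->|ni]; case: (j =P n) => [->|nj] //= hi hj.
- by rewrite hk eqxx scale1r.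
- rewrite gtn_eqF // scale0r; apply: trmxC_inj.
  by rewrite trmxC_mul trmxCK -scalemxAr orth // scaler0 trmxC0.
- by rewrite -scalemxAr orth // scaler0 ltn_eqF // scale0r.
- exact: hw.
Qed.

Lemma orthonormal_basis d (S : 'cV[F]_d -> Prop) : subspace S ->
  exists n (w : nat -> 'cV_d),
    [/\ forall i, (i < n)%N -> S (w i), frame 1%:M n w
      & forall x, S x -> x = \sum_(i < n) w i *m ((w i)^t* *m x)].
Proof.
move=> hS; apply: maximal_frame => //.
- by apply/eqP => /matrixP /(_ 0 0) /eqP; rewrite !mxE oner_eq0.
- by rewrite trmxC1.
- by rewrite mulmx1.
- by move=> x y _ _; exists ((x^t* *m y) 0 0); rewrite scalemx1 -mx11_scalar.
- by move=> x _; rewrite mulmx1.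
Qed.

(** No unit is demanded, so that corners and ideals qualify. *)
Record star_algebra d (S : 'M[F]_d -> Prop) : Prop := StarAlgebra {
  sa_sub :> subspace S;
  saM : forall x y, S x -> S y -> S (x *m y);
  saJ : forall x, S x -> S (x^t*) }.

(** The leading factor [D 0 i] keeps the polynomial free of a constant term, as [S] need not contain
    the identity. *)
Lemma polynomial_mem d (S : 'M[F]_d -> Prop) (P : 'M[F]_d) (D : 'rV[F]_d) (s : seq F) :
  star_algebra S -> P *m P^t* = 1%:M -> S (P^t* *m diag_mx D *m P) ->
  S (P^t* *m diag_mx (\row_i (D 0 i * \prod_(c <- s) (D 0 i - c))) *m P).
Proof.
move=> hS PP hD; elim: s => [|c s IHs].
  rewrite (_ : \row_i _ = D) //; apply/rowP => i.
  by rewrite mxE big_nil mulr1.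
set E := \row_i _ in IHs.
have := subB hS (saM hS IHs hD) (subZ hS c IHs).
rewrite -!mulmxA (mulmxA P) PP mul1mx (mulmxA (diag_mx E)) mulmx_diag.
rewrite scalemxAr scalemxAl -linearZ /= -mulmxBr -mulmxBl -linearB /=.
rewrite !mulmxA; congr (S (_ *m diag_mx _ *m _)); apply/rowP => i.
by rewrite !mxE big_cons; ring.
Qed.

(** Lagrange interpolation: a polynomial vanishing at zero and at every eigenvalue other than a
    chosen [D 0 k != 0], scaled to 1 there, turns [h] into its spectral projection. *)
Lemma spectral_projection d (S : 'M[F]_d -> Prop) (h : 'M_d) :
  star_algebra S -> S h -> h^t* = h -> h != 0 ->
  exists e l, [/\ S e, e^t* = e, e *m e = e, e != 0 & h *m e = l *: e /\ l != 0].
Proof.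
move=> hS Sh hH h0; have [P [D [P1 P2 eh]]] := herm_spectral hH.
have [k hk] : exists k, D 0 k != 0.
  apply/existsP; apply: contraNT h0 => /existsPn hD; rewrite eh.
  suff -> : D = 0 by rewrite linear0 mulmx0 mul0mx.
  by apply/rowP => i; rewrite mxE; apply/eqP; rewrite -[_ == _]negbK hD.
(* Repetitions in [s] do no harm: only the zeros of [q] and its nonvanishing at [D 0 k] matter. *)
pose s := [seq D 0 j | j <- enum 'I_d & D 0 j != D 0 k].
pose q x := x * \prod_(c <- s) (x - c).
have qk : q (D 0 k) != 0.
  rewrite mulf_neq0 // prodf_seq_neq0; apply/allP => c /mapP [j].
  by rewrite mem_filter => /andP [hj _] ->; rewrite subr_eq0 eq_sym.
have qj j : D 0 j != D 0 k -> q (D 0 j) = 0.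
  move=> hj; have hs : D 0 j \in s.
    by apply/mapP; exists j => //; rewrite mem_filter hj mem_enum.
  by rewrite /q (big_rem _ hs) /= subrr mul0r mulr0.
pose E := \row_i (D 0 i == D 0 k)%:R : 'rV[F]_d.
pose e := P^t* *m diag_mx E *m P.
have Se : S e.
  have := @polynomial_mem _ S P D s hS P1; rewrite -eh => /(_ Sh).
  move=> /(subZ hS (q (D 0 k))^-1).
  rewrite scalemxAl scalemxAr -linearZ /=.
  congr (S (_ *m diag_mx _ *m _)); apply/rowP => i; rewrite !mxE.
  case: (eqVneq (D 0 i) (D 0 k)) => [->|hi]; first by rewrite mulVf.
  by rewrite -/(q (D 0 i)) (qj i hi) mulr0.
have PeP : P *m e *m P^t* = diag_mx E.
  by rewrite /e !mulmxA P1 mul1mx -mulmxA P1 mulmx1.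
exists e, (D 0 k); split=> //.
- rewrite /e !trmxC_mul trmxCK tr_diag_mx map_diag_mx !mulmxA.
  congr (_ *m diag_mx _ *m _); apply/rowP => i.
  by rewrite !mxE rmorph_nat.
- rewrite /e -!mulmxA (mulmxA P) P1 mul1mx (mulmxA (diag_mx E)) mulmx_diag.
  congr (_ *m (diag_mx _ *m _)); apply/rowP => i.
  by rewrite !mxE; case: eqP; rewrite ?mulr1 ?mulr0.
- apply/eqP => e0; move: PeP; rewrite e0 mulmx0 mul0mx => /matrixP /(_ k k).
  by rewrite !mxE !eqxx => /eqP; rewrite eq_sym oner_eq0.
- split=> //; rewrite {1}eh /e -!mulmxA (mulmxA P) P1 mul1mx.
  rewrite (mulmxA (diag_mx D)) mulmx_diag scalemxAr scalemxAl -linearZ /=.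
  congr (_ *m (diag_mx _ *m _)); apply/rowP => i.
  by rewrite !mxE; case: eqP => [->|]; rewrite ?mulr0.
Qed.

(** A nonzero spectral projection of [h] lies below [e], hence equals [e] by minimality of the rank;
    so [h] has a single eigenvalue on the range of [e]. *)
Lemma corner_hermitian d (S : 'M[F]_d -> Prop) (e h : 'M_d) :
  star_algebra S -> S e -> e^t* = e -> e *m e = e ->
  (forall f, S f -> f^t* = f -> f *m f = f -> f != 0 -> (\rank e <= \rank f)%N) ->
  S h -> h^t* = h -> e *m h = h -> exists c, h = c *: e.
Proof.
move=> hS Se eH ee emin Sh hH eh.
have [->|h0] := eqVneq h 0; first by exists 0; rewrite scale0r.
have [f [l [Sf fH ff f0 [hf l0]]]] := spectral_projection hS Sh hH h0.
have ef : e *m f = f.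
  have -> : f = l^-1 *: (h *m f) by rewrite hf scalerA mulVf // scale1r.
  by rewrite -scalemxAr mulmxA eh.
have fe : f *m e = f by apply: trmxC_inj; rewrite trmxC_mul eH fH.
have /eqmxP fe' : (f == e)%MS.
  rewrite -(mxrank_leqif_eq (_ : (f <= e)%MS)).
    by rewrite eqn_leq emin // mxrankS // -fe submxMl.
  by rewrite -fe submxMl.
have /submxP [D De] : (e <= f)%MS by rewrite fe'.
have ef' : f = e.
  by rewrite -[LHS]fH -fe trmxC_mul fH eH De -mulmxA ff.
have he : h *m e = h by apply: trmxC_inj; rewrite trmxC_mul eH hH.
by exists l; rewrite -he -ef' hf.
Qed.

(** A projection of least positive rank works: the Hermitian and skew-Hermitian parts of
    [e *m b *m e] are handled separately by [corner_hermitian]. *)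
Lemma minimal_projection d (S : 'M[F]_d -> Prop) (a : 'M_d) :
  star_algebra S -> S a -> a != 0 ->
  exists e, [/\ S e, e^t* = e, e *m e = e, e != 0
              & forall b, S b -> exists c, e *m b *m e = c *: e].
Proof.
move=> hS Sa a0.
pose P n := exists e, [/\ S e, e^t* = e, e *m e = e, e != 0 & \rank e = n].
have exP : exists n, `[< P n >].
  have [|||e [l [Se eH ee e0 _]]] := @spectral_projection d S (a^t* *m a) hS.
  - by apply: saM => //; exact: saJ.
  - by rewrite trmxC_mul trmxCK.
  - by apply: contra a0 => /eqP /gram_mx0 ->.
  by exists (\rank e); apply/asboolP; exists e.
case: (ex_minnP exP) => n /asboolP [e [Se eH ee e0 en]] nmin.
exists e; split=> // b Sb.
have emin f : S f -> f^t* = f -> f *m f = f -> f != 0 -> (\rank e <= \rank f)%N.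
  by move=> *; rewrite en; apply: nmin; apply/asboolP; exists f.
set g := e *m b *m e.
have Sg : S g by do 2?apply: saM => //.
have gHE : g^t* = e *m b^t* *m e by rewrite /g !trmxC_mul eH mulmxA.
have eg : e *m g = g by rewrite /g !mulmxA ee.
have egH : e *m g^t* = g^t* by rewrite gHE !mulmxA ee.
have SgH := saJ hS Sg.
have [c hc] : exists c, g + g^t* = c *: e.
  apply: (corner_hermitian hS Se eH ee emin); first exact: (subD hS).
    by rewrite trmxCD trmxCK addrC.
  by rewrite mulmxDr eg egH.
have [c' hc'] : exists c, 'i *: (g - g^t*) = c *: e.
  apply: (corner_hermitian hS Se eH ee emin).
  - by apply: (subZ hS); exact: (subB hS).
  - by rewrite trmxCZ trmxCB trmxCK conjCi scaleNr -scalerN opprB.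
  - by rewrite -scalemxAr mulmxBr eg egH.
(* With [h1] the sum of [g] and its adjoint and [h2] the difference times ['i], one has
   [g = (h1 - 'i h2) / 2]. *)
exists (2%:R^-1 * (c - 'i * c')).
rewrite -scalerA scalerBl -scalerA -hc -hc' scalerA -expr2 sqrCi scaleN1r opprK.
rewrite addrACA subrr addr0 -mulr2n -scaler_nat scalerA mulVf ?scale1r //.
by rewrite pnatr_eq0.
Qed.

End Orthonormal.

(** The conjugate of [blockdiag] by a unitary, written with its columns [u r]. Only the first
    [block_total bs] columns occur, so a frame of that length suffices until it is completed to a
    unitary. *)
Definition block_sum d (bs : list (nat * nat * Mat)) (Xs : nat -> Mat)
    (u : nat -> 'cV[K]_d) : 'M_d :=
  \sum_(r < block_total bs) \sum_(s < block_total bs)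
    toc (blockdiag bs Xs r s) *: (u r *m (u s)^t*).

Lemma sum_mul_ord (V : nmodType) m n (f : nat -> V) :
  \sum_(r < m * n) f r = \sum_(j < m) \sum_(b < n) f (j * n + b)%N.
Proof.
elim: m => [|m IHm]; first by rewrite mul0n !big_ord0.
rewrite big_ord_recr /= -IHm mulSnr.
by rewrite big_split_ord /=.
Qed.

Lemma block_index (j b n : nat) : (b < n)%N ->
  Nat.div (j * n + b) n = j /\ Nat.modulo (j * n + b) n = b.
Proof.
move=> hb; have n0 : n <> O by move=> e; rewrite e in hb.
have hb' : (b < n)%coq_nat by apply/ssrnat.ltP.
split; first by rewrite Nat.div_add_l // Nat.div_small // Nat.add_0_r.
have -> : (j * n + b)%N = Nat.add b (Nat.mul j n) by rewrite addnC.
by rewrite Nat.Div0.mod_add Nat.mod_small.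
Qed.

Lemma ltb_ltn m n : Nat.ltb m n = (m < n)%N.
Proof. by apply/idP/ssrnat.ltP => /Nat.ltb_lt. Qed.

Lemma block_sum_cons d d1 d2 rho bs Xs (u : nat -> 'cV[K]_d) :
  block_sum ((d1, d2, rho) :: bs) Xs u =
  \sum_(j < d1) \sum_(b < d2) \sum_(k < d1) \sum_(c < d2)
    (toc (Xs O j k) * toc (rho b c)) *: (u (j * d2 + b)%N *m (u (k * d2 + c)%N)^t*)
  + block_sum bs (fun i => Xs i.+1) (fun r => u (d1 * d2 + r)%N).
Proof.
have lt_block (j : 'I_d1) (b : 'I_d2) : (j * d2 + b < d1 * d2)%N.
  apply: (@leq_trans (j.+1 * d2)); last by rewrite leq_mul2r ltn_ord orbT.
  by rewrite mulSnr ltn_add2l.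
rewrite /block_sum.
change (block_total ((d1, d2, rho) :: bs)) with (d1 * d2 + block_total bs)%N.
set n := block_total bs; pose G r s := toc (blockdiag ((d1, d2, rho) :: bs) Xs r s)
  *: (u r *m (u s)^t*).
rewrite big_split_ord; congr (_ + _).
  rewrite (sum_mul_ord _ _ (fun r => \sum_(s < d1 * d2 + n) G r s)); apply: eq_bigr => j _; apply: eq_bigr => b _.
  rewrite big_split_ord /= [X in _ + X]big1 ?addr0 => [|s _].
    rewrite (sum_mul_ord _ _ (G (j * d2 + b)%N)).
    apply: eq_bigr => k _; apply: eq_bigr => c _; rewrite /G /=.
    rewrite !ltb_ltn !lt_block //.
    have [-> ->] := block_index j (ltn_ord b).
    by have [-> ->] := block_index k (ltn_ord c).
  rewrite /G /= !ltb_ltn lt_block // (_ : (_ + s < _)%N = false) ?toc0 ?scale0r //.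
  by rewrite ltnNge leq_addr.
apply: eq_bigr => r _; rewrite big_split_ord /= [X in X + _]big1 ?add0r => [|s _].
  apply: eq_bigr => s _; rewrite !ltb_ltn !ltnNge !leq_addr /=.
  by rewrite !minusE !addKn.
by rewrite !ltb_ltn ltn_ord ltnNge leq_addr toc0 scale0r.
Qed.

Lemma block_sum_nil d Xs (u : nat -> 'cV[K]_d) : block_sum nil Xs u = 0.
Proof. by rewrite /block_sum big_ord0. Qed.

Lemma mulmx_col_ext (F : nzRingType) m n (A B : 'M[F]_(m, n)) :
  (forall x : 'cV_n, A *m x = B *m x) -> A = B.
Proof.
move=> h; apply/matrixP => i j; have /matrixP /(_ i 0) := h (delta_mx j 0).
by rewrite -!colE !mxE.
Qed.

Lemma range_projection d (e : 'M[K]_d) n (v : nat -> 'cV_d) : e^t* = e ->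
  (forall i, (i < n)%N -> e *m v i = v i) ->
  (forall x : 'cV_d, e *m x = x -> x = \sum_(i < n) v i *m ((v i)^t* *m x)) ->
  e *m e = e -> \sum_(i < n) v i *m (v i)^t* = e.
Proof.
move=> eH ev hx ee; apply: mulmx_col_ext => x.
rewrite [RHS](hx (e *m x)); last by rewrite mulmxA ee.
rewrite mulmx_suml; apply: eq_bigr => i _.
rewrite -mulmxA; congr (_ *m _); rewrite mulmxA; congr (_ *m _).
by rewrite -{1}(ev i) // trmxC_mul eH.
Qed.

(* [z] is a central projection with [z S rho = M_n1 (x) r0], up to the isometry with columns [u]. *)
Definition splits_off_block d (S : 'M[K]_d -> Prop) (rho : 'M[K]_d) : Prop :=
  exists (n1 n2 : nat) (r0 : Mat) (z : 'M[K]_d) (u : nat -> 'cV_d),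
    let block X0 := \sum_(j < n1) \sum_(b < n2) \sum_(k < n1) \sum_(c < n2)
      (toc (X0 j k) * toc (r0 b c)) *: (u (j * n2 + b)%N *m (u (k * n2 + c)%N)^t*) in
    [/\ is_state n2 r0,
        [/\ S z, z^t* = z, z *m z = z, z != 0 & forall a, S a -> a *m z = z *m a],
        frame 1%:M (n1 * n2) u /\ (forall r, (r < n1 * n2)%N -> z *m u r = u r),
        forall a, S a -> exists X0 : Mat, a *m z *m rho = block X0
      & forall X0 : Mat, exists a, [/\ S a, a *m z = a & a *m rho = block X0] ].

(** * The simple summand generated by a minimal projection *)

Section Peel.
Variables (d : nat) (S : 'M[K]_d -> Prop) (rho e : 'M[K]_d).
Hypotheses (hS : star_algebra S) (Se : S e) (eH : e^t* = e) (ee : e *m e = e)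
  (e0 : e != 0) (emin : forall b, S b -> exists c, e *m b *m e = c *: e)
  (comm : forall a, S a -> rho *m a = a *m rho).
Variables (d1 d2 : nat) (w : nat -> 'M[K]_d) (v : nat -> 'cV[K]_d).
Hypotheses (wS : forall i, (i < d1)%N -> S (w i) /\ w i *m e = w i)
  (wf : frame e d1 w)
  (wx : forall x, S x /\ x *m e = x -> x = \sum_(i < d1) w i *m ((w i)^t* *m x))
  (ev : forall i, (i < d2)%N -> e *m v i = v i) (vf : frame 1%:M d2 v)
  (ve : \sum_(i < d2) v i *m (v i)^t* = e).

(** The products of [w j] with the adjoint of [w k] are matrix units of the summand generated by
    [e]; their diagonal sum is its unit. *)
Definition central_projection := \sum_(i < d1) w i *m (w i)^t*.
Local Notation z := central_projection.

(** The compressed matrix is a multiple of [e], and testing it on the unit vector [v 0] in the range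
    of [e] reads off the factor. *)
Definition corner_coef (a : 'M[K]_d) j k : K :=
  ((v 0%N)^t* *m ((w j)^t* *m a *m w k) *m v 0%N) 0 0.

Definition corner_state b c : K := ((v b)^t* *m rho *m v c) 0 0.

Definition block_vector r : 'cV[K]_d := w (r %/ d2) *m v (r %% d2).

Lemma corner_dim_gt0 : (0 < d2)%N.
Proof.
by rewrite lt0n; apply/eqP => d0; move: e0 ve; rewrite d0 big_ord0 => h e1; rewrite -e1 eqxx in h.
Qed.

Lemma wSJ i : (i < d1)%N -> S ((w i)^t*).
Proof. by move=> /wS [h _]; exact: saJ. Qed.

Lemma wSe i : (i < d1)%N -> e *m (w i)^t* = (w i)^t*.
Proof. by move=> /wS [_ h]; rewrite -[in RHS]h trmxC_mul eH. Qed.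

Lemma central_projection_mem : S z.
Proof.
apply: (sub_sum hS) => i; apply: (saM hS); last exact: wSJ.
by have [] := wS (ltn_ord i).
Qed.

Lemma central_projection_herm : z^t* = z.
Proof. by rewrite trmxC_sum; apply: eq_bigr => i _; rewrite trmxC_mul trmxCK. Qed.

Lemma central_projection_w x : S x -> x *m e = x -> z *m x = x.
Proof.
move=> h1 h2; rewrite [RHS]wx // mulmx_suml.
by apply: eq_bigr => i _; rewrite -mulmxA.
Qed.

(** The elements [x] of [S] with [x *m e = x] form a left ideal containing all [a *m w i], and [z]
    acts on it as the identity. Together with the adjoint identity this gives centrality. *)
Lemma mul_central a : S a -> a *m z = z *m a *m z.
Proof.
move=> Sa; rewrite mulmx_sumr mulmx_sumr; apply: eq_bigr => i _.
have [Sw we] := wS (ltn_ord i).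
rewrite -[in RHS]mulmxA [a *m (_ *m _)]mulmxA [RHS]mulmxA.
rewrite (central_projection_w (saM hS Sa Sw)) //.
by rewrite -mulmxA we.
Qed.

Lemma central_comm a : S a -> a *m z = z *m a.
Proof.
move=> Sa; rewrite mul_central //; apply: trmxC_inj.
rewrite !trmxC_mul central_projection_herm.
by rewrite [RHS](mul_central (saJ hS Sa)) mulmxA.
Qed.

Lemma central_idem : z *m z = z.
Proof.
rewrite {2}/central_projection mulmx_sumr; apply: eq_bigr => i _.
have [Sw we] := wS (ltn_ord i).
by rewrite mulmxA central_projection_w.
Qed.

Lemma corner_coefP a j k : S a -> (j < d1)%N -> (k < d1)%N ->
  (w j)^t* *m a *m w k = corner_coef a j k *: e.
Proof.
move=> Sa hj hk; have [Swk wke] := wS hk.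
have [c hc] : exists c, (w j)^t* *m a *m w k = c *: e.
  have [|c hc] := emin (b := (w j)^t* *m a *m w k).
    by apply: (saM hS) => //; apply: (saM hS) => //; exact: wSJ.
  by exists c; rewrite -hc !mulmxA wSe // -!mulmxA wke.
rewrite /corner_coef hc -scalemxAr -scalemxAl -mulmxA ev ?corner_dim_gt0 //.
by rewrite vf ?corner_dim_gt0 // eqxx scale1r !mxE eqxx mulr1.
Qed.

Lemma block_vectorE j b : (b < d2)%N -> block_vector (j * d2 + b) = w j *m v b.
Proof.
by move=> hb; rewrite /block_vector divnMDl ?modnMDl ?modn_small ?divn_small ?addn0 ?corner_dim_gt0.
Qed.

Lemma block_vector_frame : frame 1%:M (d1 * d2) block_vector.
Proof.
move=> r r' hr hr'; rewrite /block_vector trmxC_mul.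
rewrite -mulmxA (mulmxA ((w _)^t*)) wf ?ltn_divLR ?corner_dim_gt0 //.
rewrite -scalemxAl -scalemxAr ev ?ltn_mod ?corner_dim_gt0 //.
rewrite vf ?ltn_mod ?corner_dim_gt0 // scalerA -natrM mulnb.
congr (_%:R *: _); congr nat_of_bool; apply/andP/eqP => [[/eqP h1 /eqP h2]|-> //].
by rewrite (divn_eq r d2) h1 h2 -divn_eq.
Qed.

Lemma block_vector_central r : (r < d1 * d2)%N -> z *m block_vector r = block_vector r.
Proof.
move=> hr; rewrite /block_vector mulmxA central_projection_w //.
  by have [] := wS (_ : (r %/ d2 < d1)%N); rewrite ?ltn_divLR ?corner_dim_gt0.
by have [] := wS (_ : (r %/ d2 < d1)%N); rewrite ?ltn_divLR ?corner_dim_gt0.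
Qed.

(** Since [rho] commutes with [S], it can be moved between [w j] and the adjoint of [w k], where
    only its compression to the range of [e] is visible. This produces the same second tensor factor
    for all [j] and [k]. *)
Lemma matrix_unit_state j k : (j < d1)%N -> (k < d1)%N ->
  w j *m (w k)^t* *m rho = \sum_(b < d2) \sum_(c < d2)
    corner_state b c *: (block_vector (j * d2 + b) *m (block_vector (k * d2 + c))^t*).
Proof.
move=> hj hk; have [_ wje] := wS hj.
rewrite -mulmxA -comm; last exact: wSJ.
rewrite -{1}wje -(wSe hk) -{1}ve -{1}ve.
rewrite mulmx_sumr mulmx_suml; apply: eq_bigr => b _.
rewrite mulmx_suml !mulmx_sumr; apply: eq_bigr => c _.
rewrite !block_vectorE // trmxC_mul.
rewrite -[LHS]mulmxA -!mulmxA (mulmxA rho) (mulmxA ((v b)^t*)) [_ *m (rho *m _)]mulmxA.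
rewrite [X in _ *m (_ *m (X *m _)) = _]mx11_scalar mul_scalar_mx -!scalemxAr.
by [].
Qed.

Lemma central_expand a : S a -> a *m z *m rho =
  \sum_(j < d1) \sum_(k < d1) corner_coef a j k *: (w j *m (w k)^t* *m rho).
Proof.
move=> Sa; rewrite mul_central // /central_projection -mulmxA.
rewrite mulmx_suml mulmx_suml; apply: eq_bigr => j _.
rewrite mulmx_suml mulmx_sumr; apply: eq_bigr => k _.
have [_ wje] := wS (ltn_ord j).
rewrite -!mulmxA (mulmxA a) (mulmxA ((w j)^t*)) [_ *m (a *m w k)]mulmxA.
rewrite corner_coefP // -!scalemxAl -scalemxAr; congr (_ *: _).
by rewrite -{2}wje -!mulmxA.
Qed.

Lemma corner_state_psd : psd rho -> psd (\matrix_(b < d2, c < d2) corner_state b c).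
Proof.
move=> h; pose V := \matrix_(i < d, b < d2) v b i 0.
suff -> : \matrix_(b, c) corner_state b c = V^t* *m rho *m V^t*^t*.
  exact: psd_conj.
rewrite trmxCK; apply/matrixP => b c; rewrite mxE /corner_state !mxE.
apply: eq_bigr => i _; rewrite !mxE; congr (_ * _).
by apply: eq_bigr => j _; rewrite !mxE.
Qed.

Definition block_weight := \sum_(b < d2) corner_state b b.

Definition block_state : Mat := fun b c => ofc (block_weight^-1 * corner_state b c).

(** A compression of [rho] with zero trace would vanish, and faithfulness would then kill the unit
    vector [v 0]. *)
Lemma block_weight_gt0 (s : 'M[K]_d) : psd rho ->
  (forall a, S a -> s *m a = a) ->
  (forall x : 'cV_d, (x^t* *m rho *m x) 0 0 = 0 -> s *m x = 0) ->
  0 < block_weight.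
Proof.
move=> hr hs faith; pose R := \matrix_(b < d2, c < d2) corner_state b c.
have trR : block_weight = \tr R by apply: eq_bigr => b _; rewrite mxE.
have hR : psd R by exact: corner_state_psd.
rewrite lt0r trR psd_tr_ge0 // andbT; apply/eqP => /(psd_tr0 hR).
have d20 := corner_dim_gt0.
move=> /matrixP /(_ (Ordinal d20) (Ordinal d20)); rewrite !mxE => /faith.
rewrite -(ev d20) mulmxA (hs _ Se) ev // => v0.
have := vf d20 d20; rewrite v0 mulmx0 eqxx scale1r => /matrixP /(_ 0 0).
by rewrite !mxE eqxx => /eqP; rewrite eq_sym oner_eq0.
Qed.

Lemma block_state_is_state : psd rho -> 0 < block_weight -> is_state d2 block_state.
Proof.
move=> hr t0; apply/is_state_mx.
have -> : mx d2 block_state = block_weight^-1 *: \matrix_(b < d2, c < d2) corner_state b c.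
  by apply/matrixP => b c; rewrite !mxE ofcK.
split; first by apply: psdZ; [rewrite invr_ge0 ltW|exact: corner_state_psd].
rewrite mxtraceZ /mxtrace (eq_bigr (fun b : 'I_d2 => corner_state b b)).
  by rewrite mulVf // gt_eqF.
by move=> b _; rewrite mxE.
Qed.

Definition first_block (X0 : Mat) : 'M[K]_d :=
  \sum_(j < d1) \sum_(b < d2) \sum_(k < d1) \sum_(c < d2)
    (toc (X0 j k) * toc (block_state b c)) *:
    (block_vector (j * d2 + b)%N *m (block_vector (k * d2 + c)%N)^t*).

Lemma first_blockE (X0 : Mat) : 0 < block_weight -> first_block X0 =
  (\sum_(j < d1) \sum_(k < d1) (toc (X0 j k) / block_weight) *: (w j *m (w k)^t*)) *m rho.
Proof.
move=> t0; rewrite mulmx_suml; apply: eq_bigr => j _.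
rewrite exchange_big mulmx_suml; apply: eq_bigr => k _ /=.
rewrite -scalemxAl matrix_unit_state // scaler_sumr; apply: eq_bigr => b _.
rewrite scaler_sumr; apply: eq_bigr => c _.
by rewrite scalerA ofcK mulrA.
Qed.

Lemma peel_block (s : 'M[K]_d) : psd rho -> (forall a, S a -> s *m a = a) ->
  (forall x : 'cV_d, (x^t* *m rho *m x) 0 0 = 0 -> s *m x = 0) ->
  splits_off_block S rho.
Proof.
move=> hr hs faith; have t0 := block_weight_gt0 hr hs faith.
exists d1, d2, block_state, z, block_vector => block; split.
- exact: block_state_is_state.
- split; [exact: central_projection_mem|exact: central_projection_herm
    |exact: central_idem| |exact: central_comm].
  apply: contra e0 => /eqP z0; rewrite -(central_projection_w Se ee).
  by rewrite z0 mul0mx.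
- by split; [exact: block_vector_frame|exact: block_vector_central].
(* The factor [block_weight] compensates the normalization of [block_state]. *)
- move=> a Sa; exists (fun j k => ofc (block_weight * corner_coef a j k)).
  change (a *m z *m rho = first_block (fun j k => ofc (block_weight * corner_coef a j k))).
  rewrite first_blockE // central_expand // mulmx_suml.
  apply: eq_bigr => j _; rewrite mulmx_suml; apply: eq_bigr => k _.
  by rewrite ofcK mulrAC mulfV ?gt_eqF // mul1r scalemxAl.
move=> X0; change (block X0) with (first_block X0); rewrite first_blockE //.
eexists; split; [| |by []].
  apply: (sub_sum hS) => j; apply: (sub_sum hS) => k; apply: (subZ hS).
  by apply: (saM hS); [have [] := wS (ltn_ord j)|exact: wSJ].
rewrite mulmx_suml; apply: eq_bigr => j _.
rewrite mulmx_suml; apply: eq_bigr => k _; rewrite -scalemxAl; congr (_ *: _).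
have [Sk ek] := wS (ltn_ord k).
rewrite -mulmxA; congr (_ *m _); apply: trmxC_inj.
by rewrite trmxC_mul trmxCK central_projection_herm central_projection_w.
Qed.

End Peel.

Lemma star_algebra_peel d (S : 'M[K]_d -> Prop) (s rho a : 'M[K]_d) :
  star_algebra S -> (forall a, S a -> s *m a = a) ->
  psd rho -> (forall a, S a -> rho *m a = a *m rho) ->
  (forall x : 'cV_d, (x^t* *m rho *m x) 0 0 = 0 -> s *m x = 0) ->
  S a -> a != 0 ->
  splits_off_block S rho.
Proof.
move=> hS hs hr comm faith Sa a0.
have [e [Se eH ee e0 emin]] := minimal_projection hS Sa a0.
have [d2 [v [ev vf vx]]] : exists n (v : nat -> 'cV[K]_d),
    [/\ forall i, (i < n)%N -> e *m v i = v i, frame 1%:M n v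
      & forall x : 'cV[K]_d, e *m x = x -> x = \sum_(i < n) v i *m ((v i)^t* *m x)].
  apply: (@orthonormal_basis _ _ (fun x : 'cV[K]_d => e *m x = x)).
  split; first by rewrite mulmx0.
    by move=> x y hx hy; rewrite mulmxDr hx hy.
  by move=> c x hx; rewrite -scalemxAr hx.
have [d1 [w [wS wf wx]]] : exists n (w : nat -> 'M[K]_d),
    [/\ forall i, (i < n)%N -> S (w i) /\ w i *m e = w i, frame e n w
      & forall x, S x /\ x *m e = x -> x = \sum_(i < n) w i *m ((w i)^t* *m x)].
  apply: (@maximal_frame _ _ _ (fun x => S x /\ x *m e = x)) => //.
  - split; first by split; [exact: (sub0 hS)|rewrite mul0mx].
      by move=> x y [h1 h2] [h3 h4]; split; [exact: (subD hS)|rewrite mulmxDl h2 h4].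
    by move=> c x [h1 h2]; split; [exact: (subZ hS)|rewrite -scalemxAl h2].
  - move=> x y [h1 h2] [h3 h4].
    have [|c hc] := emin (x^t* *m y).
      by apply: (saM hS) => //; exact: (saJ hS).
    by exists c; rewrite -hc -{1}h2 -{1}h4 trmxC_mul eH !mulmxA.
  by move=> x [].
have ve := range_projection eH ev vx ee.
exact: (peel_block hS Se eH ee e0 emin comm wS wf wx ev vf ve hr hs faith).
Qed.

Lemma projection_rank_lt d (s z : 'M[K]_d) : s *m s = s -> z *m z = z -> z != 0 ->
  s *m z = z -> z *m s = z -> (\rank (s - z)%R < \rank s)%N.
Proof.
move=> ss zz z0 sz zs; rewrite ltnNge; apply: contra z0 => le.
have sub : ((s - z)%R <= s)%MS.
  by apply/submxP; exists (s - z); rewrite mulmxBl ss zs.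
have : (s <= (s - z)%R)%MS.
  by have := mxrank_leqif_eq sub => -[_]; rewrite eqn_leq mxrankS //= le => /esym /andP [].
by move=> /submxP [D e]; rewrite -sz e -mulmxA mulmxBl sz zz subrr mulmx0.
Qed.

(** Induction on the rank of [s], the unit for [S]. After one block with central projection [z] is
    removed, the ideal [S'] annihilated by [z] remains, with unit [s - z] of smaller rank. The same
    [rho] serves at every stage because it stays faithful on the smaller unit. *)
Theorem star_algebra_blocks d n (S : 'M[K]_d -> Prop) (s rho : 'M[K]_d) :
  (\rank s < n)%N -> star_algebra S -> s^t* = s -> s *m s = s ->
  (forall a, S a -> s *m a = a) ->
  psd rho -> (forall a, S a -> rho *m a = a *m rho) ->
  (forall x : 'cV_d, (x^t* *m rho *m x) 0 0 = 0 -> s *m x = 0) ->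
  exists bs (u : nat -> 'cV[K]_d),
    [/\ frame 1%:M (block_total bs) u,
        forall r, (r < block_total bs)%N -> s *m u r = u r,
        forall d1 d2 r0, In (d1, d2, r0) bs -> is_state d2 r0
      & forall X, (exists a, S a /\ X = a *m rho) <-> exists Xs, X = block_sum bs Xs u].
Proof.
elim: n S s => [//|n IHn] S s lt_n hS sH ss hs hr comm faith.
have [[a [Sa a0]]|noa] := pselect (exists a, S a /\ a != 0); last first.
  have S0 a : S a -> a = 0.
    by move=> Sa; apply: contrapT => /eqP a0; apply: noa; exists a.
  exists nil, (fun=> 0); split=> //.
  move=> X; split=> [[a [/S0 -> ->]]|[Xs ->]].
    by exists (fun=> idm); rewrite mul0mx block_sum_nil.
  by exists 0; rewrite block_sum_nil mul0mx; split=> //; exact: (sub0 hS).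
have [n1 [n2 [r0 [z [u [hr0 [Sz zH zz z0 zc] [uf zu] fwd bwd]]]]]] :=
  star_algebra_peel hS hs hr comm faith Sa a0.
have sz : s *m z = z by exact: hs.
have zs : z *m s = z by apply: trmxC_inj; rewrite trmxC_mul zH sH.
pose S' a := S a /\ a *m z = 0.
have zS' a' : S' a' -> z *m a' = 0 by move=> [h1 h2]; rewrite -zc.
have hS' : star_algebra S'.
  split; first split.
  - by split; [exact: (sub0 hS)|rewrite mul0mx].
  - by move=> x y [h1 h2] [h3 h4]; split; [exact: (subD hS)|rewrite mulmxDl h2 h4 addr0].
  - by move=> c x [h1 h2]; split; [exact: (subZ hS)|rewrite -scalemxAl h2 scaler0].
  - by move=> x y [h1 h2] [h3 h4]; split; [exact: (saM hS)|rewrite -mulmxA h4 mulmx0].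
  move=> x hx; have [h1 h2] := hx; split; first exact: (saJ hS).
  by apply: trmxC_inj; rewrite trmxC_mul trmxCK zH trmxC0 zS'.
have [|||||||bs [u' [uf' su' hbs iff]]] := IHn S' (s - z) _ hS'.
- by apply: (@leq_trans (\rank s)) => //; exact: projection_rank_lt.
- by rewrite trmxCB sH zH.
- by rewrite mulmxBl !mulmxBr ss sz zs zz subrr subr0.
- by move=> a' h; have [h1 _] := h; rewrite mulmxBl hs // zS' // subr0.
- by [].
- by move=> a' [h1 _]; exact: comm.
- move=> x /faith sx; rewrite mulmxBl sx.
  by rewrite -zs -mulmxA sx mulmx0 subrr.
(* The new vectors lie in the range of [z] and the old ones in its kernel, so the concatenation is
   again a frame. *)
pose u'' r := if (r < n1 * n2)%N then u r else u' (r - n1 * n2)%N.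
have su'' r : (r < block_total bs)%N -> z *m u' r = 0.
  by move=> h; rewrite -su' // mulmxA mulmxBr zs zz subrr mul0mx.
have orth i j : (i < n1 * n2)%N -> (j < block_total bs)%N -> (u i)^t* *m u' j = 0.
  by move=> hi hj; rewrite -(zu i) // trmxC_mul zH -mulmxA su'' // mulmx0.
have lt_block (j : 'I_n1) (b : 'I_n2) : (j * n2 + b < n1 * n2)%N.
  apply: (@leq_trans (j.+1 * n2)); last by rewrite leq_mul2r ltn_ord orbT.
  by rewrite mulSnr ltn_add2l.
pose block (X0 : Mat) := \sum_(j < n1) \sum_(b < n2) \sum_(k < n1) \sum_(c < n2)
      (toc (X0 j k) * toc (r0 b c)) *: (u (j * n2 + b)%N *m (u (k * n2 + c)%N)^t*).
have sumE Xs : block_sum ((n1, n2, r0) :: bs) Xs u'' =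
    block (Xs O) + block_sum bs (fun i => Xs i.+1) u'.
  rewrite block_sum_cons; apply: (congr2 +%R).
    apply: eq_bigr => j _; apply: eq_bigr => b _; apply: eq_bigr => k _.
    by apply: eq_bigr => c _; rewrite /u'' !lt_block.
  apply: eq_bigr => i _; apply: eq_bigr => j _.
  by rewrite /u'' !ltnNge !leq_addr /= !addKn.
exists ((n1, n2, r0) :: bs), u''; split.
- move=> i j hi hj; rewrite /u''.
  have bound k : (k < block_total ((n1, n2, r0) :: bs))%N -> ~~ (k < n1 * n2)%N ->
      (k - n1 * n2 < block_total bs)%N.
    move=> hk; rewrite -leqNgt => hk'.
    by rewrite ltn_subLR.
  case: ifPn => hi'; case: ifPn => hj'.
  + exact: uf.
  + rewrite orth ?bound // (_ : (i == j) = false) ?scale0r //.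
    by apply/negbTE; apply: contra hj' => /eqP <-.
  + apply: trmxC_inj; rewrite trmxC_mul trmxCK orth ?bound //.
    rewrite (_ : (i == j) = false) ?scale0r ?trmxC0 //.
    by apply/negbTE; apply: contra hi' => /eqP ->.
  + rewrite uf' ?bound //; congr (_%:R *: _); congr nat_of_bool.
    rewrite -!leqNgt in hi' hj'.
    by rewrite -(eqn_add2l (n1 * n2)) !subnKC.
- move=> r hr'; rewrite /u''; case: ifPn => h.
    by rewrite -zu // mulmxA sz.
  have h' : (r - n1 * n2 < block_total bs)%N.
    by move: h; rewrite -leqNgt => h; rewrite ltn_subLR.
  by rewrite -su' // mulmxA mulmxBr ss sz.
- by move=> d1 d2 r1 [e|h]; [case: e => _ <- <-|exact: hbs h].
move=> X; split=> [[b [Sb ->]]|[Xs ->]].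
  have [X0 hX0] := fwd b Sb.
  (* The part [b *m z] belongs to the head block, and [b - b *m z] lies in [S']. *)
  have [|Xs hXs] := (iff ((b - b *m z) *m rho)).1.
    exists (b - b *m z); split=> //; split.
      by apply: (subB hS) => //; exact: (saM hS).
    by rewrite mulmxBl -mulmxA zz subrr.
  exists (fun i => if i is i'.+1 then Xs i' else X0); rewrite sumE /=.
  by rewrite -hXs mulmxBl hX0 addrC subrK.
have [a1 [Sa1 a1z ea1]] := bwd (Xs O).
have [a2 [[Sa2 a2z] ea2]] : exists a, S' a /\ block_sum bs (fun i => Xs i.+1) u' = a *m rho.
  by apply/(iff _); exists (fun i => Xs i.+1).
exists (a1 + a2); split; first exact: (subD hS).
by rewrite sumE ea2 mulmxDl ea1.
Qed.

(** * Channels in Kraus form *)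

Lemma linear_matrix (F : fieldType) d (f : 'M[F]_d -> 'M_d) : linear f ->
  exists M, forall X, mxvec (f X) = mxvec X *m M.
Proof.
move=> hf; pose fl := GRing.isLinear.Build F 'M[F]_d 'M[F]_d _ f hf.
pose f' : {linear 'M[F]_d -> 'M[F]_d} := HB.pack f fl.
by exists (lin_mx f') => X; rewrite mul_vec_lin.
Qed.

(** Dimension count: the first identity puts the range of [h] inside that of [f], and the inclusion
    of kernels makes the rank of [f] no larger. *)
Lemma linear_range_eq (F : fieldType) d (f h : 'M[F]_d -> 'M_d) :
  linear f -> linear h -> (forall X, f (h X) = h X) ->
  (forall X, h X = 0 -> f X = 0) -> forall X, exists X', f X = h X'.
Proof.
move=> /linear_matrix [A hA] /linear_matrix [B hB] fh ker X.
have BA : B = B *m A.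
  apply/row_matrixP => i; rewrite !rowE mulmxA -[delta_mx 0 i]vec_mxK.
  by rewrite -hB -hA fh.
have BsA : (B <= A)%MS by apply/submxP; exists B.
have kk : (kermx B <= kermx A)%MS.
  apply/rV_subP => v /sub_kermxP hv; apply/sub_kermxP.
  rewrite -[v]vec_mxK -hA ker ?linear0 //.
  by apply: (can_inj mxvecK); rewrite hB vec_mxK hv linear0.
have rk : (\rank A <= \rank B)%N.
  have := mxrankS kk; rewrite !mxrank_ker.
  have := rank_leq_row A; have := rank_leq_row B; move: (\rank A) (\rank B) => a b ha hb.
  by rewrite leq_sub2lE.
have : (A <= B)%MS.
  by have [_] := mxrank_leqif_eq BsA; rewrite eqn_leq rk mxrankS //= => /esym /andP [].
move=> /submxP [D AD]; exists (vec_mx (mxvec X *m D)).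
by apply: (can_inj mxvecK); rewrite hA hB vec_mxK AD mulmxA.
Qed.

Section Kraus.
Variable (F : numClosedFieldType).

Lemma orthogonal_projection d (S : 'cV[F]_d -> Prop) : subspace S ->
  exists Q : 'M_d, [/\ Q^t* = Q, Q *m Q = Q, forall x, S x -> Q *m x = x
    & forall x, S (Q *m x)].
Proof.
move=> hS; have [n [w [wS wf wx]]] := orthonormal_basis hS.
pose Q := \sum_(i < n) w i *m (w i)^t*.
have QH : Q^t* = Q.
  by rewrite trmxC_sum; apply: eq_bigr => i _; rewrite trmxC_mul trmxCK.
have Qx x : S x -> Q *m x = x.
  move=> /wx {2}->; rewrite mulmx_suml; apply: eq_bigr => i _.
  by rewrite mulmxA.
have SQ x : S (Q *m x).
  rewrite mulmx_suml; apply: (sub_sum hS) => i.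
  rewrite -mulmxA [_ *m x]mx11_scalar mul_mx_scalar.
  by apply: (subZ hS); exact: wS.
exists Q; split=> //; apply: mulmx_col_ext => x.
by rewrite -mulmxA Qx.
Qed.

Definition kraus_map d (I : finType) (A : I -> 'M[F]_d) (X : 'M_d) :=
  \sum_i A i *m X *m (A i)^t*.

Definition kraus_dual d (I : finType) (A : I -> 'M[F]_d) (X : 'M_d) :=
  \sum_i (A i)^t* *m X *m A i.

Definition kraus_channel d (f : 'M[F]_d -> 'M_d) := exists (I : finType) (A : I -> 'M_d),
  (forall X, f X = kraus_map A X) /\ \sum_i (A i)^t* *m A i = 1%:M.

Section Maps.
Variables (d : nat) (I : finType) (A : I -> 'M[F]_d).

Lemma kraus_map_linear : linear (kraus_map A).
Proof.
move=> c X Y; rewrite /kraus_map scaler_sumr -big_split /=.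
by apply: eq_bigr => i _; rewrite mulmxDr mulmxDl -scalemxAr -scalemxAl.
Qed.

Lemma kraus_dual_linear : linear (kraus_dual A).
Proof.
move=> c X Y; rewrite /kraus_dual scaler_sumr -big_split /=.
by apply: eq_bigr => i _; rewrite mulmxDr mulmxDl -scalemxAr -scalemxAl.
Qed.

Lemma kraus_map_adj X : (kraus_map A X)^t* = kraus_map A (X^t*).
Proof.
by rewrite trmxC_sum; apply: eq_bigr => i _; rewrite !trmxC_mul trmxCK !mulmxA.
Qed.

Lemma kraus_dual_adj X : (kraus_dual A X)^t* = kraus_dual A (X^t*).
Proof.
by rewrite trmxC_sum; apply: eq_bigr => i _; rewrite !trmxC_mul trmxCK !mulmxA.
Qed.

Lemma kraus_duality B X : \tr (kraus_dual A B *m X) = \tr (B *m kraus_map A X).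
Proof.
rewrite mulmx_suml mulmx_sumr !linear_sum; apply: eq_bigr => i _ /=.
by rewrite -!mulmxA mxtrace_mulC !mulmxA.
Qed.

Lemma kraus_map_psd X : psd X -> psd (kraus_map A X).
Proof. by move=> h; apply: psd_sum => i; exact: psd_conj. Qed.

End Maps.

Lemma trace_nondegenerate d (A B : 'M[F]_d) :
  (forall X, \tr (A *m X) = \tr (B *m X)) -> A = B.
Proof.
move=> h; apply/eqP; rewrite -subr_eq0; apply/eqP; apply: gram_eq0.
by rewrite mxtrace_mulC mulmxBl linearB /= h subrr.
Qed.

(* A family [L] on the support of a faithful invariant state [rho], in which the
   corner projection [Q] plays the role of the identity. *)
Section FaithfulCorner.
Variables (d : nat) (I : finType) (L : I -> 'M[F]_d) (Q : 'M[F]_d).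
Hypotheses (QH : Q^t* = Q) (QQ : Q *m Q = Q)
  (QL : forall i, Q *m L i = L i) (LQ : forall i, L i *m Q = L i)
  (LL : \sum_i (L i)^t* *m L i = Q).
Local Notation g := (kraus_map L).
Local Notation E := (kraus_dual L).
Hypothesis (gg : forall X, g (g X) = g X).
Definition corner_rho := \sum_i L i *m (L i)^t*.
Local Notation rho := corner_rho.
Hypothesis (faith : forall x : 'cV_d, (x^t* *m rho *m x) 0 0 = 0 -> Q *m x = 0).

Definition commutant_algebra a := [/\ Q *m a = a, a *m Q = a
  & forall i, a *m L i = L i *m a /\ a *m (L i)^t* = (L i)^t* *m a].
Local Notation Alg := commutant_algebra.

Lemma commutant_star_algebra : star_algebra Alg.
Proof.
split; first split.
- by split=> [||i]; rewrite !(mulmx0, mul0mx).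
- move=> x y [h1 h2 h3] [k1 k2 k3]; split; rewrite ?mulmxDr ?mulmxDl ?h1 ?k1 ?h2 ?k2 //.
  move=> i; have [a b] := h3 i; have [a' b'] := k3 i.
  by rewrite !mulmxDl !mulmxDr a b a' b'.
- move=> c x [h1 h2 h3]; split; rewrite -?scalemxAr -?scalemxAl ?h1 ?h2 //.
  move=> i; have [a b] := h3 i.
  by rewrite -!scalemxAr -!scalemxAl a b.
- move=> x y [h1 h2 h3] [k1 k2 k3]; split; first by rewrite mulmxA h1.
    by rewrite -mulmxA k2.
  move=> i; have [a b] := h3 i; have [a' b'] := k3 i.
  by rewrite -!mulmxA a' b' !mulmxA a b.
move=> x [h1 h2 h3]; split; try by apply: trmxC_inj; rewrite trmxC_mul trmxCK QH.
move=> i; have [a b] := h3 i.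
split; apply: trmxC_inj; rewrite !trmxC_mul !trmxCK //.
Qed.

Lemma corner_rho_psd : psd rho.
Proof. by apply: psd_sum => i; exact: psd_gram. Qed.

Lemma corner_rhoE : rho = g 1%:M.
Proof. by apply: eq_bigr => i _; rewrite mulmx1. Qed.

Lemma corner_rho_comm a : Alg a -> rho *m a = a *m rho.
Proof.
move=> [_ _ h]; rewrite mulmx_suml mulmx_sumr; apply: eq_bigr => i _.
by have [a1 a2] := h i; rewrite -mulmxA -a2 !mulmxA a1.
Qed.

Lemma corner_map a : Alg a -> g a = a *m rho.
Proof.
move=> [_ _ h]; rewrite mulmx_sumr; apply: eq_bigr => i _.
by have [a1 a2] := h i; rewrite mulmxA a1.
Qed.

Lemma faithful_mul0 m (a : 'M[F]_(m, d)) : a *m rho = 0 -> a *m Q = 0.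
Proof.
move=> h; apply: trmxC_inj; rewrite trmxC_mul QH trmxC0.
apply: mulmx_col_ext => x; rewrite mul0mx -mulmxA; apply: faith.
rewrite -!mulmxA (_ : rho *m (a^t* *m x) = 0) ?mulmx0 ?mxE //.
have rH : rho^t* = rho by rewrite corner_rhoE kraus_map_adj trmxC1.
by rewrite mulmxA -{1}rH -trmxC_mul h trmxC0 mul0mx.
Qed.

Lemma dual_idem B : E (E B) = E B.
Proof. by apply: trace_nondegenerate => X; rewrite !kraus_duality gg. Qed.

Lemma dual_corner B : Q *m E B = E B /\ E B *m Q = E B.
Proof.
split; rewrite ?mulmx_sumr ?mulmx_suml; apply: eq_bigr => i _.
  by rewrite !mulmxA -{1}QH -trmxC_mul LQ.
by rewrite -mulmxA LQ.
Qed.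

(* Lindblad's argument: [sum_i [a, L_i]^* [a, L_i] = E (a^* a) - a^* a] has zero
   expectation in the invariant state [rho]. *)
Lemma dual_commute B i : E B *m L i = L i *m E B.
Proof.
set a := E B; have [Qa aQ] := dual_corner B; rewrite -/a in Qa aQ.
have Ea : E a = a by exact: dual_idem.
have EaH : E (a^t*) = a^t* by rewrite -kraus_dual_adj Ea.
pose c k := a *m L k - L k *m a.
have cc : \sum_k (c k)^t* *m c k = E (a^t* *m a) - a^t* *m a.
  transitivity (E (a^t* *m a) - E (a^t*) *m a - a^t* *m E a + a^t* *m Q *m a).
    rewrite /kraus_dual mulmx_suml mulmx_sumr -LL mulmx_sumr mulmx_suml.
    rewrite -!sumrB -big_split /=; apply: eq_bigr => k _.
    rewrite trmxCB !trmxC_mul mulmxBr !mulmxBl !mulmxA.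
    by rewrite opprB addrA addrAC; congr (_ + _); rewrite addrAC.
  by rewrite EaH Ea -mulmxA Qa subrK.
have g_rho : g rho = rho by rewrite corner_rhoE gg.
have tr0 : \sum_k \tr ((c k)^t* *m c k *m rho) = 0.
  rewrite -linear_sum -mulmx_suml cc mulmxBl linearB /=.
  by rewrite kraus_duality g_rho subrr.
(* Expanding [rho] turns [tr0] into the vanishing of the sum of the squared norms of all
   [c k *m L j]. *)
have c0 k j : c k *m L j = 0.
  move: k j; suff h : \sum_(p : I * I) \tr ((c p.1 *m L p.2)^t* *m (c p.1 *m L p.2)) = 0.
    by move=> k j; exact: (sum_gram_eq0 h (k, j)).
  rewrite -(pair_bigA _ (fun k j => \tr ((c k *m L j)^t* *m (c k *m L j)))) /=.
  apply: etrans tr0; apply: eq_bigr => k _; rewrite mulmx_sumr linear_sum; apply: eq_bigr => j _ /=.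
  by rewrite trmxC_mul -mulmxA mxtrace_mulC !mulmxA.
have cQ : c i *m Q = 0.
  apply: faithful_mul0; rewrite mulmx_sumr big1 // => j _.
  by rewrite mulmxA c0 mul0mx.
by apply/eqP; rewrite -subr_eq0 -/(c i) -cQ mulmxBl -!mulmxA LQ aQ.
Qed.

Lemma dual_mem B : Alg (E B).
Proof.
have [h1 h2] := dual_corner B; split=> // i; split; first exact: dual_commute.
apply: trmxC_inj; rewrite !trmxC_mul trmxCK kraus_dual_adj.
by rewrite dual_commute.
Qed.

(** For the forward inclusion, [Z |-> E (g Z) *m rho] takes its values in [Alg] times [rho], all
    fixed by [g], and its kernel lies in that of [g]; a dimension count gives equality of ranges. *)
Lemma corner_range X : (exists Y, X = g Y) <-> (exists a, Alg a /\ X = a *m rho).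
Proof.
split=> [[Y ->]|[a [ha ->]]]; last by exists a; rewrite corner_map.
have [||||X' ->] := @linear_range_eq _ _ g (fun X => E (g X) *m rho) _ _ _ _ Y.
- exact: kraus_map_linear.
- move=> c Z T; rewrite kraus_map_linear kraus_dual_linear mulmxDl.
  by rewrite -scalemxAl.
- by move=> Z; rewrite -corner_map ?gg //; exact: dual_mem.
(* By idempotence, the squared norm of [g Z] is the trace of [g Z] against [g] of the adjoint of
   [g Z]; duality moves that [g] to the left factor, which becomes [E (g Z) = 0]. *)
- move=> Z /faithful_mul0; have [_ ->] := dual_corner (g Z) => h.
  apply: trmxC_inj; rewrite trmxC0; apply: gram_eq0.
  by rewrite trmxCK -{2}gg kraus_map_adj -kraus_duality h mul0mx mxtrace0.
by exists (E (g X')); split=> //; exact: dual_mem.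
Qed.

End FaithfulCorner.
End Kraus.

(** All Kraus operators map into the support of [r = f 1], so [Q f(X) Q = f(X)]. Cutting them by [Q]
    on the right therefore changes neither the range nor idempotence, and makes [Q] the unit of the
    cut family. *)
Theorem idempotent_channel_range d (f : 'M[K]_d -> 'M_d) :
  kraus_channel f -> (forall X, f (f X) = f X) ->
  exists bs (u : nat -> 'cV[K]_d),
    [/\ frame 1%:M (block_total bs) u,
        forall d1 d2 r0, In (d1, d2, r0) bs -> is_state d2 r0
      & forall X, (exists Y, X = f Y) <-> exists Xs, X = block_sum bs Xs u].
Proof.
move=> [I [A [fA AA]]] ff; pose r := f 1%:M.
have rA : r = \sum_i A i *m (A i)^t*.
  by rewrite /r fA; apply: eq_bigr => i _; rewrite mulmx1.
have rp : psd r by rewrite rA; apply: psd_sum => i; exact: psd_gram.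
have rH := psd_herm rp.
have [Q [QH QQ Qr SQ]] : exists Q : 'M_d, [/\ Q^t* = Q, Q *m Q = Q,
    forall x : 'cV_d, (exists y, x = r *m y) -> Q *m x = x
    & forall x : 'cV_d, exists y, Q *m x = r *m y].
  apply: orthogonal_projection; split.
  - by exists 0; rewrite mulmx0.
  - by move=> x y [x' ->] [y' ->]; exists (x' + y'); rewrite mulmxDr.
  - by move=> c x [x' ->]; exists (c *: x'); rewrite scalemxAr.
have {}Qr : Q *m r = r.
  by apply: mulmx_col_ext => x; rewrite -mulmxA Qr //; exists x.
have rQ : r *m Q = r by apply: trmxC_inj; rewrite trmxC_mul rH QH.
have rfaith (x : 'cV_d) : r *m x = 0 -> Q *m x = 0.
  move=> rx; apply: gram00_eq0; rewrite trmxC_mul QH -mulmxA (mulmxA Q) QQ.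
  have [y ->] := SQ x; rewrite mulmxA.
  by rewrite -[x^t* *m r]trmxCK trmxC_mul trmxCK rH rx trmxC0 mul0mx mxE.
(* The compression of [r] to the complement of [Q] is zero and is also a sum of Gram matrices of the
   [(1 - Q) A i]. *)
have QA i : Q *m A i = A i.
  suff h : ((1%:M - Q) *m A i)^t* = 0.
    apply/eqP; rewrite eq_sym -subr_eq0 -{1}[A i]mul1mx -mulmxBl.
    by apply/eqP; apply: trmxC_inj; rewrite h trmxC0.
  move: i; apply: sum_gram_eq0.
  transitivity (\tr ((1%:M - Q) *m r *m (1%:M - Q))).
    rewrite rA mulmx_sumr mulmx_suml linear_sum; apply: eq_bigr => i _ /=.
    by rewrite trmxCK trmxC_mul trmxCB trmxC1 QH !mulmxA.
  by rewrite mulmxBl mul1mx Qr subrr mul0mx mxtrace0.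
have AQ i : (A i)^t* *m Q = (A i)^t* by rewrite -[in RHS]QA trmxC_mul QH.
pose L i := A i *m Q.
have gE X : kraus_map L X = f (Q *m X *m Q).
  by rewrite fA; apply: eq_bigr => i _; rewrite trmxC_mul QH !mulmxA.
have QfQ X : Q *m f X *m Q = f X.
  rewrite fA mulmx_sumr mulmx_suml; apply: eq_bigr => i _.
  by rewrite !mulmxA QA -mulmxA AQ.
have range X : (exists Y, X = f Y) <-> exists Y, X = kraus_map L Y.
  split=> -[Y ->]; last by exists (Q *m Y *m Q).
  by exists (f Y); rewrite gE QfQ ff.
have gg X : kraus_map L (kraus_map L X) = kraus_map L X by rewrite !gE QfQ ff.
have QL i : Q *m L i = L i by rewrite mulmxA QA.
have LQ i : L i *m Q = L i by rewrite -mulmxA QQ.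
have LL : \sum_i (L i)^t* *m L i = Q.
  transitivity (Q *m (\sum_i (A i)^t* *m A i) *m Q); last by rewrite AA mulmx1 QQ.
  rewrite mulmx_sumr mulmx_suml; apply: eq_bigr => i _.
  by rewrite trmxC_mul QH !mulmxA.
(* Vanishing of the form says that [Q] kills every adjoint of [A i] applied to [x]. Since [r] is
   invariant and [r = r *m Q], the form of [r] at [x] vanishes as well. *)
have faith (x : 'cV_d) : (x^t* *m corner_rho L *m x) 0 0 = 0 -> Q *m x = 0.
  move=> h; have {}h : \sum_i \tr ((((L i)^t* *m x))^t* *m ((L i)^t* *m x)) = 0.
    rewrite -[RHS]h -trace_mx11 mulmx_sumr mulmx_suml linear_sum.
    by apply: eq_bigr => i _ /=; rewrite trmxC_mul trmxCK !mulmxA.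
  apply: rfaith; apply: (psd_ker rp); rewrite {1}/r -ff fA.
  rewrite mulmx_sumr mulmx_suml summxE big1 // => i _.
  rewrite -!mulmxA -/r -rQ -mulmxA (mulmxA Q) -{1}QH -trmxC_mul.
  by rewrite (sum_gram_eq0 h) !mulmx0 mxE.
have QAlg a : commutant_algebra L Q a -> Q *m a = a by case.
have hS : star_algebra (commutant_algebra L Q) by exact: commutant_star_algebra.
have rhop : psd (corner_rho L) by exact: corner_rho_psd.
have comm a : commutant_algebra L Q a -> corner_rho L *m a = a *m corner_rho L.
  exact: corner_rho_comm.
have [bs [u [uf _ hbs hX]]] := star_algebra_blocks (ltnSn _) hS QH QQ QAlg rhop comm faith.
exists bs, u; split=> // X; rewrite range -hX.
by apply: corner_range.
Qed.

(** * Choi matrices, compositions and uniform bounds *)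

Section Choi.
Variable F : numClosedFieldType.

Lemma mx_delta_sum d (f : 'M[F]_d -> 'M_d) X : linear f ->
  f X = \sum_k \sum_l X k l *: f (delta_mx k l).
Proof.
move=> hf; pose fl := GRing.isLinear.Build F 'M[F]_d 'M[F]_d _ f hf.
pose f' : {linear 'M[F]_d -> 'M[F]_d} := HB.pack f fl.
transitivity (f' X); first by [].
rewrite {1}[X]matrix_sum_delta linear_sum; apply: eq_bigr => k _.
by rewrite linear_sum; apply: eq_bigr => l _; rewrite linearZ.
Qed.

Lemma kraus_entry d (I : finType) (A : I -> 'M[F]_d) k l i j :
  kraus_map A (delta_mx k l) i j = \sum_t A t i k * (A t j l)^*.
Proof.
rewrite summxE; apply: eq_bigr => t _.
rewrite mxE (bigD1 l) //= big1 ?addr0 => [|m ml].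
  rewrite mxE (bigD1 k) //= big1 ?addr0 => [|m mk]; rewrite !mxE.
    by rewrite !eqxx mulr1.
  by rewrite (negPf mk) mulr0.
by rewrite mxE big1 ?mul0r // => m' _; rewrite mxE (negPf ml) andbF mulr0.
Qed.

(** The quadratic form of the Choi matrix, with rows and columns indexed by pairs of an output and
    an input index. As a finite sum of entries it passes directly to pointwise limits. *)
Definition choi_positive d (f : 'M[F]_d -> 'M_d) := forall x : 'M[F]_d,
  0 <= \sum_(p : 'I_d * 'I_d) \sum_(q : 'I_d * 'I_d)
    (x p.1 p.2)^* * f (delta_mx p.2 q.2) p.1 q.1 * x q.1 q.2.

(** The columns of a factor [B] of the Choi matrix, reshaped as [d x d] matrices, are the Kraus
    operators. Trace preservation becomes their normalization by nondegeneracy of the trace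
    pairing. *)
Lemma choi_kraus d (f : 'M[F]_d -> 'M_d) :
  linear f -> (forall X, \tr (f X) = \tr X) -> choi_positive f -> kraus_channel f.
Proof.
move=> hf trf pos; pose P := ('I_d * 'I_d)%type.
pose A : 'M[F]_#|{: P}| := \matrix_(r, s)
  f (delta_mx (enum_val r).2 (enum_val s).2) (enum_val r).1 (enum_val s).1.
have hA : psd A.
  move=> x; have := pos (\matrix_(i, k) x (enum_rank (i, k)) 0).
  rewrite (reindex (fun r : 'I_#|{: P}| => enum_val r)) /=; last first.
    exact/onW_bij/enum_val_bij.
  rewrite -mulmxA mxE; congr (0 <= _); apply: eq_bigr => r _.
  rewrite !mxE (reindex (fun r : 'I_#|{: P}| => enum_val r)) /=; last first.
    exact/onW_bij/enum_val_bij.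
  rewrite mulr_sumr; apply: eq_bigr => s _.
  by rewrite !mxE -!surjective_pairing !enum_valK mulrA.
have [B AB] := psd_factor hA.
pose Kr t := \matrix_(i, k) B (enum_rank (i, k)) t : 'M[F]_d.
have fK X : f X = kraus_map Kr X.
  rewrite (mx_delta_sum _ hf) (mx_delta_sum _ (@kraus_map_linear _ _ _ Kr)).
  apply: eq_bigr => k _; apply: eq_bigr => l _; congr (_ *: _).
  apply/matrixP => i j; rewrite kraus_entry.
  have /matrixP /(_ (enum_rank (i, k)) (enum_rank (j, l))) := AB.
  rewrite !mxE !enum_rankK /= => ->; apply: eq_bigr => t _.
  by rewrite !mxE.
exists 'I_#|{: P}|, Kr; split=> //.
apply: trace_nondegenerate => X; rewrite mul1mx -(trf X) fK.
rewrite -[kraus_map _ _]mul1mx -kraus_duality; congr (\tr (_ *m _)).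
by apply: eq_bigr => t _; rewrite mulmx1.
Qed.

Lemma kraus_channel_linear d (f : 'M[F]_d -> 'M_d) : kraus_channel f -> linear f.
Proof. by move=> [I [A [fA _]]] c X Y; rewrite !fA kraus_map_linear. Qed.

Lemma kraus_channel_trace d (f : 'M[F]_d -> 'M_d) X : kraus_channel f ->
  \tr (f X) = \tr X.
Proof.
move=> [I [A [fA AA]]]; rewrite fA -[kraus_map _ _]mul1mx -kraus_duality.
rewrite (_ : kraus_dual A 1%:M = 1%:M) ?mul1mx // -[RHS]AA.
by apply: eq_bigr => t _; rewrite mulmx1.
Qed.

Lemma kraus_channel_psd d (f : 'M[F]_d -> 'M_d) X : kraus_channel f ->
  psd X -> psd (f X).
Proof. by move=> [I [A [fA _]]] h; rewrite fA; exact: kraus_map_psd. Qed.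

Lemma kraus_channel_choi d (f : 'M[F]_d -> 'M_d) : kraus_channel f -> choi_positive f.
Proof.
move=> [I [A [fA _]]] x.
pose c t := \sum_(p : 'I_d * 'I_d) (x p.1 p.2)^* * A t p.1 p.2.
suff -> : \sum_(p : 'I_d * 'I_d) \sum_(q : 'I_d * 'I_d)
    (x p.1 p.2)^* * f (delta_mx p.2 q.2) p.1 q.1 * x q.1 q.2 = \sum_t c t * (c t)^*.
  by apply: sumr_ge0 => t _; exact: mul_conjC_ge0.
rewrite (eq_bigr (fun p : 'I_d * 'I_d => \sum_(q : 'I_d * 'I_d) \sum_t
    (x p.1 p.2)^* * A t p.1 p.2 * ((A t q.1 q.2)^* * x q.1 q.2))); last first.
  move=> p _; apply: eq_bigr => q _; rewrite fA kraus_entry mulr_sumr mulr_suml.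
  by apply: eq_bigr => t _; rewrite !mulrA.
under eq_bigr do rewrite exchange_big.
rewrite exchange_big; apply: eq_bigr => t _ /=.
rewrite /c rmorph_sum mulr_suml; apply: eq_bigr => p _.
rewrite mulr_sumr; apply: eq_bigr => q _.
by rewrite rmorphM /= conjCK [(A _ _ _)^* * _]mulrC.
Qed.

Lemma kraus_channel_id d : kraus_channel (fun X : 'M[F]_d => X).
Proof.
exists 'I_1, (fun=> 1%:M); split=> [X|].
  by rewrite /kraus_map big_ord1 trmxC1 mul1mx mulmx1.
by rewrite big_ord1 trmxC1 mul1mx.
Qed.

Lemma kraus_channel_comp d (f g : 'M[F]_d -> 'M_d) :
  kraus_channel f -> kraus_channel g -> kraus_channel (fun X => f (g X)).
Proof.
move=> [I [A [fA AA]]] [J [B [gB BB]]].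
exists (J * I)%type, (fun p => A p.2 *m B p.1); split=> [X|].
  rewrite fA gB /kraus_map -(pair_bigA _ (fun j i => A i *m B j *m X *m (A i *m B j)^t*)) /=.
  rewrite exchange_big; apply: eq_bigr => i _; rewrite mulmx_sumr mulmx_suml.
  by apply: eq_bigr => j _; rewrite trmxC_mul !mulmxA.
rewrite -(pair_bigA _ (fun j i => (A i *m B j)^t* *m (A i *m B j))) /= -BB.
apply: eq_bigr => j _.
transitivity ((B j)^t* *m (\sum_i (A i)^t* *m A i) *m B j); last by rewrite AA mulmx1.
rewrite mulmx_sumr mulmx_suml; apply: eq_bigr => i _.
by rewrite trmxC_mul !mulmxA.
Qed.

Lemma kraus_channel_iter d (f : 'M[F]_d -> 'M_d) n : kraus_channel f ->
  kraus_channel (iter n f).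
Proof.
by move=> hf; elim: n => [|n IHn]; [exact: kraus_channel_id|exact: (kraus_channel_comp hf IHn)].
Qed.

(** Normalization bounds the square sum over [t] of any fixed entry of the [A t] by 1; the
    inequality between [a b] and [(a^2 + b^2) / 2] does the rest. The bound holds for all powers of
    a channel at once. *)
Lemma kraus_channel_bound d (f : 'M[F]_d -> 'M_d) k l i j : kraus_channel f ->
  `|f (delta_mx k l) i j| <= 1.
Proof.
move=> [I [A [fA AA]]]; rewrite fA kraus_entry.
have col1 m n : \sum_t `|A t m n| ^+ 2 <= 1.
  have -> : 1 = (1%:M : 'M[F]_d) n n by rewrite mxE eqxx.
  rewrite -AA summxE; apply: ler_sum => t _; rewrite mxE (bigD1 m) //= !mxE.
  rewrite [(A t m n)^* * _]mulrC -normCK lerDl; apply: sumr_ge0 => s _.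
  by rewrite !mxE mulrC mul_conjC_ge0.
apply: le_trans (ler_norm_sum _ _ _) _.
have h2 : (2%:R : F) != 0 by rewrite pnatr_eq0.
apply: (@le_trans _ _ (2%:R^-1 * (\sum_t `|A t i k| ^+ 2 + \sum_t `|A t j l| ^+ 2))).
  rewrite -big_split mulr_sumr; apply: ler_sum => t _ /=.
  rewrite normrM norm_conjC -subr_ge0.
  set a := `|_|; set b := `|_|.
  have -> : 2%:R^-1 * (a ^+ 2 + b ^+ 2) - a * b = 2%:R^-1 * (a - b) ^+ 2 by field.
  by rewrite mulr_ge0 ?invr_ge0 ?ler0n // real_exprn_even_ge0 // rpredB // normr_real.
rewrite ler_pdivrMl ?ltr0n // mulr1 (_ : 2%:R = 1 + 1) ?lerD //.
Qed.

End Choi.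

(** * Limits of powers of a channel *)

Lemma Un_cv_ext (u v : nat -> R) l : u =1 v -> Un_cv u l -> Un_cv v l.
Proof. by move=> /funext ->. Qed.

(** Subsequences are encoded by reindexings with [n <= h n], a condition that preserves limits and
    is stable under composition. *)
Lemma Un_cv_sub (u : nat -> R) l h : (forall n, (n <= h n)%N) ->
  Un_cv u l -> Un_cv (fun n => u (h n)) l.
Proof.
move=> hh hu eps he; have [N hN] := hu eps he; exists N => n hn.
by apply: hN; apply/ssrnat.leP; apply: leq_trans (hh n); apply/ssrnat.leP.
Qed.

Lemma Re_mul (a b : K) : complex.Re (a * b) =
  (complex.Re a * complex.Re b - complex.Im a * complex.Im b)%R.
Proof. by case: a b => ? ? []. Qed.

Lemma Im_mul (a b : K) : complex.Im (a * b) =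
  (complex.Re a * complex.Im b + complex.Im a * complex.Re b)%R.
Proof. by case: a b => ? ? []. Qed.

Definition cvC (u : nat -> K) (l : K) :=
  Un_cv (fun n => complex.Re (u n)) (complex.Re l) /\
  Un_cv (fun n => complex.Im (u n)) (complex.Im l).

Lemma cvC_ext u v l : u =1 v -> cvC u l -> cvC v l.
Proof. by move=> /funext ->. Qed.

Lemma Un_cv_const (c : R) : Un_cv (fun=> c) c.
Proof.
by move=> eps he; exists O => n _; rewrite /Rdist Rminus_diag Rabs_R0.
Qed.

Lemma cvC_const c : cvC (fun=> c) c.
Proof. by split; exact: Un_cv_const. Qed.

Lemma cvC_add u v l m : cvC u l -> cvC v m -> cvC (fun n => u n + v n) (l + m).
Proof.
move=> [h1 h2] [k1 k2]; split.
  rewrite raddfD; apply: Un_cv_ext (CV_plus _ _ _ _ h1 k1) => n.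
  by rewrite raddfD.
rewrite raddfD; apply: Un_cv_ext (CV_plus _ _ _ _ h2 k2) => n.
by rewrite raddfD.
Qed.

Lemma cvC_mul u v l m : cvC u l -> cvC v m -> cvC (fun n => u n * v n) (l * m).
Proof.
move=> [h1 h2] [k1 k2]; split.
  rewrite Re_mul.
  apply: Un_cv_ext (CV_minus _ _ _ _ (CV_mult _ _ _ _ h1 k1) (CV_mult _ _ _ _ h2 k2)).
  by move=> n; rewrite Re_mul.
rewrite Im_mul.
apply: Un_cv_ext (CV_plus _ _ _ _ (CV_mult _ _ _ _ h1 k2) (CV_mult _ _ _ _ h2 k1)).
by move=> n; rewrite Im_mul.
Qed.

Lemma cvC_scale c v m : cvC v m -> cvC (fun n => c * v n) (c * m).
Proof. by move=> h; apply: cvC_mul h; exact: cvC_const. Qed.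

Lemma cvC_sub h u l : (forall n, (n <= h n)%N) -> cvC u l -> cvC (fun n => u (h n)) l.
Proof. by move=> hh [h1 h2]; split; [exact: (Un_cv_sub hh h1)|exact: (Un_cv_sub hh h2)]. Qed.

Lemma cvC_unique u l m : cvC u l -> cvC u m -> l = m.
Proof.
move=> [h1 h2] [k1 k2]; move: (UL_sequence _ _ _ h1 k1) (UL_sequence _ _ _ h2 k2).
by case: l m {h1 h2 k1 k2} => a b [c e] /= -> ->.
Qed.

Lemma cvC_sum (I : finType) (u : I -> nat -> K) l : (forall i, cvC (u i) (l i)) ->
  cvC (fun n => \sum_i u i n) (\sum_i l i).
Proof.
move=> h; elim: (index_enum I) => [|i s IHs].
  by rewrite big_nil; apply: cvC_ext (cvC_const 0) => n; rewrite big_nil.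
by rewrite big_cons; apply: cvC_ext (cvC_add (h i) IHs) => n; rewrite big_cons.
Qed.

Lemma Un_cv_ge0 (u : nat -> R) l : (forall n, Rle 0 (u n)) -> Un_cv u l -> Rle 0 l.
Proof.
move=> h hu; apply: Rnot_lt_le => hl.
have [|N hN] := hu (- l)%R; first by apply: Ropp_0_gt_lt_contravar.
have := hN N (le_n N); rewrite /Rdist => /Rabs_def2 [/RltP h1 _].
have /RleP h3 := h N; move/RltP in hl; rewrite RminusE in h1.
by rewrite R0E in h3 hl; lra.
Qed.

Lemma cvC_ge0 u l : (forall n, 0 <= u n) -> cvC u l -> 0 <= l.
Proof.
move=> h [h1 h2]; rewrite lecE /=; apply/andP; split; last first.
  apply/RleP; apply: Un_cv_ge0 h1 => n; apply/RleP.
  by have := h n; rewrite lecE => /andP [].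
apply/eqP; apply: (UL_sequence _ _ _ h2).
apply: Un_cv_ext (Un_cv_const 0%R) => n.
by have := h n; rewrite lecE => /andP [/eqP ->].
Qed.

Lemma cvC_conj u l : cvC u l -> cvC (fun n => (u n)^*) (l^*).
Proof.
case: l => a b [h1 h2]; split.
  by apply: Un_cv_ext h1 => n /=; case: (u n).
by apply: Un_cv_ext (CV_opp _ _ h2) => n; rewrite /opp_seq /=; case: (u n).
Qed.

Lemma Un_cv_extract (u : nat -> R) (B : R) : (forall n, Rle (Rabs (u n)) B) ->
  exists h, (forall n, (n <= h n)%N) /\ exists l, Un_cv (fun n => u (h n)) l.
Proof.
move=> hB.
have hB' n : Rle (- B) (u n) /\ Rle (u n) B.
  have /RleP := hB n; rewrite RabsE ler_norml => /andP [h1 h2].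
  by split; apply/RleP.
have [l hl] := Bolzano_Weierstrass u _ (compact_P3 (- B) B) hB'.
have ch n : exists p, (n <= p)%N /\ Rlt (Rabs (u p - l)%R) (/ (INR n.+1))%R.
  have pos : Rlt 0 (/ INR n.+1)%R by apply: Rinv_0_lt_compat; apply: lt_0_INR; exact/ssrnat.ltP.
  have [p [hp hv]] := hl (disc l (mkposreal _ pos)) n (ex_intro _ _ (fun x hx => hx)).
  by exists p; split => //; exact/ssrnat.leP.
have [h hh] := choice ch.
exists h; split=> [n|]; first by have [] := hh n.
exists l => eps he; have [N [hN1 hN2]] := archimed_cor1 eps he.
exists N => n hn; have [_ h2] := hh n; rewrite /Rdist.
apply: Rlt_trans h2 _; apply: Rle_lt_trans hN1.
apply: Rinv_le_contravar; first exact: lt_0_INR.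
by apply: le_INR; apply: Nat.le_trans hn _; exact: Nat.le_succ_diag_r.
Qed.

(** The finitely many sequences are refined one after the other, each first in its real and then in
    its imaginary part. *)
Lemma cvC_extract (T : eqType) (s : seq T) (u : T -> nat -> K) :
  (forall t n, `|u t n| <= 1) ->
  exists h, (forall n, (n <= h n)%N) /\ forall t, t \in s -> exists l, cvC (fun n => u t (h n)) l.
Proof.
move=> bd; elim: s => [|t s [h [hh hs]]]; first by exists (fun n => n); split.
have bR n : Rle (Rabs (complex.Re (u t (h n)))) 1 /\ Rle (Rabs (complex.Im (u t (h n)))) 1.
  have := bd t (h n); rewrite normc_def lecR => le1.
  have sq1 : complex.Re (u t (h n)) ^+ 2 + complex.Im (u t (h n)) ^+ 2 <= 1.
    by rewrite -(ler_sqrt _ ler01) sqrtr1.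
  split; apply/RleP; rewrite RabsE -(ler_sqr (x := `|_|)) ?nnegrE ?ler01 //.
    rewrite real_normK ?num_real // expr1n; apply: le_trans sq1.
    by rewrite lerDl sqr_ge0.
  rewrite real_normK ?num_real // expr1n; apply: le_trans sq1.
  by rewrite lerDr sqr_ge0.
have [h1 [hh1 [a ha]]] := Un_cv_extract (fun n => (bR n).1).
have [h2 [hh2 [b hb]]] := Un_cv_extract (fun n => (bR (h1 n)).2).
exists (fun n => h (h1 (h2 n))); split=> [n|t'].
  by apply: leq_trans (hh2 n) _; apply: leq_trans (hh1 _) _.
rewrite inE => /orP [/eqP ->|ht'].
  by exists (Complex a b); split=> //; exact: (Un_cv_sub hh2 ha).
have [l hl] := hs t' ht'; exists l.
have hh12 n : (n <= h1 (h2 n))%N by apply: leq_trans (hh2 n) _.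
exact: (cvC_sub hh12 hl).
Qed.

Definition cv0 (u : nat -> K) := forall eps : R, 0 < eps ->
  exists N, forall n, (N <= n)%N -> normc (u n) < eps.

Lemma Re_le_normc (z : K) : `|complex.Re z| <= normc z.
Proof.
rewrite -(ler_sqr (x := `|_|)) ?nnegrE ?normr_ge0 //; last by case: z => a b; exact: sqrtr_ge0.
case: z => a b /=; rewrite real_normK ?num_real // sqr_sqrtr ?addr_ge0 ?sqr_ge0 //.
by rewrite lerDl sqr_ge0.
Qed.

Lemma Im_le_normc (z : K) : `|complex.Im z| <= normc z.
Proof.
rewrite -(ler_sqr (x := `|_|)) ?nnegrE ?normr_ge0 //; last by case: z => a b; exact: sqrtr_ge0.
case: z => a b /=; rewrite real_normK ?num_real // sqr_sqrtr ?addr_ge0 ?sqr_ge0 //.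
by rewrite lerDr sqr_ge0.
Qed.

Lemma cv0_cvC u : cv0 u -> cvC u 0.
Proof.
move=> h; split=> eps /RltP he; have [N hN] := h eps he; exists N => n /ssrnat.leP hn;
  rewrite RdistE subr0; apply/RltP; apply: le_lt_trans (hN n hn).
- exact: Re_le_normc.
- exact: Im_le_normc.
Qed.

Lemma cv0_sub u h : (forall n, (n <= h n)%N) -> cv0 u -> cv0 (fun n => u (h n)).
Proof.
move=> hh hu eps he; have [N hN] := hu eps he; exists N => n hn.
by apply: hN; exact: leq_trans (hh n).
Qed.

Lemma cv0_bounded u v (B : R) : (forall n, normc (v n) <= B) -> cv0 u ->
  cv0 (fun n => u n * v n).
Proof.
move=> hB hu eps he.
have B1 : 0 < `|B| + 1 by rewrite ltr_wpDl // normr_ge0.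
have [N hN] := hu (eps / (`|B| + 1)) (divr_gt0 he B1); exists N => n hn.
rewrite normcM; have := hN n hn; rewrite ltr_pdivlMr // => h.
apply: le_lt_trans h; apply: ler_wpM2l.
  by case: (u n) => a b; exact: sqrtr_ge0.
by apply: le_trans (hB n) _; apply: le_trans (ler_norm _) _; rewrite lerDl ler01.
Qed.

Lemma normc_lt (z : K) (r : R) : (`|z| < r%:C%C) = (normc z < r).
Proof. by rewrite normc_def; case: z => a b; rewrite ltcR. Qed.

Lemma normc_bound (z b : K) : `|z| <= b -> normc z <= complex.Re b.
Proof. by rewrite normc_def lecE /=; case: z => x y /= /andP [_]. Qed.

Lemma cv0_pow (l : K) : `|l| < 1 -> cv0 (fun n => l ^+ n).
Proof.
rewrite normc_lt => hl eps /RltP he.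
have l0 : 0 <= normc l by case: l {hl} => a b; exact: sqrtr_ge0.
have [|N hN] := pow_lt_1_zero (normc l) _ eps he.
  by apply/RltP; rewrite RabsE ger0_norm.
exists N => n /ssrnat.leP /hN /RltP; rewrite RabsE RpowE.
have -> : normc (l ^+ n) = normc l ^+ n.
  elim: n => [|n IHn]; first by rewrite !expr0 normc1.
  by rewrite !exprS normcM IHn.
by rewrite ger0_norm // exprn_ge0.
Qed.

Lemma cv0_inv : cv0 (fun n => (n.+1%:R)^-1).
Proof.
move=> eps /RltP he; have [N [h1 h2]] := archimed_cor1 eps he.
exists N => n hn; rewrite normcV.
have -> : normc (n.+1%:R : K) = n.+1%:R.
  by rewrite normcMn normc1.
apply: le_lt_trans (_ : (N%:R)^-1 < _); last by apply/RltP; rewrite -INRE.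
rewrite lef_pV2 ?posrE ?ltr0n //; last exact/ssrnat.ltP.
by rewrite ler_nat; exact: leq_trans hn _.
Qed.

(** * Pointwise limits of channels *)

Section LimitMaps.
Variable d : nat.
Implicit Types (fs gs : nat -> 'M[K]_d -> 'M[K]_d) (f g L M : 'M[K]_d -> 'M[K]_d).

Definition cvF fs g := forall X i j, cvC (fun n => fs n X i j) (g X i j).

Lemma cvF_unique fs f g : cvF fs f -> cvF fs g -> f =1 g.
Proof. by move=> h1 h2 X; apply/matrixP => i j; exact: cvC_unique (h1 X i j) (h2 X i j). Qed.

Lemma cvF_sub fs g h : (forall n, (n <= h n)%N) -> cvF fs g -> cvF (fun n => fs (h n)) g.
Proof. by move=> hh hg X i j; exact: (cvC_sub hh (hg X i j)). Qed.

(** Kraus families need not converge, but linearity, trace preservation and positivity of the Choi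
    matrix are closed conditions. *)
Lemma cvF_channel fs g : (forall n, kraus_channel (fs n)) -> cvF fs g -> kraus_channel g.
Proof.
move=> hf hg; apply: choi_kraus.
- move=> c X Y; apply/matrixP => i j; rewrite !mxE; apply: cvC_unique (hg _ i j) _.
  apply: cvC_ext (cvC_add (cvC_scale c (hg X i j)) (hg Y i j)) => n.
  by rewrite (kraus_channel_linear (hf n)) !mxE.
- move=> X; apply: (cvC_unique (cvC_sum (fun i => hg X i i))).
  by apply: cvC_ext (cvC_const (\tr X)) => n; rewrite -(kraus_channel_trace X (hf n)).
- move=> x; apply: (cvC_ge0 (fun n => kraus_channel_choi (hf n) x)).
  apply: cvC_sum => p; apply: cvC_sum => q; apply: cvC_mul; last exact: cvC_const.
  by apply: cvC_scale; exact: hg.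
Qed.

Lemma kraus_channel_expand f X i j : kraus_channel f ->
  f X i j = \sum_k \sum_l X k l * f (delta_mx k l) i j.
Proof.
move=> hf; rewrite (mx_delta_sum _ (kraus_channel_linear hf)) summxE.
by apply: eq_bigr => k _; rewrite summxE; apply: eq_bigr => l _; rewrite mxE.
Qed.

(** A channel is determined by its finitely many entries on matrix units, all of modulus at most
    1. *)
Lemma channel_compact fs : (forall n, kraus_channel (fs n)) ->
  exists h, (forall n, (n <= h n)%N) /\ exists g, cvF (fun n => fs (h n)) g.
Proof.
move=> hf; pose T := ('I_d * 'I_d * 'I_d * 'I_d)%type.
pose u (t : T) n := fs n (delta_mx t.1.1.1 t.1.1.2) t.1.2 t.2.
have [|h [hh hl]] := @cvC_extract T (enum {: T}) u.
  by move=> t n; exact: kraus_channel_bound.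
have hl' t : exists l, cvC (fun n => u t (h n)) l by apply: hl; rewrite mem_enum.
have [l ll] := choice hl'.
exists h; split=> //; exists (fun X => \matrix_(i, j) \sum_a \sum_b X a b * l (a, b, i, j)).
move=> X i j; rewrite mxE.
apply: (@cvC_ext (fun n => \sum_a \sum_b X a b * u (a, b, i, j) (h n))).
  by move=> n; rewrite [RHS]kraus_channel_expand.
by apply: cvC_sum => a; apply: cvC_sum => b; exact: cvC_scale.
Qed.

Lemma cvF_comp fs gs f g : (forall n, kraus_channel (fs n)) ->
  cvF fs f -> cvF gs g -> cvF (fun n X => fs n (gs n X)) (fun X => f (g X)).
Proof.
move=> hfs hf hg X i j; have fch := cvF_channel hfs hf.
rewrite kraus_channel_expand //.
apply: (@cvC_ext (fun n => \sum_k \sum_l gs n X k l * fs n (delta_mx k l) i j)).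
  by move=> n; rewrite [RHS]kraus_channel_expand.
by apply: cvC_sum => a; apply: cvC_sum => b; apply: cvC_mul.
Qed.

Lemma cvF_const f : cvF (fun=> f) f.
Proof. by move=> X i j; exact: cvC_const. Qed.

Lemma channel_bounded f : kraus_channel f -> forall X i j, exists B : R,
  forall n, normc (iter n f X i j) <= B.
Proof.
move=> hf X i j; exists (complex.Re (\sum_a \sum_b `|X a b|)) => n.
apply: normc_bound; rewrite kraus_channel_expand; last exact: kraus_channel_iter.
apply: le_trans (ler_norm_sum _ _ _) _; apply: ler_sum => a _.
apply: le_trans (ler_norm_sum _ _ _) _; apply: ler_sum => b _.
rewrite normrM ler_piMr //; apply: kraus_channel_bound.
exact: kraus_channel_iter.
Qed.

End LimitMaps.

(** * Eigenvectors, recurrence and the phase subspace *)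

Section Phase.
Variables (d : nat) (f : 'M[K]_d -> 'M[K]_d).
Hypothesis hf : kraus_channel f.
Local Notation it := (fun n => iter n f).

Let it_channel n : kraus_channel (iter n f).
Proof. exact: kraus_channel_iter. Qed.

Lemma channelB g X Y : kraus_channel g -> g (X - Y) = g X - g Y :> 'M[K]_d.
Proof.
move=> hg; have hl := kraus_channel_linear hg.
by rewrite addrC -scaleN1r hl scaleN1r addrC.
Qed.

Lemma channelD g X Y : kraus_channel g -> g (X + Y) = g X + g Y :> 'M[K]_d.
Proof. by move=> hg; rewrite -[X]scale1r (kraus_channel_linear hg) !scale1r. Qed.

Lemma channelZ g c X : kraus_channel g -> g (c *: X) = c *: g X :> 'M[K]_d.
Proof.
move=> hg; have hl := kraus_channel_linear hg.
have g0 : g 0 = 0 by rewrite -[0 in LHS](subrr 0) channelB // subrr.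
by rewrite -[c *: X]addr0 hl g0 addr0.
Qed.

Lemma channel_sum g (I : finType) (P : pred I) (X : I -> 'M[K]_d) : kraus_channel g ->
  g (\sum_(i | P i) X i) = \sum_(i | P i) g (X i).
Proof.
move=> hg; apply: (big_morph g) => [x y|].
  by rewrite -[x]scale1r (kraus_channel_linear hg) !scale1r.
by rewrite -[0 in LHS](subrr 0) channelB // subrr.
Qed.

Lemma iter_eigen l X n : f X = l *: X -> iter n f X = l ^+ n *: X.
Proof.
move=> h; elim: n => [|n IHn] /=; first by rewrite expr0 scale1r.
by rewrite IHn channelZ // h scalerA -exprSr.
Qed.

(* The exponents [h' (h n + n) - h n] are at least [n], and adding [h n] to them gives a
   subsequence of [h']. *)
Lemma limit_quotient h h' L M :
  (forall n, (n <= h n)%N) -> (forall n, (n <= h' n)%N) ->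
  cvF (fun n => it (h n)) L -> cvF (fun n => it (h' n)) M ->
  exists k S, [/\ forall n, (n <= k n)%N, cvF (fun n => it (k n)) S, kraus_channel S
    & forall X, S (L X) = M X].
Proof.
move=> hh hh' hL hM.
have [e [he [S hS]]] := channel_compact (fun n => it_channel (h' (h n + n) - h n)).
have lem n : (h n + n <= h' (h n + n))%N by exact: hh'.
exists (fun n => (h' (h (e n) + e n) - h (e n))%N), S; split=> //.
- move=> n; rewrite leq_subRL; last by apply: leq_trans (lem _); exact: leq_addr.
  by apply: leq_trans (lem _); rewrite leq_add2l.
- by apply: cvF_channel hS => n.
have h1 := cvF_comp (fun n => it_channel _) hS (cvF_sub he hL).
have h2 : cvF (fun n => it (h' (h (e n) + e n)%N)) M.
  apply: (@cvF_sub _ (fun n => it (h' n)) M (fun n => (h (e n) + e n)%N)) hM => n.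
  by apply: leq_trans (he n) _; exact: leq_addl.
apply: cvF_unique h2 => X i j; apply: cvC_ext (h1 X i j) => n.
by rewrite -iterD subnK //; apply: leq_trans (lem _); exact: leq_addr.
Qed.

(* Along a convergent subsequence the powers of the eigenvalue converge to a unimodular
   number, so [S L = L] forces [S X = X]. *)
Lemma limit_phase h L S l X : cvF (fun n => it (h n)) L -> kraus_channel S ->
  (forall Y, S (L Y) = L Y) -> f X = l *: X -> `|l| = 1 -> S X = X.
Proof.
move=> hL hS SL fX l1.
have [->|X0] := eqVneq X 0.
  by rewrite -[0 in LHS](subrr 0) channelB // subrr.
have [i [j Xij]] : exists i j, X i j != 0.
  apply: contrapT => hn; move/eqP: X0; apply; apply/matrixP => i j; rewrite mxE.
  by apply: contrapT => hz; apply: hn; exists i, j; apply/eqP.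
have lX n : iter (h n) f X = l ^+ h n *: X by exact: iter_eigen.
pose mu := L X i j / X i j.
have hmu : cvC (fun n => l ^+ h n) mu.
  apply: (@cvC_ext (fun n => iter (h n) f X i j / X i j)).
    by move=> n; rewrite lX mxE mulfK.
  by apply: cvC_mul; [exact: hL|exact: cvC_const].
have LX : L X = mu *: X.
  apply/matrixP => a b; rewrite mxE; apply: cvC_unique (hL X a b) _.
  apply: (@cvC_ext (fun n => l ^+ h n * X a b)); first by move=> n; rewrite lX mxE.
  by apply: cvC_mul; [exact: hmu|exact: cvC_const].
have mu0 : mu != 0.
  apply/eqP => m0; have := cvC_mul hmu (cvC_conj hmu); rewrite m0 mul0r => h0.
  suff : cvC (fun n => l ^+ h n * (l ^+ h n)^*) 1.
    by move=> /(cvC_unique h0) /eqP; rewrite eq_sym oner_eq0.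
  apply: cvC_ext (cvC_const 1) => n.
  by rewrite -normCK normrX l1 !expr1n.
have := SL X; rewrite LX channelZ // => /(congr1 (fun Z => mu^-1 *: Z)).
by rewrite !scalerA mulVf // !scale1r.
Qed.

(** Recurrence excludes decay: [Y] is the limit of [l ^+ h n *: Y], which is zero. *)
Lemma eigen_lt1 l Y h S : (forall n, (n <= h n)%N) -> cvF (fun n => it (h n)) S ->
  S Y = Y -> f Y = l *: Y -> `|l| < 1 -> Y = 0.
Proof.
move=> hh hS SY fY l1; apply/matrixP => i j; rewrite mxE -SY.
apply: cvC_unique (hS Y i j) _; apply: cv0_cvC.
apply: (@cv0_sub (fun n => iter n f Y i j) h hh).
rewrite (_ : (fun n => _) = (fun n => l ^+ n * Y i j)).
  exact: (@cv0_bounded _ _ (normc (Y i j))) (cv0_pow l1).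
by apply/funext => n; rewrite (iter_eigen n fY) mxE.
Qed.

Lemma eigen_gt1 l Y : f Y = l *: Y -> 1 < `|l| -> Y = 0.
Proof.
move=> fY l1; apply/matrixP => i j; rewrite mxE.
have [B hB] := channel_bounded hf Y i j.
have l0 : l != 0 by rewrite -normr_gt0; exact: lt_trans ltr01 l1.
have lV : `|l^-1| < 1 by rewrite normfV invf_lt1 // (lt_trans ltr01).
apply: cvC_unique (cvC_const _) _; apply: cv0_cvC.
rewrite (_ : (fun n => _) = (fun n => l^-1 ^+ n * iter n f Y i j)).
  exact: cv0_bounded hB (cv0_pow lV).
apply/funext => n; rewrite (iter_eigen n fY) mxE mulrA -exprMn mulVf //.
by rewrite expr1n mul1r.
Qed.

(* A Jordan block for a unimodular eigenvalue would make the powers grow linearly. *)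
Lemma no_jordan_block l Y Z : f Y = l *: Y + Z -> f Z = l *: Z -> `|l| = 1 -> Z = 0.
Proof.
move=> fY fZ l1; apply/matrixP => i j; rewrite mxE.
have l0 : l != 0 by rewrite -normr_gt0 l1 ltr01.
have itY n : iter n.+1 f Y = l ^+ n.+1 *: Y + (n.+1%:R * l ^+ n) *: Z.
  elim: n => [|n IHn]; first by rewrite /= fY expr1 expr0 mulr1 scale1r.
  rewrite iterS IHn (channelD _ _ hf) !(channelZ _ _ hf) fY fZ scalerDr !scalerA -addrA -scalerDl -exprSr.
  congr (_ + _ *: _); rewrite -[n.+2%:R]natr1 exprSr; ring.
have [B hB] := channel_bounded hf Y i j.
apply: cvC_unique (cvC_const _) _; apply: cv0_cvC.
(* Solving [itY] for [Z] gives [v n] divided by [n + 1], and [v n] is bounded because [l] is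
   unimodular and the powers of [f] are bounded. *)
pose v n := l ^- n * (iter n.+1 f Y i j - l ^+ n.+1 * Y i j).
rewrite (_ : (fun n => _) = (fun n => n.+1%:R^-1 * v n)).
  apply: (@cv0_bounded _ _ (B + normc (Y i j))) cv0_inv => n.
  have nl m : normc (l ^+ m) = 1.
    elim: m => [|m IHm]; first by rewrite expr0 normc1.
    by rewrite exprS normcM IHm mulr1; move: l1; rewrite normc_def; case: (l) => a b [].
  rewrite normcM normcV nl invr1 mul1r.
  apply: le_trans (le_normcD _ _) _; apply: lerD => //.
  by rewrite normcN normcM nl mul1r.
apply/funext => n; rewrite /v itY !mxE addrAC subrr add0r.
have ln : l ^+ n != 0 by rewrite expf_neq0.
have n0 : n.+1%:R != 0 :> K by rewrite pnatr_eq0.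
by field; rewrite ln nat1r.
Qed.

(** Coefficients are absorbed into the [Z i], which unlike phase points may vanish, and angles are
    replaced by unimodular numbers. *)
Definition phase_span X := exists n (Z : 'I_n -> 'M[K]_d) (l : 'I_n -> K),
  (forall i, f (Z i) = l i *: Z i /\ `|l i| = 1) /\ X = \sum_i Z i.

Lemma phase_span1 l X : f X = l *: X -> `|l| = 1 -> phase_span X.
Proof.
move=> h1 h2; exists 1%N, (fun=> X), (fun=> l).
by split=> //; rewrite big_ord1.
Qed.

Lemma phase_span0 : phase_span 0.
Proof. by exists 0%N, (fun=> 0), (fun=> 0); rewrite big_ord0; split=> // -[]. Qed.

Lemma phase_spanD X Y : phase_span X -> phase_span Y -> phase_span (X + Y).
Proof.
move=> [n [Z [l [h ->]]]] [n' [Z' [l' [h' ->]]]].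
exists (n + n')%N, (fun i => match split i with inl a => Z a | inr b => Z' b end),
  (fun i => match split i with inl a => l a | inr b => l' b end).
split=> [i|]; first by case: (split i).
rewrite big_split_ord /=; congr (_ + _); apply: eq_bigr => i _.
  by rewrite (unsplitK (inl i)).
by rewrite (unsplitK (inr i)).
Qed.

Lemma phase_span_sum (I : finType) (P : pred I) (X : I -> 'M[K]_d) :
  (forall i, P i -> phase_span (X i)) -> phase_span (\sum_(i | P i) X i).
Proof. by move=> h; elim/big_rec: _ => [|i x Pi]; [exact: phase_span0|apply: phase_spanD; exact: h]. Qed.

Lemma phase_spanZ c X : phase_span X -> phase_span (c *: X).
Proof.
move=> [n [Z [l [h ->]]]]; exists n, (fun i => c *: Z i), l; split=> [i|].
  by have [h1 h2] := h i; rewrite channelZ // h1 scalerA mulrC -scalerA.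
by rewrite scaler_sumr.
Qed.

(** The product of the [f - l] over [s]. For the roots of the characteristic polynomial it is zero
    by Cayley-Hamilton, which stands in for a Jordan form. *)
Fixpoint apply_factors s X := if s is l :: s' then apply_factors s' (f X - l *: X) else X.

(** By induction [f Y - l *: Y] is a sum of phase vectors [Z i] with eigenvalues [m i]. Those with
    [m i != l] are images under [f - l] of multiples of themselves and are subtracted from [Y]. The
    remaining sum [W] would form a Jordan block at [l], hence vanishes, and what is left of [Y] is
    an eigenvector for [l]: recurrence and boundedness leave only [|l| = 1] or zero. *)
Lemma recurrent_phase_span h S s Y : (forall n, (n <= h n)%N) ->
  cvF (fun n => it (h n)) S -> (forall l X, f X = l *: X -> `|l| = 1 -> S X = X) ->
  S Y = Y -> apply_factors s Y = 0 -> phase_span Y.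
Proof.
move=> hh hS Sphase.
have Sch : kraus_channel S by apply: cvF_channel hS => n.
have Sf X : S (f X) = f (S X).
  apply/matrixP => i j; apply: cvC_unique (hS _ i j) _.
  apply: cvC_ext (cvF_comp (fun n => hf) (cvF_const f) hS X i j) => n /=.
  by rewrite -iterS -iterSr.
elim: s Y => [|l s IHs] Y SY /=; first by move=> ->; exact: phase_span0.
move=> /IHs [|n [Z [m [hZ eZ]]]]; first by rewrite channelB // channelZ // Sf SY.
pose Y' := Y - \sum_(i | m i != l) (m i - l)^-1 *: Z i.
have SZ : forall i, S (Z i) = Z i by move=> i; have [h1 h2] := hZ i; exact: Sphase h1 h2.
have SY' : S Y' = Y'.
  rewrite channelB // SY channel_sum //; congr (_ - _); apply: eq_bigr => i _.
  by rewrite channelZ // SZ.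
pose W := \sum_(i | m i == l) Z i.
have fY' : f Y' = l *: Y' + W.
  have e1 : f Y = l *: Y + W + \sum_(i | m i != l) Z i.
    rewrite -addrA -[f Y](subrK (l *: Y)) eZ addrC; congr (_ + _).
    by rewrite (bigID (fun i => m i == l)).
  rewrite /Y' (channelB _ _ hf) e1 (channel_sum _ _ hf) scalerBr scaler_sumr.
  have -> : \sum_(i | m i != l) f ((m i - l)^-1 *: Z i) =
      \sum_(i | m i != l) l *: ((m i - l)^-1 *: Z i) + \sum_(i | m i != l) Z i.
    rewrite -big_split; apply: eq_bigr => i hi /=; have [h1 _] := hZ i.
    rewrite channelZ // h1 !scalerA -[X in _ = _ + X]scale1r -scalerDl; congr (_ *: _).
    by rewrite -[X in _ = _ + X](mulVf (_ : m i - l != 0)) ?subr_eq0 //; ring.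
  by rewrite opprD addrACA subrr addr0 addrAC.
have W0 : W = 0.
  have [[i hi]|no] := pselect (exists i, m i == l); last first.
    by rewrite /W big1 // => i hi; case: no; exists i.
  have l1 : `|l| = 1 by rewrite -(eqP hi); have [] := hZ i.
  apply: (no_jordan_block fY') => //.
  rewrite channel_sum // scaler_sumr; apply: eq_bigr => k /eqP <-.
  by have [] := hZ k.
rewrite W0 addr0 in fY'.
rewrite -[Y](subrK (\sum_(i | m i != l) (m i - l)^-1 *: Z i)) -/Y'.
apply: phase_spanD; last first.
  apply: phase_span_sum => i _; apply: phase_spanZ.
  by have [h1 h2] := hZ i; exact: phase_span1 h1 h2.
have [lt|gt|e] := real_ltgtP (normr_real l) (real1 K); last exact: phase_span1 fY' e.
  by rewrite (eigen_lt1 hh hS SY' fY' lt); exact: phase_span0.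
by rewrite (eigen_gt1 fY' gt); exact: phase_span0.
Qed.

End Phase.

Lemma apply_factors_char d (f : 'M[K]_d -> 'M[K]_d) : linear f ->
  exists s, forall Y, apply_factors f s Y = 0.
Proof.
move=> /linear_matrix [M hM].
have mxvec_factors s Y : mxvec (apply_factors f s Y) =
    mxvec Y *m \big[mulmx/1%:M]_(l <- s) (M - l%:M).
  elim: s Y => [|l s IHs] Y /=; first by rewrite big_nil mulmx1.
  by rewrite IHs big_cons linearB linearZ /= hM mulmxA mulmxBr mul_mx_scalar.
suff [s hs] : exists s : seq K, \big[mulmx/1%:M]_(l <- s) (M - l%:M) = 0.
  by exists s => Y; apply: (can_inj mxvecK); rewrite mxvec_factors hs mulmx0 linear0.
move: M {hM mxvec_factors}; case: (d * d)%N => [|n] M.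
  by exists nil; apply/matrixP => -[].
have [s hs] := closed_field_poly_normal (char_poly M).
exists s; have := Cayley_Hamilton M.
rewrite hs (monicP (char_poly_monic M)) scale1r rmorph_prod /= => h.
rewrite -[RHS]h; elim: s {hs h} => [|l s IHs]; first by rewrite !big_nil.
by rewrite !big_cons IHs rmorphB /= horner_mx_X horner_mx_C.
Qed.

(** The first quotient gives [P] with [P L = L], hence [P] fixes phase vectors. The second gives [S]
    with [S P = P], which makes every [P X] recurrent and so a sum of phase vectors. Idempotence of
    [P] is a consequence. *)
Theorem limit_projection d (f : 'M[K]_d -> 'M[K]_d) : kraus_channel f ->
  exists k P, [/\ forall n, (n <= k n)%N, cvF (fun n => iter (k n) f) P, kraus_channel P,
    forall X, phase_span f (P X) & forall X, phase_span f X -> P X = X].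
Proof.
move=> hf; have [h [hh [L hL]]] := channel_compact (fun n => kraus_channel_iter n hf).
have [k [P [hk hP Pch PL]]] := limit_quotient hf hh hh hL hL.
have [k' [S [hk' hS Sch SP]]] := limit_quotient hf hk hk hP hP.
have Pphase l X : f X = l *: X -> `|l| = 1 -> P X = X.
  exact: (limit_phase hf hL Pch PL).
have Sphase l X : f X = l *: X -> `|l| = 1 -> S X = X.
  exact: (limit_phase hf hP Sch SP).
have [s hs] := apply_factors_char (kraus_channel_linear hf).
exists k, P; split=> // X.
  exact: (recurrent_phase_span hf hk' hS Sphase (SP X) (hs _)).
move=> [n [Z [l [hZ ->]]]]; rewrite channel_sum //; apply: eq_bigr => i _.
by have [h1 h2] := hZ i; exact: Pphase h1 h2.
Qed.

(** * Superoperators and bipartite matrices *)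

Definition sop d (T : Superop) (X : 'M[K]_d) : 'M[K]_d :=
  \matrix_(i < d, j < d) \sum_(k < d) \sum_(l < d) toc (T i j k l) * X k l.

Lemma mx_sapply d T X : mx d (sapply d T X) = sop T (mx d X).
Proof.
apply/matrixP => i j; rewrite !mxE toc_sum; apply: eq_bigr => k _.
by rewrite toc_sum; apply: eq_bigr => l _; rewrite tocM mxE.
Qed.

Lemma sop_linear d T : linear (@sop d T).
Proof.
move=> c X Y; apply/matrixP => i j; rewrite !mxE mulr_sumr -big_split.
apply: eq_bigr => k _ /=; rewrite mulr_sumr -big_split; apply: eq_bigr => l _ /=.
by rewrite !mxE; ring.
Qed.

Lemma sop_delta d T (i j k l : 'I_d) : sop T (delta_mx k l) i j = toc (T i j k l).
Proof.
rewrite mxE (bigD1 k) //= (bigD1 l) //= mxE !eqxx mulr1 !big1 ?addr0 //.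
  by move=> k' hk; rewrite big1 // => l' _; rewrite mxE (negPf hk) mulr0.
by move=> l' hl; rewrite mxE (negPf hl) andbF mulr0.
Qed.

Lemma eqb_eqn m n : Nat.eqb m n = (m == n).
Proof. by apply/idP/eqP => /Nat.eqb_eq. Qed.

Lemma sop_sid d (X : 'M_d) : sop sid X = X.
Proof.
rewrite [RHS](mx_delta_sum (f := fun X => X)) ?(mx_delta_sum X (@sop_linear d sid)) //.
apply: eq_bigr => k _; apply: eq_bigr => l _; congr (_ *: _).
apply/matrixP => i j; rewrite sop_delta mxE /sid !eqb_eqn.
by rewrite -[i == k]/(nat_of_ord i == k) -[j == l]/(nat_of_ord j == l); case: ifP.
Qed.

Lemma sop_scomp d S T (X : 'M_d) : sop (scomp d S T) X = sop S (sop T X).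
Proof.
rewrite (mx_delta_sum X (@sop_linear d _)).
have lin : linear (fun X : 'M_d => sop S (sop T X)).
  by move=> c Y Z; rewrite !sop_linear.
rewrite [RHS](mx_delta_sum X lin).
apply: eq_bigr => k _; apply: eq_bigr => l _; congr (_ *: _).
apply/matrixP => i j; rewrite sop_delta mxE toc_sum; apply: eq_bigr => a _.
rewrite toc_sum; apply: eq_bigr => b _.
by rewrite tocM sop_delta.
Qed.

Lemma sop_spow d T n (X : 'M_d) : sop (spow d T n) X = iter n (sop T) X.
Proof.
by elim: n X => [|n IHn] X; [exact: sop_sid|rewrite sop_scomp IHn].
Qed.

(* The [d x d] matrix obtained from a bipartite [rho] by fixing the indices [b], [b'] of the
   second factor, for the basis order [(i, b) |-> i * k + b]. *)
Definition slice d k (rho : Mat) b b' : 'M[K]_d :=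
  \matrix_(i < d, j < d) toc (rho (i * k + b)%N (j * k + b')%N).

Lemma slice_ampl d k T rho b b' : (b < k)%N -> (b' < k)%N ->
  slice d k (ampl d k T rho) b b' = sop T (slice d k rho b b').
Proof.
move=> hb hb'; apply/matrixP => i j; rewrite !mxE /ampl toc_sum.
have [-> ->] := block_index i hb; have [-> ->] := block_index j hb'.
apply: eq_bigr => a _; rewrite toc_sum; apply: eq_bigr => c _.
by rewrite tocM mxE.
Qed.

Lemma slice_kron d k A B b b' : (b < k)%N -> (b' < k)%N ->
  slice d k (kron k A B) b b' = toc (B b b') *: mx d A.
Proof.
move=> hb hb'; apply/matrixP => i j; rewrite !mxE /kron tocM.
have [-> ->] := block_index i hb; have [-> ->] := block_index j hb'.
by rewrite mulrC.
Qed.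

Lemma slice_lt d k (i : 'I_d) b : (b < k)%N -> (i * k + b < d * k)%N.
Proof.
move=> hb; apply: (@leq_trans (i.+1 * k)); last by rewrite leq_mul2r ltn_ord orbT.
by rewrite mulSnr ltn_add2l.
Qed.

Lemma slice_eq d k A B : meq (d * k) A B <->
  forall b b', (b < k)%N -> (b' < k)%N -> slice d k A b b' = slice d k B b b'.
Proof.
split=> [h b b' hb hb'|h r s /ssrnat.ltP hr /ssrnat.ltP hs].
  by apply/matrixP => i j; rewrite !mxE h //; apply/ssrnat.ltP; exact: slice_lt.
have k0 : (0 < k)%N by move: hr; case: (k) => //; rewrite muln0.
have hr1 : (r %/ k < d)%N by rewrite ltn_divLR.
have hs1 : (s %/ k < d)%N by rewrite ltn_divLR.
have := h _ _ (ltn_pmod r k0) (ltn_pmod s k0).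
move=> /matrixP /(_ (Ordinal hr1) (Ordinal hs1)); rewrite !mxE /= -!divn_eq.
exact: (can_inj tocK).
Qed.

Lemma slice_trace d k rho : \tr (mx (d * k) rho) = \sum_(b < k) \tr (slice d k rho b b).
Proof.
transitivity (\sum_(r < d * k) toc (rho r r)).
  by apply: eq_bigr => r _; rewrite mxE.
rewrite (sum_mul_ord d k (fun r => toc (rho r r))) exchange_big.
by apply: eq_bigr => b _; apply: eq_bigr => i _; rewrite mxE.
Qed.

Lemma slice_psd d k rho : psd (mx (d * k) rho) <-> forall x : 'M[K]_(d, k),
  0 <= \sum_(i < d) \sum_(b < k) \sum_(j < d) \sum_(b' < k) (x i b)^* * (slice d k rho b b' i j * x j b').
Proof.
have key (y : 'cV[K]_(d * k)) (x : 'M[K]_(d, k)) (z : nat -> K) :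
   (forall r : 'I_(d * k), y r 0 = z r) ->
   (forall (i : 'I_d) (b : 'I_k), x i b = z (i * k + b)%N) ->
   (y^t* *m mx (d * k) rho *m y) 0 0 =
     \sum_(i < d) \sum_(b < k) \sum_(j < d) \sum_(b' < k) (x i b)^* * (slice d k rho b b' i j * x j b').
  move=> hy hx; rewrite -mulmxA mxE.
  transitivity (\sum_(r < d * k) \sum_(s < d * k) (z r)^* * (toc (rho r s) * z s)).
    apply: eq_bigr => r _; rewrite !mxE hy mulr_sumr.
    by apply: eq_bigr => s _; rewrite mxE hy.
  rewrite (sum_mul_ord d k (fun r => \sum_(s < d * k) (z r)^* * (toc (rho r s) * z s))).
  apply: eq_bigr => i _; apply: eq_bigr => b _.
  rewrite (sum_mul_ord d k (fun s => (z (i * k + b)%N)^* *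
     (toc (rho (i * k + b)%N s) * z s))).
  apply: eq_bigr => j _; apply: eq_bigr => b' _.
  by rewrite !hx mxE.
split=> h x.
  pose z r := if insub (r %/ k)%N is Some i then
    if insub (r %% k)%N is Some b then x i b else 0 else 0.
  rewrite -(key (\col_r z r) x z) ?h //; first by move=> r; rewrite mxE.
  move=> i b; rewrite /z.
  have e1 : ((i * k + b) %/ k)%N = i.
    by rewrite divnMDl ?divn_small ?addn0 //; apply: leq_ltn_trans (leq0n b) _.
  have e2 : ((i * k + b) %% k)%N = b by rewrite modnMDl modn_small.
  by rewrite e1 e2 !valK.
pose z r := if insub r is Some r' then x r' 0 else 0.
rewrite (key x (\matrix_(i, b) z (i * k + b)%N) z) ?h //.
  by move=> r; rewrite /z valK.
by move=> i b; rewrite mxE.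
Qed.

(** Here [omega] is the unnormalized maximally entangled projector, whose slices are the matrix
    units; applying the channel to its first factor gives the Choi matrix. *)
Lemma quantum_channel_kraus d T : quantum_channel d T -> kraus_channel (@sop d T).
Proof.
move=> [cp tp]; apply: choi_kraus; first exact: sop_linear.
  move=> X; rewrite -{1}(matK X) -mx_sapply -mx_trace tp mx_trace.
  by rewrite matK.
pose omega : Mat := fun r s => Cmul (idm (Nat.div r d) (Nat.modulo r d))
                                    (idm (Nat.div s d) (Nat.modulo s d)).
have blo (b b' : 'I_d) : slice d d omega b b' = delta_mx b b'.
  apply/matrixP => i j; rewrite !mxE /omega.
  have [-> ->] := block_index i (ltn_ord b); have [-> ->] := block_index j (ltn_ord b').
  rewrite tocM /idm !eqb_eqn -[i == b]/(nat_of_ord i == b) -[j == b']/(nat_of_ord j == b').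
  by do 2!case: eqP => _; rewrite ?mulr1 ?mulr0.
have pso : PSD (d * d) omega.
  apply/PSD_mx/slice_psd => x.
  pose t := \sum_i x i i.
  suff -> : \sum_(i < d) \sum_(b < d) \sum_(j < d) \sum_(b' < d)
     (x i b)^* * (slice d d omega b b' i j * x j b') = t * t^*.
    exact: mul_conjC_ge0.
  rewrite mulrC /t rmorph_sum mulr_suml; apply: eq_bigr => i _.
  rewrite (bigD1 i) //= [X in _ + X]big1 ?addr0 => [|b hb]; last first.
    rewrite big1 // => j _; rewrite big1 // => b' _.
    by rewrite blo mxE [i == b]eq_sym (negPf hb) mul0r mulr0.
  rewrite mulr_sumr; apply: eq_bigr => j _.
  rewrite (bigD1 j) //= [X in _ + X]big1 ?addr0 => [|b hb].
    by rewrite blo mxE !eqxx mul1r.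
  by rewrite blo mxE [j == b]eq_sym (negPf hb) andbF mul0r mulr0.
have /PSD_mx/slice_psd h := cp d omega pso.
move=> x; have := h x; congr (0 <= _).
rewrite -(pair_bigA _ (fun i b => \sum_(q : 'I_d * 'I_d) (x i b)^* *
  sop T (delta_mx b q.2) i q.1 * x q.1 q.2)) /=.
apply: eq_bigr => i _; apply: eq_bigr => b _.
rewrite -(pair_bigA _ (fun j b' => (x i b)^* * sop T (delta_mx b b') i j * x j b')) /=.
apply: eq_bigr => j _; apply: eq_bigr => b' _.
by rewrite slice_ampl // blo mulrA.
Qed.

Lemma Cexpi_abs t : `|toc (Cexpi t)| = 1.
Proof.
rewrite toc_abs /Cabs /=.
have := sin2_cos2 t; rewrite /Rsqr => h.
by rewrite Rplus_comm h sqrt_1.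
Qed.

Lemma Cexpi_surj (l : K) : `|l| = 1 -> exists t, toc (Cexpi t) = l.
Proof.
case: l => x y; rewrite normc_def /= => -[] h.
have {}h : x ^+ 2 + y ^+ 2 = 1.
  by rewrite -[LHS]sqr_sqrtr ?addr_ge0 ?sqr_ge0 // h expr1n.
have hx : Rle (- (1)) x /\ Rle x 1.
  have : `|x| <= 1.
    rewrite -(ler_sqr (x := `|_|)) ?nnegrE ?normr_ge0 ?ler01 //.
    by rewrite real_normK ?num_real // expr1n -h lerDl sqr_ge0.
  by rewrite ler_norml => /andP [h1 h2]; split; apply/RleP.
have y2 : y ^+ 2 = 1 - x ^+ 2 by rewrite -h addrC addKr.
have s : sqrt (1 - Rsqr x) = `|y|.
  by rewrite RsqrtE -sqrtr_sqr y2.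
have [y0|y0] := lerP 0 y.
  exists (acos x); rewrite /Cexpi /toc /= cos_acos // sin_acos // s ger0_norm //.
exists (- acos x)%R.
by rewrite /Cexpi /toc /= cos_neg sin_neg cos_acos // sin_acos // s ltr0_norm // RoppE opprK.
Qed.

Lemma phase_point_sop d T Z : phase_point d T Z <->
  mx d Z != 0 /\ exists l, sop T (mx d Z) = l *: mx d Z /\ `|l| = 1.
Proof.
have scal l : mx d (fun i j => Cmul l (Z i j)) = toc l *: mx d Z.
  by apply/matrixP => i j; rewrite !mxE.
split=> [[/mx_zero h [t /meq_mx]]|[/mx_zero h [l [e l1]]]].
  rewrite mx_sapply scal => e; split=> //; exists (toc (Cexpi t)).
  by split=> //; exact: Cexpi_abs.
split=> //; have [t ht] := Cexpi_surj l1; exists t; apply/meq_mx.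
by rewrite mx_sapply scal ht.
Qed.

Lemma phase_subspace_sop d T X : kraus_channel (@sop d T) ->
  in_phase_subspace d T X <-> phase_span (@sop d T) (mx d X).
Proof.
move=> hT; have comb m c (Z : nat -> Mat) :
    mx d (fun i j => Csum m (fun t => Cmul (c t) (Z t i j))) =
    \sum_(t < m) toc (c t) *: mx d (Z t).
  apply/matrixP => i j; rewrite summxE mxE toc_sum; apply: eq_bigr => t _.
  by rewrite !mxE.
split=> [[m [c [Z [hZ /meq_mx ->]]]]|[n [Z [l [hZ eX]]]]].
  rewrite comb; apply: phase_span_sum => t _; apply: phase_spanZ => //.
  have [|_ [l [h1 h2]]] := (phase_point_sop d T (Z t)).1 (hZ t _).
    by apply/ssrnat.ltP.
  exact: phase_span1 h1 h2.
have [[i0 hi0]|no] := pselect (exists i, Z i != 0); last first.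
  exists O, (fun=> Defs.C0), (fun=> idm); split; first by move=> t /ssrnat.ltP.
  apply/meq_mx; rewrite comb big_ord0 eX big1 // => i _.
  by apply: contrapT => /eqP h; apply: no; exists i.
(* Phase points must be nonzero: vanishing summands are replaced by the nonzero [Z i0] with
   coefficient zero. *)
pose Z' t := if insub t is Some i then if Z i != 0 then Z i else Z i0 else Z i0.
pose c t := if insub t is Some i then if Z i != 0 then Defs.C1 else Defs.C0 else Defs.C0.
exists n, c, (fun t => mat (Z' t)); split.
  move=> t _; apply/phase_point_sop; rewrite matK /Z'.
  have [h1 h2] := hZ i0.
  case: insubP => [i _ _|_]; last by split=> //; exists (l i0).
  case: ifP => hi; last by split=> //; exists (l i0).
  by have [h3 h4] := hZ i; split=> //; exists (l i).
apply/meq_mx; rewrite comb eX; apply: eq_bigr => t _.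
rewrite matK /Z' /c valK; case: ifP => [_|/eqP ->]; first by rewrite toc1 scale1r.
by rewrite toc0 scale0r.
Qed.

(** * Structure decompositions and orthonormal frames *)

Lemma blockdiag_out bs Xs r s : (block_total bs <= r)%N || (block_total bs <= s)%N ->
  blockdiag bs Xs r s = Defs.C0.
Proof.
elim: bs Xs r s => [//|[[d1 d2] rho] bs IHbs] Xs r s.
change (block_total ((d1, d2, rho) :: bs)) with (d1 * d2 + block_total bs)%N => h /=.
rewrite !ltb_ltn; case: (ltnP r) => hr; case: (ltnP s) => hs //.
  by case/orP: h; rewrite leqNgt ltn_addr.
by apply: IHbs; rewrite !minusE !leq_subRL.
Qed.

Definition ucol d (U : Mat) r : 'cV[K]_d := \col_i toc (U i r).

Lemma block_sum_mx d U bs Xs : (block_total bs <= d)%N ->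
  mx d (mmul d (mmul d U (blockdiag bs Xs)) (adj U)) = block_sum bs Xs (@ucol d U).
Proof.
move=> hd; set t := block_total bs.
pose G r s := toc (blockdiag bs Xs r s) *: (@ucol d U r *m (@ucol d U s)^t*).
transitivity (\sum_(r < d) \sum_(s < d) G r s).
  rewrite !mx_mul mx_adj; apply/matrixP => i j; rewrite summxE mxE.
  under eq_bigr do rewrite mxE mulr_suml.
  rewrite exchange_big; apply: eq_bigr => r _; rewrite summxE; apply: eq_bigr => s _.
  by rewrite !mxE big_ord1 !mxE; ring.
have trunc (H : nat -> 'M[K]_d) : (forall r, (t <= r)%N -> H r = 0) ->
    \sum_(r < d) H r = \sum_(r < t) H r.
  move=> h0; rewrite -!(big_mkord xpredT) (big_cat_nat _ (n := t)) //=.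
  rewrite [X in _ + X]big_nat_cond [X in _ + X]big1 ?addr0 // => r.
  by rewrite andbT => /andP [hr _]; exact: h0.
rewrite (trunc (fun r => \sum_(s < d) G r s)) => [|r hr]; last first.
  by rewrite big1 // => s _; rewrite /G blockdiag_out ?hr ?scale0r.
apply: eq_bigr => r _; apply: (trunc (G r)) => s hs.
by rewrite /G blockdiag_out ?hs ?orbT // scale0r.
Qed.

Lemma unitary_frame d U t : unitary d U -> (t <= d)%N -> frame 1%:M t (@ucol d U).
Proof.
move=> /meq_mx; rewrite mx_mul mx_adj mx_id => h ht i j hi hj.
have := congr1 (fun M : 'M[K]_d => M (Ordinal (leq_trans hi ht)) (Ordinal (leq_trans hj ht))) h.
rewrite !mxE -val_eqE /= => e; rewrite [LHS]mx11_scalar scalemx1; congr (_%:M).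
by rewrite -e mxE; apply: eq_bigr => k _; rewrite !mxE.
Qed.

Lemma phase_structureP d T U bs : kraus_channel (@sop d T) ->
  phase_structure d T U bs <-> [/\ unitary d U, (block_total bs <= d)%N,
    forall d1 d2 rho, In (d1, d2, rho) bs -> is_state d2 rho
  & forall X : 'M_d, phase_span (@sop d T) X <->
      exists Xs, X = block_sum bs Xs (@ucol d U)].
Proof.
move=> hT; split=> [[h1 [/ssrnat.leP h2 [h3 h4]]]|[h1 h2 h3 h4]].
  split=> // X; have := h4 (mat X); rewrite phase_subspace_sop // matK => ->.
  by split=> -[Xs hX]; exists Xs; [move/meq_mx: hX; rewrite matK block_sum_mx
     |apply/meq_mx; rewrite matK block_sum_mx].
split=> //; split; first exact/ssrnat.leP.
split=> // X; rewrite phase_subspace_sop // h4.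
by split=> -[Xs hX]; exists Xs; [apply/meq_mx; rewrite block_sum_mx
   |move/meq_mx: hX; rewrite block_sum_mx].
Qed.

(** An orthonormal basis of the orthogonal complement is appended. The resulting resolution of the
    identity forces [d <= t + n], so that all [d] columns of [U] are filled. *)
Lemma frame_extend d t (u : nat -> 'cV[K]_d) : frame 1%:M t u ->
  exists U, [/\ unitary d U & forall r, (r < t)%N -> @ucol d U r = u r].
Proof.
move=> uf; pose S (x : 'cV[K]_d) := forall r, (r < t)%N -> (u r)^t* *m x = 0.
have hS : subspace S.
  split; first by move=> r _; rewrite mulmx0.
    by move=> x y hx hy r hr; rewrite mulmxDr hx // hy // addr0.
  by move=> c x hx r hr; rewrite -scalemxAr hx // scaler0.
have [n [w [wS wf wx]]] := orthonormal_basis hS.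
pose v r := if (r < t)%N then u r else w (r - t)%N.
have vf : frame 1%:M (t + n) v.
  move=> i j hi hj; rewrite /v.
  have bound k : (k < t + n)%N -> ~~ (k < t)%N -> (k - t < n)%N.
    by move=> hk; rewrite -leqNgt => hk'; rewrite ltn_subLR.
  case: ifPn => hi'; case: ifPn => hj'.
  + exact: uf.
  + rewrite wS ?bound // (_ : (i == j) = false) ?scale0r //.
    by apply/negbTE; apply: contra hj' => /eqP <-.
  + apply: trmxC_inj; rewrite trmxC_mul trmxCK wS ?bound //.
    rewrite (_ : (i == j) = false) ?scale0r ?trmxC0 //.
    by apply/negbTE; apply: contra hi' => /eqP ->.
  + rewrite wf ?bound //; congr (_%:R *: _); congr nat_of_bool.
    rewrite -!leqNgt in hi' hj'.
    by rewrite -(eqn_add2l t) !subnKC.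
have le_d : (t + n <= d)%N.
  apply: (frame_bound _ _ _ vf); rewrite ?trmxC1 ?mulmx1 //.
  by apply/eqP => /matrixP /(_ 0 0) /eqP; rewrite !mxE oner_eq0.
have sum1 : \sum_(r < t + n) v r *m (v r)^t* = 1%:M.
  apply: mulmx_col_ext => x; rewrite mul1mx.
  pose y := x - \sum_(r < t) u r *m ((u r)^t* *m x).
  have Sy : S y.
    move=> r hr; rewrite mulmxBr mulmx_sumr (bigD1 (Ordinal hr)) //= big1 => [|k hk].
      by rewrite addr0 mulmxA uf // eqxx scale1r mul1mx subrr.
    rewrite (mulmxA ((u r)^t*)) uf // (_ : (r == k) = false) ?scale0r ?mul0mx //.
    by apply/negbTE; rewrite eq_sym; apply: contra hk => /eqP h; apply/eqP/val_inj.
  rewrite mulmx_suml big_split_ord /=.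
  rewrite -[RHS](subrK (\sum_(r < t) u r *m ((u r)^t* *m x))) -/y addrC; congr (_ + _).
    rewrite [RHS](wx y Sy); apply: eq_bigr => r _.
    rewrite /v ltnNge leq_addr /= addKn -mulmxA; congr (_ *m _).
    rewrite mulmxBr mulmx_sumr big1 ?subr0 // => k _.
    rewrite mulmxA (_ : (w r)^t* *m u k = 0) ?mul0mx //.
    by apply: trmxC_inj; rewrite trmxC_mul trmxCK trmxC0 wS.
  by apply: eq_bigr => r _; rewrite /v ltn_ord -mulmxA.
have ge_d : (d <= t + n)%N.
  pose V : 'M[K]_(d, t + n) := \matrix_(i, r) v r i 0.
  have VV : V *m V^t* = 1%:M.
    rewrite -sum1; apply/matrixP => i j; rewrite summxE mxE; apply: eq_bigr => r _.
    by rewrite !mxE big_ord1 !mxE.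
  have := mxrankM_maxl V (V^t*); rewrite VV mxrank1 => h.
  exact: leq_trans h (rank_leq_col _).
pose U : Mat := fun i r => if insub i is Some i' then ofc (v r (i' : 'I_d) 0) else Defs.C0.
have colU r : @ucol d U r = v r.
  by apply/colP => i; rewrite mxE /U valK ofcK.
exists U; split; last by move=> r hr; rewrite colU /v hr.
apply/meq_mx; rewrite mx_mul mx_adj mx_id; apply/matrixP => i j.
have lt (k : 'I_d) : (k < t + n)%N by exact: leq_trans (ltn_ord k) ge_d.
have := congr1 (fun M : 'M[K]_1 => M 0 0) (vf i j (lt i) (lt j)).
rewrite mxE [RHS]mxE => e; rewrite [LHS]mxE [RHS]mxE.
transitivity (((i : nat) == j)%:R * (1%:M : 'M[K]_1) 0 0); last by rewrite mxE eqxx mulr1.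
rewrite -e; apply: eq_bigr => k _; rewrite !mxE -!colU !mxE.
by [].
Qed.

Theorem phase_structure_exists d T : kraus_channel (@sop d T) ->
  exists U bs, phase_structure d T U bs.
Proof.
move=> hT; have [k [P [_ _ Pch Pspan spanP]]] := limit_projection hT.
have PP X : P (P X) = P X by exact: spanP.
have [bs [u [uf hbs hX]]] := idempotent_channel_range Pch PP.
have le_d : (block_total bs <= d)%N.
  apply: (frame_bound _ _ _ uf); rewrite ?trmxC1 ?mulmx1 //.
  by apply/eqP => /matrixP /(_ 0 0) /eqP; rewrite !mxE oner_eq0.
have [U [hU colU]] := frame_extend uf.
exists U, bs; apply/phase_structureP => //; split=> // X.
have -> : phase_span (sop T) X <-> exists Y, X = P Y.
  by split=> [h|[Y ->]] //; exists X; rewrite spanP.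
rewrite hX; suff e Xs : block_sum bs Xs (@ucol d U) = block_sum bs Xs u.
  by split=> -[Xs ->]; exists Xs; rewrite e.
by apply: eq_bigr => r _; apply: eq_bigr => s _; rewrite !colU.
Qed.

(** * Qubit blocks *)

Definition zero_blocks : nat -> Mat := fun _ _ _ => Defs.C0.

Lemma blockdiag_zero bs r s : blockdiag bs zero_blocks r s = Defs.C0.
Proof.
elim: bs r s => [//|[[d1 d2] rho] bs IHbs] r s /=.
case: Nat.ltb; case: Nat.ltb => //.
by rewrite /zero_blocks /Cmul /Defs.C0 /= !Rmult_0_l Rminus_0_r Rplus_0_l.
Qed.

Lemma block_sum_zero d bs (u : nat -> 'cV[K]_d) : block_sum bs zero_blocks u = 0.
Proof. by rewrite /block_sum big1 // => r _; rewrite big1 // => s _; rewrite blockdiag_zero toc0 scale0r. Qed.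

(** The offset [o] is the total size of the preceding blocks; every other block is set to zero. *)
Lemma single_block d bs (u : nat -> 'cV[K]_d) d1 d2 rho : In (d1, d2, rho) bs ->
  exists o, (o + d1 * d2 <= block_total bs)%N /\ forall X0 : Mat, exists Xs,
    block_sum bs Xs u = \sum_(j < d1) \sum_(b < d2) \sum_(k < d1) \sum_(c < d2)
      (toc (X0 j k) * toc (rho b c)) *:
      (u (o + (j * d2 + b))%N *m (u (o + (k * d2 + c))%N)^t*).
Proof.
elim: bs u => [//|[[n1 n2] r0] bs IHbs] u [[-> -> ->]|/IHbs h].
  exists O; split; first exact: leq_addr.
  move=> X0; exists (fun i => if i is 0 then X0 else zero_blocks i).
  by rewrite block_sum_cons (block_sum_zero bs) addr0.
have [o [ho hX]] := h (fun r => u (n1 * n2 + r)%N).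
exists (n1 * n2 + o)%N; split.
  change (block_total ((n1, n2, r0) :: bs)) with (n1 * n2 + block_total bs)%N.
  by rewrite -addnA leq_add2l.
move=> X0; have [Xs hXs] := hX X0.
exists (fun i => if i is i'.+1 then Xs i' else zero_blocks i).
rewrite block_sum_cons [X in X + _]big1 ?add0r => [|j _]; last first.
  by rewrite big1 // => b _; rewrite big1 // => k _; rewrite big1 // => c _;
     rewrite toc0 mul0r scale0r.
rewrite [LHS]hXs; apply: eq_bigr => j _; apply: eq_bigr => b _.
by apply: eq_bigr => k _; apply: eq_bigr => c _; rewrite !addnA.
Qed.

(* A copy [M_2 (x) R] of the qubit matrix units inside the phase subspace. *)
Definition qubit_block d (f : 'M[K]_d -> 'M_d) := exists n (R : 'M[K]_n) (V : bool -> 'M[K]_(d, n)),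
  [/\ psd R, \tr R = 1, forall b c, (V b)^t* *m V c = (b == c)%:R%:M
    & forall b c, phase_span f (V b *m R *m (V c)^t*)].

(** The first two levels of the factor of size [d1] carry the qubit, with [false] and [true] read as
    0 and 1; [V b] embeds the second factor at level [b]. *)
Lemma phase_structure_qubit d T U bs d1 d2 rho : kraus_channel (@sop d T) ->
  phase_structure d T U bs -> In (d1, d2, rho) bs -> (1 < d1)%N -> qubit_block (@sop d T).
Proof.
move=> hT /(phase_structureP _ _ hT) [hU hd hst hX] hin d1_gt1.
have uf := unitary_frame hU hd; set u := @ucol d U in uf.
have [o [ho hblock]] := single_block u hin.
have [psdR trR] := (is_state_mx _ _).1 (hst _ _ _ hin).
pose V (b : bool) : 'M[K]_(d, d2) := \matrix_(i, c) u (o + (b * d2 + c))%N i 0.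
have bd (b : bool) : (b < d1)%N by case: b => //; exact: ltnW.
have lt_o (b : bool) (c : 'I_d2) : (o + (b * d2 + c) < block_total bs)%N.
  apply: leq_trans ho; rewrite ltn_add2l.
  apply: (@leq_trans (b.+1 * d2)); last by rewrite leq_mul2r bd orbT.
  by rewrite mulSnr ltn_add2l.
exists d2, (mx d2 rho), V; split=> //.
  move=> b b'; apply/matrixP => c c'.
  have := congr1 (fun M : 'M[K]_1 => M 0 0) (uf _ _ (lt_o b c) (lt_o b' c')).
  rewrite !mxE eqxx mulr1 eqn_add2l => e.
  transitivity ((b * d2 + c == b' * d2 + c')%N%:R : K).
    by rewrite -e; apply: eq_bigr => i _; rewrite !mxE.
  have d20 : (0 < d2)%N by exact: leq_ltn_trans (leq0n c) _.
  have <- : ((b == b') && (c == c')) = (b * d2 + c == b' * d2 + c')%N.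
    apply/andP/eqP => [[/eqP -> /eqP -> //]|e1].
    have := congr1 (fun m => m %/ d2)%N e1; rewrite !divnMDl // !divn_small // !addn0 => e2.
    have e3 : b = b' by case: (b) (b') e2 => -[].
    by rewrite e3 eqxx; split=> //; move/eqP: e1; rewrite e3 eqn_add2l => /eqP /val_inj ->.
  by rewrite mulrb; case: eqP; case: eqP => //= *; rewrite ?mulr1n ?mul0rn.
move=> b b'; apply/hX.
have [Xs hXs] := hblock (fun j k => if Nat.eqb j (nat_of_bool b) then if Nat.eqb k (nat_of_bool b') then Defs.C1 else Defs.C0 else Defs.C0).
exists Xs; rewrite hXs.
rewrite (bigD1 (Ordinal (bd b))) //= [X in _ + X]big1 ?addr0; last first.
  move=> j hj; rewrite big1 // => c _; rewrite big1 // => k _; rewrite big1 // => c' _.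
  rewrite eqb_eqn (_ : (j == b :> nat) = false) ?toc0 ?mul0r ?scale0r //.
  by apply: contraNF hj => /eqP h; apply/eqP/val_inj.
transitivity (\sum_(c < d2) \sum_(c' < d2) toc (rho c c') *: (u (o + (b * d2 + c))%N *m (u (o + (b' * d2 + c'))%N)^t*)).
  apply/matrixP => i j; rewrite summxE mxE.
  under eq_bigr do rewrite mxE mulr_suml.
  rewrite exchange_big; apply: eq_bigr => c _; rewrite summxE; apply: eq_bigr => c' _.
  by rewrite !mxE big_ord1 !mxE; ring.
apply: eq_bigr => c _.
rewrite (bigD1 (Ordinal (bd b'))) //= [X in _ + X]big1 ?addr0; last first.
  move=> k hk; rewrite big1 // => c' _.
  rewrite !eqb_eqn eqxx (_ : (k == b' :> nat) = false) ?toc0 ?mul0r ?scale0r //.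
  by apply: contraNF hk => /eqP h; apply/eqP/val_inj.
by apply: eq_bigr => c' _; rewrite !eqb_eqn !eqxx toc1 mul1r.
Qed.

Lemma phase_points_commute_span d T : kraus_channel (@sop d T) ->
  (forall Z1 Z2, phase_point d T Z1 -> phase_point d T Z2 ->
     meq d (mmul d Z1 Z2) (mmul d Z2 Z1)) ->
  forall X Y, phase_span (@sop d T) X -> phase_span (@sop d T) Y -> X *m Y = Y *m X.
Proof.
move=> hT comm X Y [n [Z [l [hZ ->]]]] [n' [Z' [l' [hZ' ->]]]].
rewrite mulmx_suml mulmx_sumr; apply: eq_bigr => i _.
rewrite mulmx_suml mulmx_sumr; apply: eq_bigr => j _.
have [->|hi] := eqVneq (Z i) 0; first by rewrite mul0mx mulmx0.
have [->|hj] := eqVneq (Z' j) 0; first by rewrite mul0mx mulmx0.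
have [h1 h2] := hZ i; have [h3 h4] := hZ' j.
have /meq_mx : meq d (mmul d (mat (Z i)) (mat (Z' j))) (mmul d (mat (Z' j)) (mat (Z i))).
  by apply: comm; apply/phase_point_sop; rewrite matK; split=> //; [exists (l i)|exists (l' j)].
by rewrite !mx_mul !matK.
Qed.

(** The two off-diagonal units tensored with [R] multiply, in the two orders, to [R *m R] at
    different levels. Being only sums of phase vectors, they yield noncommuting phase points by
    contraposition. *)
Lemma qubit_block_noncommuting d T : kraus_channel (@sop d T) -> qubit_block (@sop d T) ->
  exists Z1 Z2, phase_point d T Z1 /\ phase_point d T Z2 /\
    ~ meq d (mmul d Z1 Z2) (mmul d Z2 Z1).
Proof.
move=> hT [n [R [V [pR tR VV hV]]]]; apply: contrapT => no.
have comm := phase_points_commute_span hT _ (hV false true) (hV true false).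
have {comm} : V false *m R *m (V true)^t* *m (V true *m R *m (V false)^t*) =
    V true *m R *m (V false)^t* *m (V false *m R *m (V true)^t*).
  apply: comm => Z1 Z2 h1 h2; apply: contrapT => h3; apply: no.
  by exists Z1, Z2.
have red b c : V b *m R *m (V c)^t* *m (V c *m R *m (V b)^t*) = V b *m (R *m R) *m (V b)^t*.
  by rewrite -!mulmxA (mulmxA ((V c)^t*)) VV eqxx mul1mx.
rewrite !red => /(congr1 (fun M => (V false)^t* *m M *m V false)).
have V01 : (V false)^t* *m V true = 0 by rewrite VV raddf0.
have V00 : (V false)^t* *m V false = 1%:M by rewrite VV.
rewrite !mulmxA V00 V01 mul1mx !mul0mx -mulmxA V00 mulmx1 => RR.
have R0 : R = 0 by apply: gram_mx0; rewrite psd_herm.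
by move/eqP: tR; rewrite R0 mxtrace0 eq_sym oner_eq0.
Qed.

Lemma Cabs_normc z : Cabs z = normc (toc z).
Proof. by rewrite /Cabs RsqrtE /= !expr2. Qed.

Lemma cv0_shift_cvC u l : cv0 (fun n => u n - l) -> cvC u l.
Proof.
move=> /cv0_cvC h; have := cvC_add h (cvC_const l); rewrite add0r.
by apply: cvC_ext => n; rewrite subrK.
Qed.

Lemma limit_point_subsequence d T L : limit_point d (spow d T) L ->
  exists h, (forall n, (n <= h n)%N) /\ cvF (fun n => iter (h n) (@sop d T)) (@sop d L).
Proof.
move=> hL.
have ch n : exists p, (n <= p)%N /\ forall i j k l : 'I_d,
    normc (toc (spow d T p i j k l) - toc (L i j k l)) < n.+1%:R^-1.
  have [|p [hp hv]] := hL (/ INR n.+1)%R _ n.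
    by apply: Rinv_0_lt_compat; apply: lt_0_INR; exact/ssrnat.ltP.
  exists p; split; first exact/ssrnat.leP.
  move=> i j k l; rewrite -INRE; apply/RltP.
  have := hv i j k l; rewrite Cabs_normc; apply; exact/ssrnat.ltP.
have [h hh] := choice ch.
exists h; split=> [n|X i j]; first by have [] := hh n.
rewrite (mx_delta_sum X (@sop_linear d L)) summxE.
apply: (@cvC_ext (fun n => \sum_k \sum_l X k l * toc (spow d T (h n) i j k l))).
  move=> n; rewrite -sop_spow (mx_delta_sum X (@sop_linear d _)) summxE.
  apply: eq_bigr => k _; rewrite summxE; apply: eq_bigr => l _.
  by rewrite mxE sop_delta.
apply: cvC_sum => k; rewrite summxE; apply: cvC_sum => l; rewrite mxE sop_delta.
apply: cvC_scale; apply: cv0_shift_cvC => eps he.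
have [N hN] := cv0_inv he; exists N => n hn.
have [_ h2] := hh n; apply: lt_trans (h2 i j k l) _.
have := hN n hn; rewrite normcV normcMn normc1; exact.
Qed.

(** The index order in [tau c b] is that of the transpose: this is positivity of the partial
    transpose of a product, tested on the vector with components [x b]. *)
Lemma psd_bilinear n (A : 'M[K]_n) m (x : 'I_m -> 'cV[K]_n) (tau : Mat) :
  psd A -> PSD m tau ->
  0 <= \sum_(b < m) \sum_(c < m) toc (tau c b) * ((x b)^t* *m A *m x c) 0 0.
Proof.
move=> /psd_factor [B ->] /PSD_mx ht.
pose y s : 'cV[K]_m := \col_b ((x b)^t* *m B) 0 s.
suff -> : \sum_(b < m) \sum_(c < m) toc (tau c b) * ((x b)^t* *m (B *m B^t*) *m x c) 0 0 =
    \sum_s ((y s)^t* *m mx m tau *m y s) 0 0.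
  by apply: sumr_ge0 => s _; exact: ht.
transitivity (\sum_(b < m) \sum_(c < m) \sum_s (y s c 0)^* * toc (tau c b) * y s b 0).
  apply: eq_bigr => b _; apply: eq_bigr => c _.
  rewrite mulmxA -mulmxA mxE mulr_sumr; apply: eq_bigr => s _.
  have -> : (B^t* *m x c) s 0 = (y s c 0)^*.
    rewrite -[B^t* *m x c]trmxCK mxE mxE trmxC_mul trmxCK.
    by rewrite !mxE.
  by rewrite [y s b 0]mxE; ring.
under eq_bigr do rewrite exchange_big.
rewrite exchange_big; apply: eq_bigr => s _.
rewrite mxE; apply: eq_bigr => b _.
rewrite [X in _ = X * _]mxE mulr_suml; apply: eq_bigr => c _.
by rewrite !mxE.
Qed.

(* If [L] broke entanglement then so would [P = S L]; but [P] fixes the maximally entangled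
   qubit state carried by [V], whose partial transpose is not positive. *)
Theorem qubit_block_saving d T : kraus_channel (@sop d T) -> qubit_block (@sop d T) ->
  asymptotically_entanglement_saving d T.
Proof.
move=> hT [n [R [V [pR tR VV hV]]]] L hL eb.
have [h [hh hLf]] := limit_point_subsequence hL.
have [k [P [hk hP _ _ spanP]]] := limit_projection hT.
have [_ [S [_ _ Sch SL]]] := limit_quotient hT hh hk hLf hP.
pose Vb b := V (b == 1)%N.
(* The slices of the maximally entangled state, one for each matrix unit of the second factor; one
   half normalizes the trace. *)
pose X b b' := 2%:R^-1 *: (Vb b *m R *m (Vb b')^t*) : 'M[K]_d.
pose rho : Mat := fun r s => mat (X (Nat.modulo r 2) (Nat.modulo s 2)) (Nat.div r 2) (Nat.div s 2).
have blX b b' : (b < 2)%N -> (b' < 2)%N -> slice d 2 rho b b' = X b b'.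
  move=> hb hb'; apply/matrixP => i j; rewrite mxE /rho.
  have [-> ->] := block_index i hb; have [-> ->] := block_index j hb'.
  by rewrite matE ofcK.
have h2 : 0 < 2%:R^-1 :> K by rewrite invr_gt0 ltr0n.
have st : is_state (d * 2) rho.
  apply/is_state_mx; split.
    apply/slice_psd => x.
    pose z : 'cV[K]_n := \sum_(b < 2) (Vb b)^t* *m col b x.
    suff -> : \sum_(i < d) \sum_(b < 2) \sum_(j < d) \sum_(b' < 2)
        (x i b)^* * (slice d 2 rho b b' i j * x j b') = 2%:R^-1 * (z^t* *m R *m z) 0 0.
      by apply: mulr_ge0; [exact: ltW|exact: pR].
    rewrite exchange_big /z trmxC_sum !mulmx_suml summxE mulr_sumr.
    apply: eq_bigr => b _ /=.
    transitivity (\sum_(b' < 2) \sum_(i < d) \sum_(j < d)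
        (x i b)^* * (slice d 2 rho b b' i j * x j b')).
      rewrite [RHS]exchange_big; apply: eq_bigr => i _ /=; exact: exchange_big.
    rewrite mulmx_sumr summxE mulr_sumr; apply: eq_bigr => b' _.
    rewrite blX // trmxC_mul trmxCK !mulmxA.
    rewrite -[_ *m Vb b *m R *m _]mulmxA -!mulmxA [Vb b *m _]mulmxA [_ *m (_ *m col b' x)]mulmxA.
    transitivity (((col b x)^t* *m X b b' *m col b' x) 0 0).
      rewrite -mulmxA mxE; apply: eq_bigr => i _; rewrite !mxE mulr_sumr.
      by apply: eq_bigr => j _; rewrite !mxE.
    by rewrite /X -scalemxAr -scalemxAl mxE !mulmxA.
  have tr1 b : \tr (Vb b *m R *m (Vb b)^t*) = 1.
    by rewrite mxtrace_mulC mulmxA VV eqxx mul1mx.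
  rewrite slice_trace (eq_bigr (fun=> 2%:R^-1)) => [|b _].
    by rewrite sumr_const card_ord -[_ *+ 2]mulr_natl mulfV // pnatr_eq0.
  by rewrite blX // /X mxtraceZ tr1 mulr1.
have [m [p [sig [tau [hst [_ hsep]]]]]] := eb 2 rho st.
have key b b' : (b < 2)%N -> (b' < 2)%N -> X b b' =
    \sum_(t < m) (toc (mkC (p t) 0%R) * toc (tau t b b')) *: S (mx d (sig t)).
  move=> hb hb'.
  have PX : P (X b b') = X b b'.
    by apply: spanP; apply: (phase_spanZ hT); exact: hV.
  rewrite -PX -SL -blX // -slice_ampl //.
  have /slice_eq -> // := hsep.
  rewrite (_ : slice _ _ _ _ _ = \sum_(t < m) toc (mkC (p t) 0%R) *: slice d 2 (kron 2 (sig t) (tau t)) b b').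
    rewrite channel_sum //; apply: eq_bigr => t _.
    by rewrite slice_kron // scalerA channelZ.
  apply/matrixP => i j; rewrite summxE mxE toc_sum; apply: eq_bigr => t _.
  by rewrite !mxE tocM.
have [c hc] : exists c, 0 < R c c.
  apply: contrapT => no.
  have : \tr R <= 0.
    apply: sumr_le0 => c _; have := psd_diag c pR; rewrite le_eqVlt => /orP [/eqP <- //|c0].
    by case: no; exists c.
  by rewrite tR ler10.
(* The exchange of [b] and [b'] in [X b' b] is the partial transpose, which separability keeps
   positive. *)
have pos (y : nat -> 'cV[K]_d) : 0 <= \sum_(b < 2) \sum_(b' < 2) ((y b)^t* *m X b' b *m y b') 0 0.
  rewrite (_ : \sum_(b < 2) _ = \sum_(t < m) toc (mkC (p t) 0%R) *
     \sum_(b < 2) \sum_(b' < 2) toc (tau t b' b) * ((y b)^t* *m S (mx d (sig t)) *m y b') 0 0).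
    apply: sumr_ge0 => t _; have lt : (t < m)%coq_nat by apply/ssrnat.ltP.
    have [hp [/is_state_mx [hs _] [ht _]]] := hst t lt.
    apply: mulr_ge0; first by apply/toc_ge0.
    by apply: (psd_bilinear (fun b : 'I_2 => y b) (kraus_channel_psd Sch hs) ht).
  under [RHS]eq_bigr do rewrite mulr_sumr.
  rewrite [RHS]exchange_big; apply: eq_bigr => b _ /=.
  under [RHS]eq_bigr do rewrite mulr_sumr.
  rewrite [RHS]exchange_big; apply: eq_bigr => b' _ /=.
  rewrite key // mulmx_sumr mulmx_suml summxE; apply: eq_bigr => t _.
  by rewrite -scalemxAr -scalemxAl mxE mulrA.
pose e : 'cV[K]_n := delta_mx c 0.
(* The antisymmetric vector of the two levels, at a coordinate where [R c c > 0]. The partial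
   transpose of the entangled state takes the value [- R c c] on it. *)
pose y (b : nat) : 'cV[K]_d := (-1) ^+ b *: (V (b == 0)%N *m e).
have form q r s t : ((V q *m e)^t* *m (2%:R^-1 *: (V r *m R *m (V s)^t*)) *m (V t *m e)) 0 0
    = 2%:R^-1 * ((q == r)%:R * (s == t)%:R * R c c).
  rewrite -scalemxAr -scalemxAl mxE; congr (_ * _).
  rewrite trmxC_mul -!mulmxA (mulmxA ((V q)^t*)) VV (mulmxA ((V s)^t*)) VV.
  by rewrite !mul_scalar_mx -!scalemxAr !scalemxE mulmxA delta_form mulrA.
have sum22 (g : nat -> nat -> K) : \sum_(b < 2) \sum_(b' < 2) g b b' =
    g 0%N 0%N + g 0%N 1%N + (g 1%N 0%N + g 1%N 1%N).
  by rewrite !big_ord_recl !big_ord0 !addr0.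
have term b b' : ((y b)^t* *m X b' b *m y b') 0 0 = (-1) ^+ b * (-1) ^+ b' *
    (2%:R^-1 * (((b == 0)%N == (b' == 1)%N)%:R * ((b == 1)%N == (b' == 0)%N)%:R * R c c)).
  rewrite -form /y trmxCZ rmorphXn rmorphN1 -!scalemxAl -scalemxAr !scalemxE.
  by rewrite mulrA.
have := pos y; under eq_bigr do under eq_bigr do rewrite term.
rewrite (sum22 (fun b b' : nat => (-1) ^+ b * (-1) ^+ b' *
  (2%:R^-1 * (((b == 0)%N == (b' == 1)%N)%:R * ((b == 1)%N == (b' == 0)%N)%:R * R c c)))) /=.
set r := R c c in hc *; rewrite (_ : _ + _ = - r); last by field.
by rewrite oppr_ge0 => /(lt_le_trans hc); rewrite ltxx.
Qed.

(** * Commutative phase subspaces *)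

(** [R i] is the state of a block of size one and [Q i] the projection onto its support space, which
    reads off the coefficient of [R i]. The clause about vectors orthogonal to the frame carries
    orthogonality to a new head block through the induction. *)
Lemma classical_blocks d bs (u : nat -> 'cV[K]_d) : frame 1%:M (block_total bs) u ->
  (forall d1 d2 r0, In (d1, d2, r0) bs -> is_state d2 r0 /\ (d1 <= 1)%N) ->
  exists m (R Q : nat -> 'M[K]_d),
  [/\ forall i, (i < m)%N -> [/\ psd (R i), \tr (R i) = 1 & psd (Q i)],
      forall i (x : 'cV[K]_d), (i < m)%N ->
        (forall r, (r < block_total bs)%N -> (u r)^t* *m x = 0) -> R i *m x = 0 /\ Q i *m x = 0,
      forall i j, (i < m)%N -> (j < m)%N -> i != j -> R i *m R j = 0,
      forall i j, (i < m)%N -> (j < m)%N -> \tr (Q i *m R j) = (i == j)%:R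
    & forall X, (exists Xs, X = block_sum bs Xs u) <-> exists c : nat -> K, X = \sum_(i < m) c i *: R i].
Proof.
elim: bs u => [|[[d1 d2] r0] bs IHbs] u uf hbs.
  exists O, (fun=> 0), (fun=> 0); split=> // X.
  split=> -[c ->].
    by exists (fun=> 0); rewrite block_sum_nil big_ord0.
  by exists zero_blocks; rewrite block_sum_nil big_ord0.
have tot : block_total ((d1, d2, r0) :: bs) = (d1 * d2 + block_total bs)%N by [].
rewrite tot in uf *.
have [hr0 d1_le1] := hbs d1 d2 r0 (or_introl erefl).
pose u' r := u (d1 * d2 + r)%N.
have uf' : frame 1%:M (block_total bs) u'.
  by move=> i j hi hj; rewrite /u' uf ?ltn_add2l // eqn_add2l.
have hbs' : forall d1 d2 r0, In (d1, d2, r0) bs -> is_state d2 r0 /\ (d1 <= 1)%N.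
  by move=> n1 n2 r1 h; apply: (hbs n1 n2 r1); right.
have [m [R [Q [hst hker orth dual hX]]]] := IHbs u' uf' hbs'.
(* A block with [d1 = 0] is empty and contributes no state. *)
case: d1 d1_le1 uf tot @u' uf' hst hker orth dual hX {hbs} => [|[|//]] _.
  rewrite mul0n => uf _ u' uf' hst hker orth dual hX.
  exists m, R, Q; split=> // X; rewrite -hX.
  by split=> -[Xs ->]; [exists (fun i => Xs i.+1)|exists (fun i => if i is i'.+1 then Xs i' else zero_blocks i)];
     rewrite block_sum_cons big_ord0 add0r.
rewrite mul1n => uf _ u' uf' hst hker orth dual hX.
have [psd0 tr0] := (is_state_mx _ _).1 hr0.
pose V : 'M[K]_(d, d2) := \matrix_(i, b) u b i 0.
have VV : V^t* *m V = 1%:M.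
  apply/matrixP => b c.
  have := congr1 (fun M : 'M[K]_1 => M 0 0) (uf b c (ltn_addr _ (ltn_ord b)) (ltn_addr _ (ltn_ord c))).
  rewrite !mxE eqxx mulr1 -[b == c]/(nat_of_ord b == c) => <-.
  by apply: eq_bigr => i _; rewrite !mxE.
pose R0 := V *m mx d2 r0 *m V^t*; pose Q0 := V *m V^t*.
have R0H : R0^t* = R0 by exact/psd_herm/psd_conj.
have Q0H : Q0^t* = Q0 by rewrite trmxC_mul trmxCK.
have killV (x : 'cV[K]_d) : (forall b, (b < d2)%N -> (u b)^t* *m x = 0) -> V^t* *m x = 0.
  move=> hx; apply/matrixP => b k; rewrite (ord1 k).
  have := congr1 (fun M : 'M[K]_1 => M 0 0) (hx b (ltn_ord b)).
  by rewrite !mxE => e0; rewrite -[RHS]e0; apply: eq_bigr => i _; rewrite !mxE.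
have kerV i : (i < m)%N -> R i *m V = 0 /\ Q i *m V = 0.
  move=> hi.
  have hb (b : 'I_d2) : R i *m u b = 0 /\ Q i *m u b = 0.
    apply: hker => // r hr; rewrite /u' uf ?ltn_add2l ?ltn_addr ?ltn_ord //.
    by rewrite gtn_eqF ?scale0r // ltn_addr.
  split; apply/matrixP => a b; rewrite [RHS]mxE.
    have [h _] := hb b; have := congr1 (fun M : 'cV[K]_d => M a 0) h.
    by rewrite !mxE => e0; rewrite -[RHS]e0; apply: eq_bigr => k _; rewrite !mxE.
  have [_ h] := hb b; have := congr1 (fun M : 'cV[K]_d => M a 0) h.
  by rewrite !mxE => e0; rewrite -[RHS]e0; apply: eq_bigr => k _; rewrite !mxE.
pose R' i := if i is i'.+1 then R i' else R0.
pose Q' i := if i is i'.+1 then Q i' else Q0.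
have RR0 i : (i < m)%N -> R i *m R0 = 0.
  by move=> /kerV [h _]; rewrite /R0 !mulmxA h !mul0mx.
have R0R i : (i < m)%N -> R0 *m R i = 0.
  move=> hi; have [h1 _ _] := hst i hi.
  by apply: trmxC_inj; rewrite trmxC_mul R0H (psd_herm h1) RR0 // trmxC0.
exists m.+1, R', Q'; split.
- move=> [|i] hi; last exact: hst.
  split; [exact: psd_conj| |exact: psd_gram].
  by rewrite /= /R0 mxtrace_mulC mulmxA VV mul1mx.
- move=> [|i] x hi hx /=.
    have h0 : V^t* *m x = 0 by apply: killV => b hb; apply: hx; rewrite ltn_addr.
    by rewrite /R0 /Q0 -!mulmxA h0 !mulmx0.
  by apply: hker => // r hr; apply: hx; rewrite ltn_add2l.
- move=> [|i] [|j] //= hi hj; [by move=> _; exact: R0R|by move=> _; exact: RR0|by rewrite eqSS; apply: orth].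
- move=> [|i] [|j] //= hi hj.
  + by rewrite /Q0 /R0 mxtrace_mulC !mulmxA -(mulmxA _ (V^t*)) VV mulmx1 mxtrace_mulC mulmxA VV mul1mx.
  + have [h1 _ _] := hst j hj; have [h2 _] := kerV j hj.
    have h3 : V^t* *m R j = 0.
      by apply: trmxC_inj; rewrite trmxC_mul trmxCK (psd_herm h1) h2 trmxC0.
    by rewrite /Q0 -mulmxA h3 mulmx0 mxtrace0.
  + by have [_ h] := kerV i hi; rewrite /R0 !mulmxA h !mul0mx mxtrace0.
  + by rewrite dual.
have headE (X0 : Mat) : \sum_(j < 1) \sum_(b < d2) \sum_(k < 1) \sum_(c < d2)
    (toc (X0 j k) * toc (r0 b c)) *: (u (j * d2 + b)%N *m (u (k * d2 + c)%N)^t*) =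
    toc (X0 0%N 0%N) *: R0.
  rewrite big_ord1; apply/matrixP => a a'; rewrite summxE [RHS]mxE /R0 [X in _ = _ * X]mxE.
  under [X in _ = _ * X]eq_bigr do rewrite mxE mulr_suml.
  rewrite [X in _ = _ * X]exchange_big mulr_sumr; apply: eq_bigr => b _.
  rewrite big_ord1 summxE mulr_sumr; apply: eq_bigr => c _.
  by rewrite !mxE big_ord1 !mxE !mul0n !add0n; ring.
move=> X; split=> [[Xs ->]|[c ->]].
  rewrite block_sum_cons headE mul1n.
  have [c hc] := (hX _).1 (ex_intro _ (fun i => Xs i.+1) erefl).
  exists (fun i => if i is i'.+1 then c i' else toc (Xs O O O)).
  by rewrite big_ord_recl /= [X in _ + X]hc.
have [Xs hXs] := (hX _).2 (ex_intro _ (fun i => c i.+1) erefl).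
exists (fun i => if i is i'.+1 then Xs i' else fun _ _ => ofc (c O)).
by rewrite block_sum_cons (headE (fun _ _ => ofc (c O))) mul1n big_ord_recl /= ofcK [X in _ + X]hXs.
Qed.

Lemma normc_le_ReIm (z : K) : normc z <= `|complex.Re z| + `|complex.Im z|.
Proof.
case: z => a b /=; rewrite -ler_sqr ?nnegrE ?sqrtr_ge0 ?addr_ge0 ?normr_ge0 //.
rewrite sqr_sqrtr ?addr_ge0 ?sqr_ge0 // sqrrD !real_normK ?num_real //.
by rewrite addrAC lerDl mulrn_wge0 // mulr_ge0.
Qed.

Lemma cvC_normc u l : cvC u l -> forall eps : R, 0 < eps ->
  exists N, forall n, (N <= n)%N -> normc (u n - l) < eps.
Proof.
move=> [h1 h2] eps he; have /RltP e2 : 0 < eps / 2%:R by rewrite divr_gt0 ?ltr0n.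
have [N1 hN1] := h1 _ e2; have [N2 hN2] := h2 _ e2.
exists (maxn N1 N2) => n; rewrite geq_max => /andP [/ssrnat.leP /hN1 k1 /ssrnat.leP /hN2 k2].
apply: le_lt_trans (normc_le_ReIm _) _; rewrite !raddfB /= (splitr eps).
by move: k1 k2; rewrite !RdistE => /RltP k1 /RltP k2; exact: ltrD.
Qed.

Definition superop_of d (P : 'M[K]_d -> 'M[K]_d) : Superop := fun i j k l =>
  mat (P (\matrix_(a, b) ((a == k :> nat) && (b == l :> nat))%:R)) i j.

Lemma toc_superop_of d (P : 'M[K]_d -> 'M[K]_d) (i j k l : 'I_d) :
  toc (superop_of P i j k l) = P (delta_mx k l) i j.
Proof.
by rewrite /superop_of matE ofcK; congr (P _ i j); apply/matrixP => a b; rewrite !mxE.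
Qed.

Lemma sop_superop_of d (P : 'M[K]_d -> 'M[K]_d) X : kraus_channel P ->
  sop (superop_of P) X = P X.
Proof.
move=> hP; rewrite (mx_delta_sum X (@sop_linear d _)).
rewrite (mx_delta_sum X (kraus_channel_linear hP)).
apply: eq_bigr => k _; apply: eq_bigr => l _; congr (_ *: _).
by apply/matrixP => i j; rewrite sop_delta toc_superop_of.
Qed.

Lemma limit_point_superop_of d T k (P : 'M[K]_d -> 'M[K]_d) : (forall n, (n <= k n)%N) ->
  cvF (fun n => iter (k n) (@sop d T)) P -> limit_point d (spow d T) (superop_of P).
Proof.
move=> hk hP eps /RltP he N.
pose I := ('I_d * 'I_d * 'I_d * 'I_d)%type.
have ch (t : I) : exists M, forall n, (M <= n)%N -> normc (toc (spow d T (k n) t.1.1.1 t.1.1.2 t.1.2 t.2)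
     - toc (superop_of P t.1.1.1 t.1.1.2 t.1.2 t.2)) < eps.
  have [M hM] := cvC_normc (hP (delta_mx t.1.2 t.2) t.1.1.1 t.1.1.2) he.
  exists M => n /hM; rewrite -sop_spow sop_delta toc_superop_of.
  exact.
have [M hM] := choice ch.
pose n := maxn N (\max_(t : I) M t).
exists (k n); split.
  by apply/ssrnat.leP; apply: leq_trans (hk n); exact: leq_maxl.
move=> i j a b /ssrnat.ltP hi /ssrnat.ltP hj /ssrnat.ltP ha /ssrnat.ltP hb.
pose t : I := (Ordinal hi, Ordinal hj, Ordinal ha, Ordinal hb).
have := hM t n; rewrite Cabs_normc => h; apply/RltP; apply: h.
by apply: leq_trans (leq_maxr _ _); exact: leq_bigmax.
Qed.

Lemma psd_mul_trace n (A B : 'M[K]_n) : psd A -> psd B -> 0 <= \tr (A *m B).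
Proof.
move=> /psd_factor [C ->] hB; rewrite -mulmxA mxtrace_mulC.
by apply: psd_tr_ge0; have := psd_conj (C^t*) hB; rewrite trmxCK.
Qed.

(** A positive functional is completely positive: pairing with [y] gives [phi X], where [X] is the
    contraction of [rho] with [y] on the second factor and hence positive. *)
Lemma slice_functional_psd d k rho (phi : 'M[K]_d -> K) :
  psd (mx (d * k) rho) -> (forall X, psd X -> 0 <= phi X) ->
  (forall c X Y, phi (c *: X + Y) = c * phi X + phi Y) ->
  psd (\matrix_(b < k, b' < k) phi (slice d k rho b b')).
Proof.
move=> /slice_psd hr pos lin y.
have phi0 : phi 0 = 0.
  have := lin 1 0 0; rewrite scale1r addr0 mul1r => /eqP.
  by rewrite -subr_eq subrr eq_sym => /eqP.
have phi_sum (I : finType) (c : I -> K) (X : I -> 'M[K]_d) :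
    phi (\sum_i c i *: X i) = \sum_i c i * phi (X i).
  elim: (index_enum I) => [|i s IHs]; first by rewrite !big_nil phi0.
  by rewrite !big_cons lin IHs.
pose X : 'M[K]_d := \sum_(p : 'I_k * 'I_k) ((y p.1 0)^* * y p.2 0) *: slice d k rho p.1 p.2.
have pX : psd X.
  move=> x; have := hr (\matrix_(i, b) (x i 0 * y b 0)); congr (0 <= _).
  rewrite -mulmxA mxE; apply: eq_bigr => i _.
  rewrite exchange_big [Z in _ = _ * Z]mxE mulr_sumr; apply: eq_bigr => j _ /=.
  rewrite /X summxE mulr_suml mulr_sumr -(pair_bigA _ (fun b b' => (x^t*) 0 i *
     ((((y b 0)^* * y b' 0) *: slice d k rho b b') i j * x j 0))) /=.
  by apply: eq_bigr => b _; apply: eq_bigr => b' _; rewrite !mxE rmorphM; ring.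
suff -> : (y^t* *m (\matrix_(b < k, b' < k) phi (slice d k rho b b')) *m y) 0 0 = phi X.
  exact: pos.
rewrite /X phi_sum -(pair_bigA _ (fun b b' => (y b 0)^* * y b' 0 * phi (slice d k rho b b'))) /=.
rewrite -mulmxA mxE; apply: eq_bigr => b _; rewrite [Z in _ * Z = _]mxE mulr_sumr.
by apply: eq_bigr => b' _; rewrite !mxE; ring.
Qed.

(** The output is the sum of the [R i] tensored with [S i], the image of the input under [phi i] on
    its first factor. The weights are the traces of the [S i], and trace preservation makes them sum
    to 1. *)
Lemma measure_prepare_breaking d (P : 'M[K]_d -> 'M[K]_d) m (R : nat -> 'M[K]_d)
    (phi : nat -> 'M[K]_d -> K) : kraus_channel P ->
  (forall i, (i < m)%N -> [/\ psd (R i), \tr (R i) = 1,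
     forall X, psd X -> 0 <= phi i X
   & forall c X Y, phi i (c *: X + Y) = c * phi i X + phi i Y]) ->
  (forall X, P X = \sum_(i < m) phi i X *: R i) ->
  entanglement_breaking d (superop_of P).
Proof.
move=> hP hR PE k rho /is_state_mx [pr tr].
have k0 : (0 < k)%N.
  rewrite lt0n; apply/eqP => e; move/eqP: tr.
  by rewrite slice_trace e big_ord0 eq_sym oner_eq0.
pose S i : 'M[K]_k := \matrix_(b < k, b' < k) phi i (slice d k rho b b').
have pS i : (i < m)%N -> psd (S i).
  by move=> /hR [_ _ h1 h2]; exact: slice_functional_psd.
pose E0 : 'M[K]_k := delta_mx (Ordinal k0) (Ordinal k0).
have pE0 : psd E0 /\ \tr E0 = 1.
  split.
    have -> : E0 = (delta_mx (Ordinal k0) 0 : 'cV_k) *m (delta_mx (Ordinal k0) 0 : 'cV_k)^t*.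
      by rewrite trmx_delta map_delta_mx mul_delta_mx.
    exact: psd_gram.
  by rewrite /mxtrace (bigD1 (Ordinal k0)) //= big1 ?addr0 => [|i hi]; rewrite mxE ?eqxx // (negPf hi).
(* An outcome of weight zero has [S i = 0]; the state [E0] serves there as a default. *)
pose tau i := if \tr (S i) == 0 then E0 else (\tr (S i))^-1 *: S i.
have htau i : (i < m)%N -> is_state k (mat (tau i)).
  move=> hi; apply/is_state_mx; rewrite matK /tau; case: eqP => [_ //|/eqP h].
  split; last by rewrite mxtraceZ mulVf.
  by apply: psdZ (pS i hi); rewrite invr_ge0 psd_tr_ge0 //; exact: pS.
have Stau i : (i < m)%N -> S i = \tr (S i) *: tau i.
  move=> hi; rewrite /tau; case: eqP => [h|/eqP h].
    by rewrite (psd_tr0 (pS i hi) h) mxtrace0 scale0r.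
  by rewrite scalerA mulfV // scale1r.
pose p i : Rdefinitions.R := complex.Re (\tr (S i)).
have pE i : (i < m)%N -> toc (mkC (p i) (IZR 0)) = \tr (S i).
  move=> hi; have /ger0_Im := psd_tr_ge0 (pS i hi).
  by rewrite /toc /p /=; case: (\tr (S i)) => a b /= ->.
exists m, p, (fun i => mat (R i)), (fun i => mat (tau i)); split; last split.
- move=> i /ssrnat.ltP hi; split.
    by have /toc_ge0 [] : 0 <= toc (mkC (p i) (IZR 0)) by rewrite pE // psd_tr_ge0 //; exact: pS.
  split; last exact: htau.
  by apply/is_state_mx; rewrite matK; have [] := hR i hi.
- apply: (can_inj tocK); rewrite toc_sum toc1.
  rewrite (eq_bigr (fun i : 'I_m => \tr (S i))) => [|i _]; last exact: pE.
  rewrite -[RHS]tr slice_trace exchange_big; apply: eq_bigr => b _ /=.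
  rewrite -(kraus_channel_trace _ hP) PE linear_sum; apply: eq_bigr => i _ /=.
  by have [_ h _ _] := hR i (ltn_ord i); rewrite mxtraceZ h mulr1 mxE.
apply/slice_eq => b b' hb hb'; rewrite slice_ampl // sop_superop_of // PE.
transitivity (\sum_(t < m) toc (mkC (p t) 0%R) *: slice d k (kron k (mat (R t)) (mat (tau t))) b b').
  apply: eq_bigr => i _; rewrite slice_kron // matK scalerA; congr (_ *: _).
  rewrite pE // (matE _ (Ordinal hb) (Ordinal hb')) ofcK.
  have /matrixP /(_ (Ordinal hb) (Ordinal hb')) := Stau i (ltn_ord i).
  by rewrite !mxE.
apply/matrixP => i j; rewrite summxE mxE toc_sum; apply: eq_bigr => t _.
by rewrite !mxE tocM.
Qed.

(** The coefficient of [R i] in [P X] is the trace of [Q i *m P X], a positive functional of [X]; so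
    the limit [P] measures and prepares, and as a limit point it contradicts (1). *)
Lemma classical_structure_breaking d T U bs : kraus_channel (@sop d T) ->
  phase_structure d T U bs -> (forall d1 d2 rho, In (d1, d2, rho) bs -> (d1 <= 1)%N) ->
  (forall Z1 Z2, phase_point d T Z1 -> phase_point d T Z2 ->
     meq d (mmul d Z1 Z2) (mmul d Z2 Z1)) /\
  ~ asymptotically_entanglement_saving d T.
Proof.
move=> hT /(phase_structureP _ _ hT) [hU hd hst hX] le1.
have [m [R [Q [hR _ orth dual hspan]]]] :=
  classical_blocks (unitary_frame hU hd) (fun d1 d2 rho h => conj (hst _ _ _ h) (le1 _ _ _ h)).
split.
  move=> Z1 Z2 /phase_point_sop [_ [l1 [e1 n1]]] /phase_point_sop [_ [l2 [e2 n2]]].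
  have [c1 h1] := (hspan _).1 ((hX _).1 (phase_span1 e1 n1)).
  have [c2 h2] := (hspan _).1 ((hX _).1 (phase_span1 e2 n2)).
  apply/meq_mx; rewrite !mx_mul h1 h2.
  have prod (a b : nat -> K) : (\sum_(i < m) a i *: R i) *m (\sum_(i < m) b i *: R i) =
      \sum_(i < m) (a i * b i) *: (R i *m R i).
    rewrite mulmx_suml; apply: eq_bigr => i _; rewrite mulmx_sumr (bigD1 i) //= big1 ?addr0.
      by rewrite -scalemxAl -scalemxAr scalerA.
    by move=> j ji; rewrite -scalemxAl -scalemxAr orth ?scaler0 // eq_sym.
  by rewrite !prod; apply: eq_bigr => i _; rewrite mulrC.
have [k [P [hk hP Pch Pspan _]]] := limit_projection hT.
move=> /(_ _ (limit_point_superop_of hk hP)); apply.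
apply: (@measure_prepare_breaking _ P m R (fun i X => \tr (Q i *m P X))) => //.
  move=> i hi; have [h1 h2 h3] := hR i hi; split=> // [X hX0|c X Y].
    exact: (psd_mul_trace h3 (kraus_channel_psd Pch hX0)).
  by rewrite (kraus_channel_linear Pch) mulmxDr -scalemxAr mxtraceD mxtraceZ.
move=> X; have [c hc] := (hspan _).1 ((hX _).1 (Pspan X)).
rewrite {1}hc; apply: eq_bigr => i _; congr (_ *: _).
rewrite hc mulmx_sumr linear_sum (bigD1 i) //= big1 ?addr0 => [|j ji].
  by rewrite -scalemxAr mxtraceZ dual // eqxx mulr1.
rewrite -scalemxAr mxtraceZ dual // (_ : (nat_of_ord i == j) = false) ?mulr0 //.
by apply/negbTE; rewrite eq_sym.
Qed.

Theorem mainTheorem17 (d : nat) (T : Superop) (HT : quantum_channel d T) :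
  (asymptotically_entanglement_saving d T <->
     exists (U : Mat) (bs : list (nat * nat * Mat)),
       phase_structure d T U bs /\
       exists d1 d2 rho, In (d1, d2, rho) bs /\ (d1 > 1)%coq_nat) /\
  ((exists (U : Mat) (bs : list (nat * nat * Mat)),
       phase_structure d T U bs /\
       exists d1 d2 rho, In (d1, d2, rho) bs /\ (d1 > 1)%coq_nat) <->
     exists Z1 Z2 : Mat, phase_point d T Z1 /\ phase_point d T Z2 /\
       ~ meq d (mmul d Z1 Z2) (mmul d Z2 Z1)).
Proof.
have hT := quantum_channel_kraus HT.
set big_block := (X in (_ <-> X) /\ _).
have quantum : big_block -> qubit_block (@sop d T).
  move=> [U [bs [hU [d1 [d2 [rho [hin /ssrnat.ltP h1]]]]]]].
  exact: phase_structure_qubit hU hin h1.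
have classical : ~ big_block -> (forall Z1 Z2, phase_point d T Z1 -> phase_point d T Z2 ->
    meq d (mmul d Z1 Z2) (mmul d Z2 Z1)) /\ ~ asymptotically_entanglement_saving d T.
  move=> no; have [U [bs hU]] := phase_structure_exists hT.
  apply: (classical_structure_breaking hT hU) => d1 d2 rho hin.
  rewrite leqNgt; apply/negP => /ssrnat.ltP h1; apply: no.
  by exists U, bs; split=> //; exists d1, d2, rho.
split; split.
- by move=> aes; apply: contrapT => /classical [].
- by move=> /quantum; exact: qubit_block_saving.
- by move=> /quantum; exact: qubit_block_noncommuting.
move=> [Z1 [Z2 [h1 [h2 nc]]]]; apply: contrapT => /classical [comm _].
by apply: nc; exact: comm.
Qed.
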